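(* Let $f\in C^\infty(\mathbb{R}^d)$ be a tempered distribution, and suppose the set $\{\lambda\in\mathbb{R}^d:|P(i\lambda)|\le R_0\}$ is compact for a polynomial $P$ and a constant $R_0\ge 0$. Then the support of $\mathcal{F}f$ is contained in $\{\lambda\in\mathbb{R}^d:|P(i\lambda)|\le R_0\}$ if, and only if, for each $R>R_0$, there exist constants $N_R\in\mathbb{N}_0$ and $C_R\ge 0$ such that $$|P(\partial)^n f(x)|\le C_R\,n^{N_R}R^n(1+|x|)^{N_R}$$ for all $n\in\mathbb{N}$ and $x\in\mathbb{R}^d$. If this is the case then, for all $R>R_0$, one can in fact take $N_R$ equal to the order of $\mathcal{F}f$ in this inequality.
   Context: $\mathbb{N}=\{1,2,3,\ldots\}$, $\mathbb{N}_0=\{0,1,2,\ldots\}$. Polynomials are on $\mathbb{R}^d$ with complex coefficients. For a polynomial $P$, $P(\partial)$ is the corresponding constant coefficient differential operator, so that $P(\partial)e^{i\lambda\cdot x}=P(i\lambda)e^{i\lambda\cdot x}$. The Fourier transform is $\mathcal{F}f(\lambda)=(2\pi)^{-d/2}\int_{\mathbb{R}^d}f(x)e^{-i\lambda\cdot x}\,dx$ on $L^1(\mathbb{R}^d)$, extended to tempered distributions by $\langle\mathcal{F}T,\phi\rangle=\langle T,\mathcal{F}\phi\rangle$ for Schwartz functions $\phi$. *)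

(* Defs.v *)
From HB Require Import structures.
From mathcomp Require Import all_boot all_order all_algebra.
From mathcomp Require Import all_classical all_reals all_analysis.
From mathcomp Require Import complex.
From mathcomp Require mpoly.

Set Implicit Arguments.
Unset Strict Implicit.
Unset Printing Implicit Defensive.
Import Order.TTheory GRing.Theory Num.Theory.
Import numFieldNormedType.Exports.
Import ComplexField.Normc.
Local Open Scope classical_set_scope.
Local Open Scope ring_scope.

(* R^d is 'rV[R]_d, the field of complex numbers is R[i], and complex-valued
   functions are differentiated and integrated through their real and
   imaginary parts.  [normc] is the R-valued modulus on R[i]. *)

Section Euclidean.
Context {R : realType} {d : nat}.
Implicit Types x y : 'rV[R]_d.

(* The library norm on 'rV[R]_d is the sup norm. *)
Definition enorm x : R := Num.sqrt (\sum_(j < d) x ord0 j ^+ 2).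

Definition edot x y : R := \sum_(j < d) x ord0 j * y ord0 j.

End Euclidean.

Section Derivatives.
Context {R : realType} {d : nat}.

Definition partial_real (j : 'I_d) (g : 'rV[R]_d -> R) : 'rV[R]_d -> R :=
  fun x => 'D_(delta_mx ord0 j) g x.

Definition partial (j : 'I_d) (f : 'rV[R]_d -> R[i]) : 'rV[R]_d -> R[i] :=
  fun x => Complex (partial_real j (fun y => complex.Re (f y)) x)
                   (partial_real j (fun y => complex.Im (f y)) x).

(* The total operators above return junk where a derivative does not exist, so
   existence is required for each iterated partial derivative. *)
Definition smooth_real (g : 'rV[R]_d -> R) : Prop :=
  forall s : seq 'I_d,
    continuous (foldr partial_real g s) /\
    forall (j : 'I_d) (x : 'rV[R]_d),
      derivable (foldr partial_real g s) x (delta_mx ord0 j).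

Definition smooth (f : 'rV[R]_d -> R[i]) : Prop :=
  smooth_real (fun x => complex.Re (f x)) /\
  smooth_real (fun x => complex.Im (f x)).

Definition mpartial (m : mpoly.multinom d) (f : 'rV[R]_d -> R[i]) :
    'rV[R]_d -> R[i] :=
  foldr (fun j g => iter (mpoly.fun_of_multinom m j) (partial j) g) f (enum 'I_d).

Definition diffop (P : mpoly.mpoly d R[i]) (f : 'rV[R]_d -> R[i]) :
    'rV[R]_d -> R[i] :=
  fun x => \sum_(m <- mpoly.msupp P) mpoly.mcoeff m P * mpartial m f x.

(* P(i lambda) *)
Definition symbol (P : mpoly.mpoly d R[i]) (l : 'rV[R]_d) : R[i] :=
  mpoly.meval (fun j => Complex 0 (l ord0 j)) P.

End Derivatives.

Section Integration.
Context {R : realType}.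

(* Iterated Lebesgue integral over R^d; it is only applied to continuous
   functions that decay rapidly, for which it is the integral with respect to
   d-dimensional Lebesgue measure by Fubini. *)
Fixpoint integral_real (d : nat) : ('rV[R]_d -> R) -> R :=
  match d with
  | 0%N => fun g => g 0
  | d'.+1 => fun g =>
      (\int[@lebesgue_measure R]_x
         integral_real (fun y : 'rV[R]_d' =>
           g (row_mx (x%:M : 'rV[R]_1) y)))%R
  end.

Definition integral_complex (d : nat) (g : 'rV[R]_d -> R[i]) : R[i] :=
  Complex (integral_real (fun x => complex.Re (g x)))
          (integral_real (fun x => complex.Im (g x))).

(* Complex (cos t) (- sin t) is exp (- i t). *)
Definition fourier (d : nat) (f : 'rV[R]_d -> R[i]) : 'rV[R]_d -> R[i] :=
  fun l =>
    real_complex R ((2 * pi) `^ (- (d%:R / 2))) *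
    integral_complex (fun x =>
      f x * Complex (cos (edot l x)) (- sin (edot l x))).

End Integration.

Section Distributions.
Context {R : realType} {d : nat}.
Implicit Types (f phi psi : 'rV[R]_d -> R[i]) (T : ('rV[R]_d -> R[i]) -> R[i]).

Definition fsupport phi : set 'rV[R]_d := closure [set x | phi x != 0].

Definition test_function phi : Prop := smooth phi /\ compact (fsupport phi).

Definition schwartz phi : Prop :=
  smooth phi /\
  forall (k : nat) (m : mpoly.multinom d), exists M : R, forall x,
    (1 + enorm x) ^+ k * normc (mpartial m phi x) <= M.

Definition schwartz_norm (k : nat) phi : R :=
  sup [set r | exists (m : mpoly.multinom d) (x : 'rV[R]_d),
    (mpoly.mdeg m <= k)%N /\
    r = (1 + enorm x) ^+ k * normc (mpartial m phi x)].

(* Distributions are total functions on 'rV[R]_d -> R[i]; only their values on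
   Schwartz functions are meaningful, and only those are used. *)
Definition tempered_distribution T : Prop :=
  (forall (a : R[i]) phi psi, schwartz phi -> schwartz psi ->
     T (fun x => a * phi x + psi x) = a * T phi + T psi) /\
  (exists (k : nat) (C : R), forall phi, schwartz phi ->
     normc (T phi) <= C * schwartz_norm k phi).

(* The function f, viewed as a distribution, is (the restriction of) T.  Only
   test functions occur: f times a Schwartz function need not be integrable,
   as for f x = exp x * cos (exp x).  As test functions are dense in the
   Schwartz space, f determines T. *)
Definition represents f T : Prop :=
  forall phi, test_function phi ->
    T phi = integral_complex (fun x => f x * phi x).

Definition fourier_dist T : ('rV[R]_d -> R[i]) -> R[i] :=
  fun phi => T (fourier phi).

Definition vanishes_on T (U : set 'rV[R]_d) : Prop :=
  forall phi, test_function phi -> fsupport phi `<=` U -> T phi = 0.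

Definition dist_support T : set 'rV[R]_d :=
  ~` [set x | exists U : set 'rV[R]_d, [/\ open U, U x & vanishes_on T U]].

Definition Ck_norm (k : nat) phi : R :=
  sup [set r | exists (m : mpoly.multinom d) (x : 'rV[R]_d),
    (mpoly.mdeg m <= k)%N /\ r = normc (mpartial m phi x)].

Definition order_at_most T (N : nat) : Prop :=
  forall K : set 'rV[R]_d, compact K -> exists C : R, forall phi,
    test_function phi -> fsupport phi `<=` K ->
    normc (T phi) <= C * Ck_norm N phi.

Definition has_order T (N : nat) : Prop :=
  order_at_most T N /\ forall M : nat, order_at_most T M -> (N <= M)%N.

End Distributions.

Section GrowthBound.
Context {R : realType} {d : nat}.

Definition growth_bound (P : mpoly.mpoly d R[i]) (f : 'rV[R]_d -> R[i])
    (r C : R) (N : nat) : Prop :=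
  forall (n : nat) (x : 'rV[R]_d), (1 <= n)%N ->
    normc (iter n (diffop P) f x)
      <= C * n%:R ^+ N * r ^+ n * (1 + enorm x) ^+ N.

Definition sublevel (P : mpoly.mpoly d R[i]) (R0 : R) : set 'rV[R]_d :=
  [set l | normc (symbol P l) <= R0].

End GrowthBound.

(* Main.v *)
(* Write S = F T, so that P(d)^n f corresponds to P(i l)^n S.

   If S lives on K = {|P(i l)| <= R0}, then S is unchanged by multiplication
   with a cut-off chi equal to 1 near K and supported in {|P(i l)| < r}.  Up to
   a constant factor, |P(d)^n f(x)| is at most |S(chi P^n e_x)|, where
   e_x(l) = exp(i x.l); this is obtained by testing S against chi0(l / k) e_x
   with k large, chi0 being a bump whose transform has nonnegative real part.
   The derivatives of chi P^n e_x up to the order N of S are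
   O(n^N r^n (1 + |x|)^N).

   Conversely, let R0 < r < R1 and let phi be a test function with support in
   {|P(i l)| > R1}.  With a smooth Q such that P Q = 1 and |Q| <= 1 / R1 on the
   support of phi, S(phi) = (P^n S)(Q^n phi) is, up to a constant factor, the
   pairing of P(d)^n f with the transform of Q^n phi.  The first factor is
   O(n^N r^n (1 + |x|)^N), and the seminorms of the second are
   O(n^k R1^(-n)), so letting n tend to infinity gives S(phi) = 0. *)

Require Import Defs.
From HB Require Import structures.
From mathcomp Require Import all_boot all_order all_algebra.
From mathcomp Require Import all_classical all_reals all_analysis.
From mathcomp Require Import complex.
From mathcomp Require mpoly.
From mathcomp Require Import ring lra.
Set Implicit Arguments.
Unset Strict Implicit.
Unset Printing Implicit Defensive.
Import Order.TTheory GRing.Theory Num.Theory.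
Import numFieldNormedType.Exports.
Import ComplexField.Normc.
Local Open Scope classical_set_scope.
Local Open Scope ring_scope.

(** * Smooth functions *)

Section SmoothCalculus.
Context {R : realType} {d : nat}.
Implicit Types g : 'rV[R]_d -> R.

(** Nothing is assumed on the size of [f], so [f] times a Schwartz function need not be integrable,
    and [T] is known to be an integral on test functions only. Wherever [T] has to be computed at a
    transform, that transform is cut off by a bump and the remainder is shown to be O(1/n) in each
    seminorm. Hence only compactly supported continuous functions are ever integrated; for these,
    linearity, Fubini and integration by parts follow from one-variable primitives by induction on
    the dimension. Integrals over growing boxes are bounded uniformly by comparison with the product
    of the weights 1/(1 + x_j^2), which costs a factor pi per coordinate.

    The constants must not depend on n, although the seminorms that control [P(d)^n T] change with
    n. Both directions therefore rest on data of fixed index only, namely the order of [F T] in one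
    box and the pointwise bound on [P(d)^n f]; the seminorms of [P(d)^n T] occur only in errors that
    vanish in the limit of the cut-off. One exponent serves for n and for |x| because a derivative
    of [chi P^n e_x] brings at most one factor n or |x|. *)

Lemma is_derive_comp_real (h : R -> R) g x v dh :
  is_derive (g x) 1 h dh -> derivable g x v ->
  is_derive x v (fun y => h (g y)) (dh * 'D_v g x).
Proof.
move=> Hh Hg.
set l := fun t : R => g (t *: v + x).
have lE (k : R -> R) : 'D_1 (fun t : R => k (g (t *: v + x))) 0 = 'D_v (fun y => k (g y)) x.
  have E : (fun t : R => t^-1 *: (((fun t => k (g (t *: v + x))) \o shift 0) (t *: 1)
      - k (g (0 *: v + x)))) = (fun t => t^-1 *: (((fun y => k (g y)) \o shift x) (t *: v) - k (g x))).
    by apply/funext => t /=; rewrite addr0 scale0r add0r [_%:A]mulr1.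
  by rewrite /derive E.
have dl : is_derive (0 : R) 1 l ('D_v g x).
  by apply: DeriveDef; [exact/(derivable1P _ _ _).1|exact: (lE id)].
have Hh' : is_derive (l 0) 1 h dh by rewrite /l scale0r add0r.
have [D1 D2] := is_derive1_comp Hh' dl.
apply: DeriveDef; first exact/(derivable1P _ _ _).2.
by rewrite -D2 -lE.
Qed.

(** Membership of a function in such a family (trigonometric combinations, multiples of exp (-1/t))
    makes it smooth without any formula for its higher derivatives. *)
Definition derive_closed (H : set (R -> R)) : Prop :=
  forall h, H h -> exists2 h' : R -> R, H h' & forall t : R, is_derive t 1 h (h' t).

(* The partial derivatives of a member are members again, which gives
   smoothness without any induction on the order of differentiation. *)
Inductive smooth_expr : ('rV[R]_d -> R) -> Prop :=
| SmBase g of smooth_real g : smooth_expr g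
| SmCst c : smooth_expr (cst c)
| SmAdd g1 g2 of smooth_expr g1 & smooth_expr g2 : smooth_expr (g1 + g2)
| SmMul g1 g2 of smooth_expr g1 & smooth_expr g2 : smooth_expr (g1 * g2)
| SmInv g of smooth_expr g & (forall x, g x != 0) :
    smooth_expr (fun x => (g x)^-1)
| SmComp (H : set (R -> R)) h g of derive_closed H & H h & smooth_expr g : smooth_expr (fun x => h (g x)).

(** The list of directions is split at its last entry, which is the derivative taken first;
    smoothness of [g] thus reduces to that of its first partial derivatives. *)
Lemma smooth_realP g : smooth_real g <->
  continuous g /\ (forall j x, derivable g x (delta_mx ord0 j)) /\
  (forall j, smooth_real (partial_real j g)).
Proof.
split=> [H|[cg [dg sg]]].
  have [H0 H1] := H [::]; split; [exact: H0|split; [exact: H1|]].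
  by move=> j s; have := H (rcons s j); rewrite foldr_rcons.
by elim/last_ind => [//|s j _]; rewrite foldr_rcons; exact: sg.
Qed.

Lemma is_derive_continuous1 (h : R -> R) (t dh : R) :
  is_derive t 1 h dh -> {for t, continuous h}.
Proof. by move=> [Hd _]; exact/differentiable_continuous/derivable1_diffP. Qed.

Lemma smooth_expr_step g : smooth_expr g ->
  continuous g /\ (forall j x, derivable g x (delta_mx ord0 j)) /\
  (forall j, smooth_expr (partial_real j g)).
Proof.
elim=> {g}.
- move=> g /smooth_realP[cg [dg sg]]; split; [exact: cg|split; [exact: dg|]] => j; exact: SmBase.
- move=> c; split; first exact: cst_continuous.
  split.
    by move=> j x; exact: derivable_cst.
  move=> j; rewrite (_ : partial_real j _ = cst 0); first exact: SmCst.
  by apply/funext => x; rewrite /partial_real derive_cst.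
- move=> g1 g2 _ [c1 [d1 s1]] _ [c2 [d2 s2]]; split; [|split].
  + by move=> x; exact: (cvgD (c1 x) (c2 x)).
  + by move=> j x; exact: derivableD.
  + move=> j; rewrite (_ : partial_real j _ = partial_real j g1 + partial_real j g2).
      exact: SmAdd.
    by apply/funext => x; rewrite /partial_real deriveD.
- move=> g1 g2 S1 [c1 [d1 s1]] S2 [c2 [d2 s2]]; split; [|split].
  + by move=> x; exact: (cvgM (c1 x) (c2 x)).
  + by move=> j x; exact: derivableM.
  + move=> j; rewrite (_ : partial_real j _ =
      g1 * partial_real j g2 + g2 * partial_real j g1).
      by apply: SmAdd; apply: SmMul.
    by apply/funext => x; rewrite /partial_real deriveM.
- move=> g Sg [c1 [d1 s1]] g0; split; [|split].
  + by move=> x; exact: (cvgV (g0 x) (c1 x)).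
  + by move=> j x; exact: derivableV.
  + move=> j; rewrite (_ : partial_real j _ =
      cst (-1) * ((fun x => (g x)^-1) * (fun x => (g x)^-1)) * partial_real j g).
      by apply: SmMul => //; apply: SmMul; [exact: SmCst|apply: SmMul; exact: SmInv].
    apply/funext => x; rewrite /partial_real deriveV// /cst.
    rewrite /= /GRing.scale /= expr2 invfM.
    by transitivity (-1 * ((g x)^-1 * (g x)^-1) * 'D_(delta_mx ord0 j) g x); rewrite ?mulN1r.
- move=> H h g HH Hh Sg [c1 [d1 s1]].
  have [h' Hh' dh] := HH _ Hh; split; [|split].
  + move=> x; apply: continuous_comp; first exact: c1.
    exact: (is_derive_continuous1 (dh _)).
  + by move=> j x; have [] := is_derive_comp_real (dh _) (d1 j x).
  + move=> j; rewrite (_ : partial_real j _ = (fun x => h' (g x)) * partial_real j g).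
      apply: SmMul => //; exact: (SmComp HH).
    apply/funext => x; rewrite /partial_real.
    by have [_ ->] := is_derive_comp_real (dh (g x)) (d1 j x).
Qed.

Lemma smooth_expr_smooth g : smooth_expr g -> smooth_real g.
Proof.
move=> Sg s.
suff Ss : smooth_expr (foldr partial_real g s).
  by have [? []] := smooth_expr_step Ss.
by elim: s => //= j s IH; have [_ []] := smooth_expr_step IH.
Qed.

End SmoothCalculus.

(** * Epsilon-delta forms of continuity and of directional derivatives *)

Section EpsilonDelta.
Context {R : realType}.

Lemma cvg_eps (V W : normedModType R) (f : V -> W) (x : V) :
  {for x, continuous f} <-> forall e : R, 0 < e -> exists2 D : R, 0 < D &
    forall y, `|y - x| < D -> `|f y - f x| <= e.
Proof.
split=> [/cvgrPdist_le fx e e0|H].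
  have /nbhs_ballP[D /= D0 HD] := fx _ e0.
  by exists D => // y xy; rewrite distrC; apply: HD; rewrite -ball_normE /= distrC.
apply/cvgrPdist_le => e e0; have [D D0 HD] := H _ e0.
apply/nbhs_ballP; exists D => //= y; rewrite -ball_normE /= distrC => /HD.
by rewrite distrC.
Qed.

(** The difference quotient is multiplied out by [s]. At s = 0 the resulting inequality is trivial,
    so no punctured neighbourhood is left to handle. *)
Lemma is_derive_eps (V : normedModType R) (f : V -> R) (x v : V) (df : R) :
  is_derive x v f df <-> forall e : R, 0 < e -> exists2 D : R, 0 < D &
    forall s : R, `|s| < D -> `|f (s *: v + x) - f x - s * df| <= e * `|s|.
Proof.
have E (s : R) : s != 0 ->
    `|s^-1 *: (f (s *: v + x) - f x) - df| = `|s|^-1 * `|f (s *: v + x) - f x - s * df|.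
  move=> s0; rewrite -normfV -normrM; congr (`| _ |).
  by rewrite [RHS]mulrBr mulKf.
split=> [[dfx fx] e e0|H].
  have : (fun h : R => h^-1 *: ((f \o shift x) (h *: v) - f x)) @ 0^' --> df.
    by rewrite -fx; exact: dfx.
  move/cvgrPdist_le => /(_ _ e0) /nbhs_ballP[D /= D0 HD].
  exists D => // s sD; have [->|s0] := eqVneq s 0.
    by rewrite scale0r add0r subrr mul0r subr0 normr0 mulr0.
  have := HD s; rewrite -ball_normE /= sub0r normrN => /(_ sD s0).
  by rewrite distrC E// mulrC ler_pdivrMr// normr_gt0.
suff Hc : (fun h : R => h^-1 *: ((f \o shift x) (h *: v) - f x)) @ 0^' --> df.
  by apply: DeriveDef; [apply/cvg_ex; exists df|exact: cvg_lim Hc].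
apply/cvgrPdist_le => e e0; have [D D0 HD] := H _ e0.
apply/nbhs_ballP; exists D => //= s; rewrite -ball_normE /= sub0r normrN => sD s0.
by rewrite distrC E// mulrC ler_pdivrMr ?normr_gt0// HD.
Qed.

Lemma coord_le_norm n (x : 'rV[R]_n) j : `|x ord0 j| <= `|x|.
Proof.
rewrite [leRHS]/Num.norm /= mx_normrE; apply/bigmax_geP; right => /=.
by exists (ord0, j).
Qed.

Lemma norm_rV_le n (x : 'rV[R]_n) (M : R) : 0 <= M ->
  (forall j, `|x ord0 j| <= M) -> `|x| <= M.
Proof.
move=> M0 H; rewrite [leLHS]/Num.norm /= mx_normrE; apply/bigmax_leP; split=> //.
by move=> [i j] _ /=; rewrite (ord1 i).
Qed.

Lemma norm_rV_lt n (x : 'rV[R]_n) (M : R) : 0 < M ->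
  (forall j, `|x ord0 j| < M) -> `|x| < M.
Proof.
move=> M0 H; rewrite [ltLHS]/Num.norm /= mx_normrE; apply/bigmax_ltP; split=> //.
by move=> [i j] _ /=; rewrite (ord1 i).
Qed.

End EpsilonDelta.

(** * Smooth bump functions *)

Section Bump.
Context {R : realType}.

(* Multiples of exp (-1/t), extended by 0 to t <= 0; this family is closed
   under differentiation. *)
Definition flat_exp (p : {poly R}) (t : R) : R :=
  if t <= 0 then 0 else p.[t^-1] * expR (- t^-1).

Lemma poly_expRN_bounded (p : {poly R}) (k : nat) :
  exists2 C, 0 <= C & forall u : R, 0 < u -> `|p.[u]| * u ^+ k * expR (- u) <= C.
Proof.
elim/poly_ind: p k => [|p c IH] k.
  by exists 0 => // u u0; rewrite horner0 normr0 !mul0r.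
have [C1 C10 H1] := IH k.+1.
exists (C1 + `|c| * k%:R ^+ k); first by rewrite addr_ge0// mulr_ge0// exprn_ge0.
move=> u u0; rewrite hornerMXaddC.
(* From exp (u/k) >= u/k, raised to the power k. *)
have uk : u ^+ k * expR (- u) <= k%:R ^+ k.
  case: k {H1} => [|k].
    by rewrite !expr0 mul1r -expR0 ler_expR oppr_le0 ltW.
  rewrite expRN ler_pdivrMr ?expR_gt0//.
  have -> : expR u = expR (u / k.+1%:R) ^+ k.+1.
    by rewrite -expRM_natl mulrC divfK// pnatr_eq0.
  rewrite -exprMn; apply: lerXn2r; rewrite ?nnegrE ?(ltW u0) ?mulr_ge0 ?expR_ge0//.
  rewrite mulrC -ler_pdivrMr//; apply: le_trans (expR_ge1Dx _).
  by rewrite lerDr.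
apply: le_trans (_ : (`|p.[u] * u| + `|c|) * u ^+ k * expR (- u) <= _).
  by rewrite ler_wpM2r ?expR_ge0// ler_wpM2r ?exprn_ge0 ?(ltW u0)// ler_normD.
rewrite !mulrDl lerD//.
  by rewrite normrM (gtr0_norm u0) -mulrA -mulrA (mulrA u) -exprS mulrA; exact: H1.
by rewrite -mulrA ler_wpM2l.
Qed.

(** With u = 1/t, the derivative of p(u) exp (-u) is u^2 (p(u) - p'(u)) exp (-u), which is again of
    the same form. Only t = 0 needs an estimate. *)
Lemma is_derive_flat_exp (p : {poly R}) (t : R) :
  is_derive t 1 (flat_exp p) (flat_exp ('X^2 * (p - p^`()))%R t).
Proof.
have [t0|t0|->] := ltgtP t 0.
- rewrite [X in is_derive _ _ _ X](_ : _ = 0); last by rewrite /flat_exp ltW.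
  apply: (@near_eq_is_derive R R R (cst 0)).
  near=> s; rewrite /flat_exp /cst ifT//.
  by near: s; exact: (cvgr_le _ (@cvg_id _ (nbhs t)) _ t0).
- rewrite /flat_exp leNgt t0 /=.
  apply: (@near_eq_is_derive R R R (fun s => p.[s^-1] * expR (- s^-1))).
    near=> s; rewrite ifF//; apply/negbTE; rewrite -ltNge.
    by near: s; exact: (cvgr_gt _ (@cvg_id _ (nbhs t)) _ t0).
  have tn0 : t != 0 by rewrite gt_eqF.
  have dinv : is_derive t 1 (fun s : R => s^-1) (- t ^- 2).
    apply: DeriveDef; first exact: (@derivableV _ _ id).
    by rewrite (@deriveV _ _ id)// derive_id [LHS]mulr1.
  have dp : is_derive t 1 (fun s => p.[s^-1]) (p^`().[t^-1] * - t ^- 2).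
    have dh : is_derive t^-1 1 (horner p) p^`().[t^-1].
      by apply: DeriveDef; [exact: derivable_horner|rewrite -derive1E -derivE].
    exact: (is_derive1_comp dh dinv).
  have dn : is_derive t 1 (fun s : R => - s^-1) (t ^- 2).
    by rewrite -[X in is_derive _ _ _ X]opprK; exact: is_deriveN.
  have de : is_derive t 1 (fun s => expR (- s^-1)) (expR (- t^-1) * t ^- 2).
    exact: (is_derive1_comp (is_derive_expR _) dn).
  rewrite [X in is_derive _ _ _ X](_ : _ = p.[t^-1] * (expR (- t^-1) * t ^- 2) +
    expR (- t^-1) * (p^`().[t^-1] * - t ^- 2)); first exact: (is_deriveM dp de).
  by rewrite !hornerE /= exprVn; ring.
- rewrite [X in is_derive _ _ _ X](_ : _ = 0); last by rewrite /flat_exp lexx.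
  apply/is_derive_eps => e e0.
  (* The exponent 2 gives [|flat_exp p s| <= C s^2], which is o(s). *)
  have [C C0 HC] := poly_expRN_bounded p 2.
  exists (e / (C + 1)); first by rewrite divr_gt0// ltr_wpDl.
  move=> s; rewrite mulr0 subr0 addr0 [s *: 1]mulr1 {2}/flat_exp lexx subr0 => sD.
  rewrite /flat_exp; case: ifPn => [_|]; first by rewrite normr0 mulr_ge0// ltW.
  rewrite -ltNge => s0; rewrite (gtr0_norm s0) in sD *.
  have /HC : 0 < s^-1 by rewrite invr_gt0.
  rewrite normrM (gtr0_norm (expR_gt0 _)) mulrAC exprVn ler_pdivrMr ?exprn_gt0//.
  move=> /le_trans; apply; rewrite expr2 mulrA ler_wpM2r ?(ltW s0)//.
  apply: le_trans (_ : (C + 1) * s <= _).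
    by rewrite ler_wpM2r ?(ltW s0)// lerDl.
  by rewrite mulrC -ler_pdivlMr ?ltr_wpDl// ltW.
Unshelve. all: by end_near. Qed.

Lemma flat_exp_closed : derive_closed (range flat_exp).
Proof.
move=> h [p _ <-]; exists (flat_exp ('X^2 * (p - p^`()))%R); first by exists ('X^2 * (p - p^`()))%R.
exact: is_derive_flat_exp.
Qed.

Lemma flat_exp1_le0 t : t <= 0 -> flat_exp 1 t = 0.
Proof. by rewrite /flat_exp => ->. Qed.

Lemma flat_exp1_gt0 t : 0 < t -> 0 < flat_exp 1 t.
Proof.
by move=> t0; rewrite /flat_exp leNgt t0/= hornerC mul1r expR_gt0.
Qed.

Lemma flat_exp1_ge0 t : 0 <= flat_exp 1 t.
Proof.
have [/flat_exp1_le0->//|t0] := leP t 0; exact/ltW/flat_exp1_gt0.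
Qed.

Lemma flat_exp1_le s t : s <= t -> flat_exp 1 s <= flat_exp 1 t.
Proof.
move=> st; have [/flat_exp1_le0->|s0] := leP s 0; first exact: flat_exp1_ge0.
have t0 := lt_le_trans s0 st.
rewrite /flat_exp (lt_geF s0) (lt_geF t0) !hornerC !mul1r ler_expR lerN2.
by rewrite lef_pV2.
Qed.

(** The inner term vanishes for |t| <= 1 and has reached [flat_exp 1 3] at |t| = 2, as 3 = 2^2 - 1.
    Nesting [flat_exp 1] twice makes the function flat at the top and at the bottom, and the
    denominator is constant. *)
Definition plateau (t : R) : R :=
  flat_exp 1 (flat_exp 1 3 - flat_exp 1 (t ^+ 2 - 1)) / flat_exp 1 (flat_exp 1 3).

Let c_gt0 : 0 < flat_exp 1 (flat_exp 1 3) :> R.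
Proof. by rewrite !flat_exp1_gt0. Qed.

Lemma plateau_ge0 t : 0 <= plateau t.
Proof. by rewrite divr_ge0 ?flat_exp1_ge0. Qed.

Lemma plateau_le1 t : plateau t <= 1.
Proof.
rewrite ler_pdivrMr// mul1r flat_exp1_le//.
by rewrite lerBlDr lerDl flat_exp1_ge0.
Qed.

Lemma plateau_1 t : `|t| <= 1 -> plateau t = 1.
Proof.
move=> t1; rewrite /plateau [flat_exp 1 (_ - 1)]flat_exp1_le0 ?subr0 ?divff ?gt_eqF//.
by rewrite subr_le0 -real_normK ?num_real// expr_le1.
Qed.

Lemma plateau_neq0 t : plateau t != 0 -> `|t| < 2.
Proof.
apply: contra_neqT; rewrite -leNgt => t2; rewrite /plateau flat_exp1_le0 ?mul0r//.
rewrite subr_le0 flat_exp1_le// lerBrDr -real_normK ?num_real//.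
apply: le_trans (_ : 2 ^+ 2 <= _); first by rewrite -natrX -[3]/(3%:R) -[1]/(1%:R) -natrD.
by rewrite lerXn2r ?nnegrE.
Qed.

Context {d : nat}.

Lemma smooth_expr_coord j : smooth_expr (fun x : 'rV[R]_d => x ord0 j).
Proof.
apply: SmBase.
have D (x : 'rV[R]_d) (k : 'I_d) : is_derive x (delta_mx ord0 k : 'rV[R]_d) (fun x : 'rV[R]_d => x ord0 j)
    ((delta_mx ord0 k : 'rV[R]_d) ord0 j).
  apply/is_derive_eps => e e0; exists 1 => // s _.
  by rewrite [X in X - _ - _]mxE [X in X + _ - _ - _]mxE addrK subrr normr0 mulr_ge0// ltW.
apply/smooth_realP; split; first exact: coord_continuous.
split; first by move=> k x; have [] := D x k.
move=> k; apply: smooth_expr_smooth.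
rewrite (_ : partial_real _ _ = cst ((delta_mx ord0 k : 'rV[R]_d) ord0 j)); first exact: SmCst.
by apply/funext => x; have [_] := D x k.
Qed.

Lemma smooth_expr_prod n (g : 'I_n -> 'rV[R]_d -> R) :
  (forall i, smooth_expr (g i)) -> smooth_expr (fun x => \prod_(i < n) g i x).
Proof.
elim: n g => [|n IH] g Hg.
  rewrite (_ : (fun x => _) = cst 1); first exact: SmCst.
  by apply/funext => x; rewrite big_ord0.
rewrite (_ : (fun x => _) = (fun x => \prod_(i < n) g (widen_ord (leqnSn n) i) x) * g ord_max).
  by apply: SmMul => //; exact: IH.
by apply/funext => x; rewrite big_ord_recr.
Qed.

Lemma smooth_expr_sum n (g : 'I_n -> 'rV[R]_d -> R) :
  (forall i, smooth_expr (g i)) -> smooth_expr (fun x => \sum_(i < n) g i x).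
Proof.
elim: n g => [|n IH] g Hg.
  rewrite (_ : (fun x => _) = cst 0); first exact: SmCst.
  by apply/funext => x; rewrite big_ord0.
rewrite (_ : (fun x => _) = (fun x => \sum_(i < n) g (widen_ord (leqnSn n) i) x) + g ord_max).
  by apply: SmAdd => //; exact: IH.
by apply/funext => x; rewrite big_ord_recr.
Qed.

(** Balls of the sup norm are cubes, so a product of one-variable plateaus does it. *)
Lemma box_bump (p : 'rV[R]_d) (e : R) : 0 < e ->
  exists th : 'rV[R]_d -> R, [/\ smooth_real th, forall x, 0 <= th x <= 1,
    forall x, `|x - p| <= e -> th x = 1 & forall x, th x != 0 -> `|x - p| < 2 * e].
Proof.
move=> e0; exists (fun x => \prod_j plateau ((x ord0 j - p ord0 j) / e)); split.
- apply: smooth_expr_smooth; apply: smooth_expr_prod => j.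
  have Sh (q : 'rV[R]_d -> R) : smooth_expr q -> smooth_expr (fun x => flat_exp 1 (q x)).
    by apply: (SmComp flat_exp_closed); exists 1.
  have SE (g : 'rV[R]_d -> R) : smooth_expr g -> smooth_expr (fun x => plateau (g x)).
    move=> Sg; apply: (@SmMul _ _ _ (cst _)); last exact: SmCst.
    apply: (Sh _); apply: (@SmAdd _ _ (cst _)); first exact: SmCst.
    rewrite (_ : (fun x => _) = cst (-1) * (fun x => flat_exp 1 (g x ^+ 2 - 1))).
      apply: SmMul; first exact: SmCst.
      by apply: (Sh _); apply: (@SmAdd _ _ _ (cst _)); [apply: (@SmMul _ _ g g)|exact: SmCst].
    by apply/funext => x; rewrite -[LHS]mulN1r.
  apply: SE; apply: (@SmMul _ _ _ (cst _)); last exact: SmCst.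
  by apply: (@SmAdd _ _ _ (cst _)); [exact: smooth_expr_coord|exact: SmCst].
- move=> x; rewrite prodr_ge0 /=; last by move=> j _; exact: plateau_ge0.
  by apply: prodr_ile1 => j _; rewrite plateau_ge0 plateau_le1.
- move=> x xp; rewrite big1// => j _; apply: plateau_1.
  rewrite normrM normfV (gtr0_norm e0) ler_pdivrMr// mul1r.
  by apply: le_trans xp; have := coord_le_norm (x - p) j; rewrite !mxE.
- move=> x /prodf_neq0 H; apply: norm_rV_lt; first by rewrite mulr_gt0.
  move=> j; have := plateau_neq0 (H j isT); rewrite !mxE.
  by rewrite normrM normfV (gtr0_norm e0) ltr_pdivrMr.
Qed.

End Bump.

(** * The modulus and the exponential on the complex numbers *)

Section ComplexModulus.
Context {R : realType}.
Implicit Types z w : R[i].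

Lemma complex_ext z w : complex.Re z = complex.Re w ->
  complex.Im z = complex.Im w -> z = w.
Proof. by case: z => a b; case: w => a' b' /= -> ->. Qed.

Lemma ReM z w : complex.Re (z * w) =
  complex.Re z * complex.Re w - complex.Im z * complex.Im w.
Proof. by case: z => a b; case: w. Qed.

Lemma ImM z w : complex.Im (z * w) =
  complex.Re z * complex.Im w + complex.Im z * complex.Re w.
Proof. by case: z => a b; case: w. Qed.

Lemma ReD z w : complex.Re (z + w) = complex.Re z + complex.Re w.
Proof. by case: z => a b; case: w. Qed.

Lemma ImD z w : complex.Im (z + w) = complex.Im z + complex.Im w.
Proof. by case: z => a b; case: w. Qed.

Lemma ReN z : complex.Re (- z) = - complex.Re z.
Proof. by case: z. Qed.

Lemma ImN z : complex.Im (- z) = - complex.Im z.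
Proof. by case: z. Qed.

Lemma normc_ge0 z : 0 <= normc z.
Proof. by case: z => a b; exact: sqrtr_ge0. Qed.

Lemma normc_normr z : `|z| = (normc z)%:C%C.
Proof. by case: z. Qed.

Lemma normcD z w : normc (z + w) <= normc z + normc w.
Proof. by rewrite -lecR -normc_normr rmorphD /= -!normc_normr ler_normD. Qed.

Lemma normcN z : normc (- z) = normc z.
Proof. by case: z => a b /=; rewrite !sqrrN. Qed.

Lemma normcB z w : normc (z - w) <= normc z + normc w.
Proof. by rewrite -(normcN w) normcD. Qed.

Lemma normcX z n : normc (z ^+ n) = normc z ^+ n.
Proof.
elim: n => [|n IH]; first by rewrite !expr0 normc1.
by rewrite !exprS normcM IH.
Qed.

Lemma sqr_normc z : normc z ^+ 2 = complex.Re z ^+ 2 + complex.Im z ^+ 2.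
Proof. by case: z => a b /=; rewrite sqr_sqrtr// addr_ge0 ?sqr_ge0. Qed.

Lemma normc_Re z : `|complex.Re z| <= normc z.
Proof.
rewrite -(@ler_pXn2r _ 2)// ?nnegrE ?normc_ge0// sqr_normc real_normK ?num_real//.
by rewrite lerDl sqr_ge0.
Qed.

Lemma normc_Im z : `|complex.Im z| <= normc z.
Proof.
rewrite -(@ler_pXn2r _ 2)// ?nnegrE ?normc_ge0// sqr_normc real_normK ?num_real//.
by rewrite lerDr sqr_ge0.
Qed.

Lemma normc_le z : normc z <= `|complex.Re z| + `|complex.Im z|.
Proof.
rewrite -(@ler_pXn2r _ 2)// ?nnegrE ?normc_ge0 ?addr_ge0//.
rewrite sqr_normc sqrrD !real_normK ?num_real// lerD2r lerDl mulrn_wge0// mulr_ge0.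
Qed.

Lemma normc_eq0 z : (normc z == 0) = (z == 0).
Proof.
apply/eqP/eqP => [|->]; [exact: eq0_normc|exact: normc0].
Qed.

Lemma normc_gt0 z : (0 < normc z) = (z != 0).
Proof. by rewrite lt_def normc_ge0 normc_eq0 andbT. Qed.

Lemma normc_real (a : R) : normc (a%:C%C) = `|a|.
Proof. by rewrite /= expr0n addr0 sqrtr_sqr. Qed.

Lemma normc_nat (n : nat) : normc (n%:R : R[i]) = n%:R.
Proof.
have -> : (n%:R : R[i]) = (n%:R : R)%:C%C by rewrite rmorph_nat.
by rewrite normc_real normr_nat.
Qed.

Definition expi (t : R) : R[i] := Complex (cos t) (sin t).

Lemma normc_expi t : normc (expi t) = 1.
Proof. by rewrite /= cos2Dsin2 sqrtr1. Qed.

Lemma expiD s t : expi (s + t) = expi s * expi t.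
Proof.
by apply: complex_ext; rewrite ?ReM ?ImM /= ?cosD ?sinD// addrC (mulrC (cos s)).
Qed.

Lemma expi0 : expi 0 = 1.
Proof. by rewrite /expi cos0 sin0. Qed.

End ComplexModulus.

(** * Partial derivatives of complex-valued functions *)

Section ComplexSmooth.
Context {R : realType} {d : nat}.
Implicit Types f g : 'rV[R]_d -> R[i].

Lemma smooth_derivable f : smooth f -> forall x v, (exists j, v = delta_mx ord0 j) ->
  derivable (fun y => complex.Re (f y)) x v /\
  derivable (fun y => complex.Im (f y)) x v.
Proof.
by move=> [/smooth_realP[_ [d1 _]] /smooth_realP[_ [d2 _]]] x v [j ->].
Qed.

Lemma smooth_partial f j : smooth f -> smooth (partial j f).
Proof.
by move=> [/smooth_realP[_ [_ s1]] /smooth_realP[_ [_ s2]]]; split; [exact: s1|exact: s2].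
Qed.

Lemma smooth_foldr f s : smooth f -> smooth (foldr partial f s).
Proof.
move=> Sf; elim: s => [|j s IH]; [exact: Sf|exact: smooth_partial].
Qed.

Lemma smoothP f :
  smooth_expr (fun x => complex.Re (f x)) -> smooth_expr (fun x => complex.Im (f x)) ->
  smooth f.
Proof. by move=> H1 H2; split; exact: smooth_expr_smooth. Qed.

Lemma smoothRe f : smooth f -> smooth_expr (fun x => complex.Re (f x)).
Proof. by move=> [H _]; exact: SmBase. Qed.

Lemma smoothIm f : smooth f -> smooth_expr (fun x => complex.Im (f x)).
Proof. by move=> [_ H]; exact: SmBase. Qed.

Lemma smooth_cst (c : R[i]) : smooth (fun _ : 'rV[R]_d => c).
Proof. by apply: smoothP; exact: SmCst. Qed.

Lemma smoothD f g : smooth f -> smooth g -> smooth (fun x => f x + g x).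
Proof.
move=> Sf Sg; apply: smoothP.
  rewrite (_ : (fun x => _) = (fun x => complex.Re (f x)) + (fun x => complex.Re (g x))).
    by apply: SmAdd; exact: smoothRe.
  by apply/funext => x; rewrite ReD.
rewrite (_ : (fun x => _) = (fun x => complex.Im (f x)) + (fun x => complex.Im (g x))).
  by apply: SmAdd; exact: smoothIm.
by apply/funext => x; rewrite ImD.
Qed.

Lemma smoothM f g : smooth f -> smooth g -> smooth (fun x => f x * g x).
Proof.
move=> Sf Sg; apply: smoothP.
  rewrite (_ : (fun x => _) = (fun x => complex.Re (f x)) * (fun x => complex.Re (g x))
     + cst (-1) * ((fun x => complex.Im (f x)) * (fun x => complex.Im (g x)))).
    by apply: SmAdd; [|apply: SmMul; first exact: SmCst]; apply: SmMul;
      (exact: smoothRe || exact: smoothIm).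
  by apply/funext => x; rewrite ReM -[- _]mulN1r.
rewrite (_ : (fun x => _) = (fun x => complex.Re (f x)) * (fun x => complex.Im (g x))
     + (fun x => complex.Im (f x)) * (fun x => complex.Re (g x))).
  by apply: SmAdd; apply: SmMul; (exact: smoothRe || exact: smoothIm).
by apply/funext => x; rewrite ImM.
Qed.

Lemma smoothZ (c : R[i]) f : smooth f -> smooth (fun x => c * f x).
Proof. move=> Sf; exact: (smoothM (smooth_cst c) Sf). Qed.

Lemma smoothX f n : smooth f -> smooth (fun x => f x ^+ n).
Proof.
move=> Sf; elim: n => [|n IH].
  rewrite (_ : (fun x => _) = fun=> 1); first exact: smooth_cst.
  by apply/funext => x; rewrite expr0.
rewrite (_ : (fun x => _) = fun x => f x * f x ^+ n); first exact: (smoothM Sf IH).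
by apply/funext => x; rewrite exprS.
Qed.

Lemma smooth_sum (I : Type) (r : seq I) (F : I -> 'rV[R]_d -> R[i]) :
  (forall i, smooth (F i)) -> smooth (fun x => \sum_(i <- r) F i x).
Proof.
move=> SF; elim: r => [|i r IH].
  rewrite (_ : (fun x => _) = fun=> 0); first exact: smooth_cst.
  by apply/funext => x; rewrite big_nil.
rewrite (_ : (fun x => _) = fun x => F i x + \sum_(i <- r) F i x); first exact: (smoothD (SF i) IH).
by apply/funext => x; rewrite big_cons.
Qed.

Lemma smooth_real_complex (g : 'rV[R]_d -> R) : smooth_expr g ->
  smooth (fun x => (g x)%:C%C).
Proof. by move=> Sg; apply: smoothP => //=; exact: SmCst. Qed.

Lemma smooth_coord j : smooth (fun x : 'rV[R]_d => (x ord0 j)%:C%C).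
Proof. exact/smooth_real_complex/smooth_expr_coord. Qed.

Lemma partial_cst (c : R[i]) j : partial j (fun _ : 'rV[R]_d => c) = fun=> 0.
Proof.
by apply/funext => x; rewrite /partial /partial_real !derive_cst.
Qed.

Lemma partialD f g j : smooth f -> smooth g ->
  partial j (fun x => f x + g x) = fun x => partial j f x + partial j g x.
Proof.
move=> Sf Sg; apply/funext => x.
have [f1 f2] := smooth_derivable Sf x (ex_intro _ j erefl).
have [g1 g2] := smooth_derivable Sg x (ex_intro _ j erefl).
apply: complex_ext; rewrite ?ReD ?ImD /= /partial_real.
  rewrite (_ : (fun y => _) = (fun y => complex.Re (f y)) + (fun y => complex.Re (g y))).
    exact: (deriveD f1 g1).
  by apply/funext => y; rewrite ReD.
rewrite (_ : (fun y => _) = (fun y => complex.Im (f y)) + (fun y => complex.Im (g y))).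
  exact: (deriveD f2 g2).
by apply/funext => y; rewrite ImD.
Qed.

Lemma partialM f g j : smooth f -> smooth g ->
  partial j (fun x => f x * g x) = fun x => partial j f x * g x + f x * partial j g x.
Proof.
move=> Sf Sg; apply/funext => x.
have [f1 f2] := smooth_derivable Sf x (ex_intro _ j erefl).
have [g1 g2] := smooth_derivable Sg x (ex_intro _ j erefl).
apply: complex_ext; rewrite ?ReD ?ImD ?ReM ?ImM /= /partial_real.
  rewrite (_ : (fun y => _) = (fun x => complex.Re (f x)) * (fun x => complex.Re (g x))
     - (fun x => complex.Im (f x)) * (fun x => complex.Im (g x))); last first.
    by apply/funext => y; rewrite ReM.
  rewrite (deriveB (derivableM f1 g1) (derivableM f2 g2)) (deriveM f1 g1) (deriveM f2 g2).
  rewrite /GRing.scale /=; do 4![move: ('D_(delta_mx ord0 j) _ x) => ?].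
  by ring.
rewrite (_ : (fun y => _) = (fun x => complex.Re (f x)) * (fun x => complex.Im (g x))
     + (fun x => complex.Im (f x)) * (fun x => complex.Re (g x))); last first.
  by apply/funext => y; rewrite ImM.
rewrite (deriveD (derivableM f1 g2) (derivableM f2 g1)) (deriveM f1 g2) (deriveM f2 g1).
rewrite /GRing.scale /=; do 4![move: ('D_(delta_mx ord0 j) _ x) => ?].
  by ring.
Qed.

Lemma partialZ (c : R[i]) f j : smooth f ->
  partial j (fun x => c * f x) = fun x => c * partial j f x.
Proof.
move=> Sf; rewrite (partialM j (smooth_cst c) Sf).
by apply/funext => x; rewrite partial_cst mul0r add0r.
Qed.

Lemma partialX f n j : smooth f ->
  partial j (fun x => f x ^+ n.+1) = fun x => n.+1%:R * (f x ^+ n * partial j f x).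
Proof.
move=> Sf; elim: n => [|n IH].
  by apply/funext => x; rewrite expr0 !mul1r.
rewrite (_ : (fun x => _) = fun x => f x * f x ^+ n.+1); last first.
  by apply/funext => x; rewrite exprS.
rewrite (partialM j Sf (smoothX n.+1 Sf)) IH.
by apply/funext => x; rewrite -[n.+2%:R]natr1 exprS; ring.
Qed.

Lemma partial_coord j k : partial j (fun x : 'rV[R]_d => (x ord0 k)%:C%C) =
  fun=> ((j == k)%:R : R)%:C%C.
Proof.
apply/funext => x; apply: complex_ext => /=; rewrite /partial_real.
  have D : is_derive x (delta_mx ord0 j : 'rV[R]_d) (fun x : 'rV[R]_d => x ord0 k)
    ((j == k)%:R : R).
    apply/is_derive_eps => e e0; exists 1 => // s _.
    rewrite [X in X - _ - _]mxE [X in X + _ - _ - _]mxE addrK mxE eqxx /= eq_sym.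
    by rewrite subrr normr0 mulr_ge0// ltW.
  by have [_ <-] := D.
by rewrite derive_cst.
Qed.

(** The directions of [m] in the order in which [mpartial] applies them. Bounds over all lists of
    directions thereby dominate bounds over all multi-indices. *)
Definition mseq (m : mpoly.multinom d) : seq 'I_d :=
  flatten [seq nseq (mpoly.fun_of_multinom m j) j | j <- enum 'I_d].

Lemma mpartialE (m : mpoly.multinom d) f : mpartial m f = foldr partial f (mseq m).
Proof.
rewrite /mpartial /mseq; elim: (enum 'I_d) => //= j s ->.
rewrite foldr_cat; elim: (mpoly.fun_of_multinom m j) => //= n ->.
by [].
Qed.

Lemma size_mseq (m : mpoly.multinom d) : size (mseq m) = mpoly.mdeg m.
Proof.
rewrite size_flatten /shape -map_comp mpoly.mdegE sumnE big_map enumT.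
by apply: eq_bigr => j _ /=; rewrite size_nseq.
Qed.

(** Pure derivatives are reached by multi-indices without exchanging any derivatives, so bounds on
    them can be read off [Ck_norm]. *)
Lemma mpartial_pure j n f :
  exists2 m : mpoly.multinom d, mpoly.mdeg m = n & mpartial m f = iter n (partial j) f.
Proof.
pose m := mpoly.mnm_muln (mpoly.mnm1 j) n.
have E (k : 'I_d) : mpoly.fun_of_multinom m k = ((j == k) * n)%N.
  by rewrite mpoly.mulmnE mpoly.mnm1E.
have mn : mpoly.mdeg m = n.
  rewrite mpoly.mdegE (bigD1 j)//= E eqxx mul1n big1 ?addn0// => k kj.
  by rewrite E eq_sym (negbTE kj).
exists m => //; rewrite mpartialE; set L := mseq _.
suff -> : L = nseq n j by elim: (n) => //= k ->.
rewrite -mn -(size_mseq m); apply/all_pred1P/allP => k /flattenP[s].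
move=> /mapP[l _ ->]; rewrite E; have [->|jl] := eqVneq j l.
  by rewrite mem_nseq => /andP[_].
by rewrite mul0n in_nil.
Qed.

Lemma smooth_continuous f : smooth f ->
  continuous (fun x => complex.Re (f x)) /\ continuous (fun x => complex.Im (f x)).
Proof. by move=> [/smooth_realP[H1 _] /smooth_realP[H2 _]]. Qed.

End ComplexSmooth.

(** * Integration of compactly supported continuous functions *)

Section OneDim.
Context {R : realType}.
Implicit Types (u U : R -> R) (L : R).
Notation mu := (@lebesgue_measure R).

Definition cc1 L u := continuous u /\ forall x, L < `|x| -> u x = 0.

Definition int1 u : R := (\int[mu]_x u x)%R.

Lemma cc1_restrict L u : cc1 L u -> int1 u = (\int[mu]_(x in `[(- L), L]) u x)%R.
Proof.
move=> [_ uL]; rewrite [RHS]Rintegral_mkcond /int1; congr Rintegral.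
apply/funext => x; rewrite /patch; case: ifPn => //.
rewrite notin_setE /= in_itv/= -ler_norml => /negP; rewrite -ltNge; exact: uL.
Qed.

Lemma continuous_itv_integrable u a b : continuous u ->
  mu.-integrable `[a, b] (EFin \o u).
Proof.
move=> cu; apply: continuous_compact_integrable; first exact: segment_compact.
exact: continuous_subspaceT.
Qed.

Lemma FTC2_itv u U (a b : R) : a < b -> continuous u ->
  (forall x : R, is_derive x 1 U (u x)) ->
  (\int[mu]_(x in `[a, b]) u x)%R = U b - U a.
Proof.
move=> ab cu dU.
have cU : continuous U by move=> x; exact: is_derive_continuous1.
rewrite /Rintegral (@continuous_FTC2 _ u U)//.
- exact: continuous_subspaceT.
- split=> [x _||]; first by have [] := dU x.
  + by apply: cvg_at_right_filter; exact: cU.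
  + by apply: cvg_at_left_filter; exact: cU.
- by move=> x _; rewrite derive1E; have [] := dU x.
Qed.

Lemma cc1_FTC L u U : 0 < L -> cc1 L u -> (forall x : R, is_derive x 1 U (u x)) ->
  int1 u = U L - U (- L).
Proof.
move=> L0 uL dU; rewrite (cc1_restrict uL) (FTC2_itv _ _ dU)//.
  by rewrite gtrN.
by case: uL.
Qed.

Lemma cc1_lin L a u v : cc1 L u -> cc1 L v ->
  int1 (fun x => a * u x + v x) = a * int1 u + int1 v.
Proof.
move=> uL vL; have wL : cc1 L (fun x => a * u x + v x).
  split; last by move=> x Lx; rewrite uL.2// vL.2// mulr0 addr0.
  by move=> x; apply: cvgD; [apply: cvgMr; exact: uL.1|exact: vL.1].
have cu := uL.1; have cv := vL.1.
rewrite (cc1_restrict uL) (cc1_restrict vL) (cc1_restrict wL).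
rewrite RintegralD//= ?RintegralZl//.
- exact: continuous_itv_integrable.
- by apply: continuous_itv_integrable => x; apply: cvgMr; exact: uL.1.
- exact: continuous_itv_integrable.
Qed.

(** The weight enters through a primitive [W], so its integral over the box is an increment of [W],
    which may have a bound that does not depend on [L]. *)
Lemma cc1_weight L u (w W : R -> R) M B : 0 < L -> cc1 L u -> continuous w ->
  (forall x : R, is_derive x 1 W (w x)) -> W L - W (- L) <= B -> 0 <= M ->
  (forall x, `|x| <= L -> `|u x| <= M * w x) -> `|int1 u| <= M * B.
Proof.
move=> L0 uL cw dW WB M0 H; rewrite (cc1_restrict uL).
have cu := uL.1.
apply: le_trans (le_normr_Rintegral _ (continuous_itv_integrable _ _ cu)) _ => //.
apply: le_trans (_ : (\int[mu]_(x in `[(- L), L]) (M * w x))%R <= _).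
  apply: le_Rintegral => //.
  - apply: continuous_itv_integrable => x.
    exact: (continuous_comp (cu x) (@norm_continuous _ R^o _)).
  - by apply: continuous_itv_integrable => x; apply: cvgMr; exact: cw.
  - by move=> x; rewrite /= in_itv/= -ler_norml => xL; exact: H.
rewrite RintegralZl//; last exact: continuous_itv_integrable.
by rewrite ler_wpM2l// (FTC2_itv _ cw dW)// gtrN.
Qed.

Lemma mvt_bound (h h' : R -> R) (t s e : R) :
  (forall x : R, is_derive x 1 h (h' x)) ->
  (forall x, `|x - t| <= `|s| -> `|h' x - h' t| <= e) ->
  `|h (s + t) - h t - s * h' t| <= e * `|s|.
Proof.
move=> dh He.
have ch a b : {within `[a, b], continuous h}.
  by apply: continuous_subspaceT => x; exact: is_derive_continuous1.
have [s0|s0|->] := ltgtP s 0; last first.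
- by rewrite add0r subrr mul0r subr0 normr0 mulr0.
- have [|c + hc] := @MVT R h h' t (s + t) _ (fun x _ => dh x) (ch _ _).
    by rewrite ltrDr.
  rewrite in_itv/= => /andP[tc cs].
  rewrite hc addrK mulrC -mulrBr normrM mulrC ler_wpM2r// He//.
  by rewrite gtr0_norm ?subr_gt0// gtr0_norm// lerBlDr ltW.
- have [|c + hc] := @MVT R h h' (s + t) t _ (fun x _ => dh x) (ch _ _).
    by rewrite gtrDr.
  rewrite in_itv/= => /andP[tc cs].
  have -> : h (s + t) - h t = s * h' c by rewrite -[LHS]opprB hc; ring.
  rewrite -mulrBr normrM mulrC ler_wpM2r// He//.
  by rewrite ltr0_norm ?subr_lt0// ltr0_norm// opprB lerBlDr addrC -lerBlDr opprK addrC ltW.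
Qed.

Lemma derive0_const (h : R -> R) a b : (forall x : R, is_derive x 1 h (0 : R)) -> h a = h b.
Proof.
move=> dh; apply/eqP; rewrite -subr_eq0 -normr_le0.
have := @mvt_bound h (fun=> 0) b (a - b) 0 dh.
by rewrite subrK mulr0 !subr0 mul0r normr0; apply.
Qed.

Lemma deriveB_bound (h h1 k k1 : R -> R) (a b e : R) :
  (forall x : R, is_derive x 1 h (h1 x)) -> (forall x : R, is_derive x 1 k (k1 x)) ->
  (forall x, `|h1 x - k1 x| <= e) -> `|(h b - k b) - (h a - k a)| <= e * `|b - a|.
Proof.
move=> dh dk He; wlog ab : a b / a <= b.
  move=> H; have [/H//|/ltW/H] := leP a b.
  by rewrite distrC [X in _ * X]distrC.
have dhk (x : R) : is_derive x 1 (fun x => h x - k x) (h1 x - k1 x).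
  exact: is_deriveB.
have [<-|/eqP anb] := eqVneq a b; first by rewrite !subrr normr0 mulr0.
have [||c _ ->] := @MVT R (fun x => h x - k x) _ a b _ (fun x _ => dhk x).
- by rewrite lt_neqAle ab andbT; exact/eqP.
- by apply: continuous_subspaceT => x; exact: is_derive_continuous1 (dhk x).
- by rewrite normrM ler_wpM2r.
Qed.

Lemma cc1_primitive L u : 0 < L -> cc1 L u ->
  exists2 U, forall x : R, is_derive x 1 U (u x) & U (- L) = 0.
Proof.
(* The base point lies strictly to the left of [- L]: for x > a the fundamental theorem applies, and
   for x <= a the primitive vanishes on a neighbourhood of radius 1, so both cases give two-sided
   derivatives. *)
move=> L0 [cu uL]; pose a := - L - 1.
pose U x := (\int[mu]_(t in `[a, x]) u t)%R.
have U0 x : x <= - L -> U x = 0.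
  move=> xL; rewrite /U (_ : Rintegral _ _ _ = (\int[mu]_(t in `[a, x]) (cst 0 t))%R).
    by rewrite Rintegral_cst// mul0r.
  apply: eq_Rintegral => t; rewrite inE /= in_itv/= => /andP[_ tx].
  have [tL|] := eqVneq t (- L); last first.
    move=> tL; apply: uL; rewrite ltr_normr; apply/orP; right.
    by rewrite ltrNr lt_neqAle tL (le_trans tx xL).
  (* [cc1] says nothing at [- L] itself; there [u] vanishes by continuity. *)
  rewrite tL /=; apply/eqP; rewrite -normr_le0; apply/ler_addgt0Pl => e e0.
  have /cvg_eps/(_ _ e0)[D D0 HD] := cu (- L).
  have := HD (- L - D / 2); rewrite addrAC subrr add0r normrN gtr0_norm ?divr_gt0//.
  rewrite uL ?sub0r ?normrN ?addr0; first by apply; rewrite ltr_pdivrMr// ltr_pMr// ltr1n.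
  rewrite -opprD normrN ger0_norm ?addr_ge0 ?ltW ?divr_gt0//.
  by rewrite ltrDl divr_gt0.
exists U; last exact: U0.
move=> x; have [ax|ax] := ltP a x.
  have [|H1 H2] := @continuous_FTC1_closed _ u a x (x + 1) _ (continuous_itv_integrable _ _ cu) ax (cu x).
    by rewrite ltrDl.
  by apply: DeriveDef; [exact: H1|rewrite -derive1E].
rewrite uL; last first.
  rewrite ltr_normr; apply/orP; right; rewrite ltrNr; apply: le_lt_trans ax _.
  by rewrite gtrDl oppr_lt0.
apply/is_derive_eps => e e0; exists 1 => // s s1.
rewrite [s *: 1]mulr1 mulr0 subr0 !U0 ?subrr ?normr0 ?mulr_ge0 ?(ltW e0)//.
  by apply: le_trans ax _; rewrite gerDl oppr_le0.
apply: le_trans (lerD (ltW (ltr_normlW s1)) ax) _.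
by rewrite /a addrC subrK.
Qed.

Lemma int1_affine L u (a b : R) : 0 < L -> 0 < a -> cc1 L u ->
  int1 (fun x => u (a * x + b)) = a^-1 * int1 u.
Proof.
move=> L0 a0 uL; have [U dU _] := cc1_primitive L0 uL.
(* If |a x + b| <= L then a |x| <= L + |b|, so this box contains the support after substitution. *)
pose M := (L + `|b|) / a.
have M0 : 0 < M by rewrite divr_gt0// ltr_wpDr.
have aff (x : R) : is_derive x 1 (fun x => a * x + b) a.
  apply/is_derive_eps => e e0; exists 1 => // s _; rewrite [s *: 1]mulr1.
  rewrite (_ : _ - _ - _ = 0) ?normr0 ?mulr_ge0 ?(ltW e0)//; ring.
have dV (x : R) : is_derive x 1 (fun x => a^-1 * U (a * x + b)) (u (a * x + b)).
  have D0 : is_derive x 1 (fun x => U (a * x + b)) (u (a * x + b) * a).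
    exact: (is_derive1_comp (dU _) (aff x)).
  have := @is_deriveZ R R R _ a^-1 x 1 _ D0.
  by rewrite /GRing.scale /= mulrC mulfK ?gt_eqF.
have cV : cc1 M (fun x => u (a * x + b)).
  split; first by move=> x; apply: continuous_comp; [exact: is_derive_continuous1 (aff x)|exact: uL.1].
  move=> x; rewrite ltr_pdivrMr// => H; apply: uL.2.
  have : `|x| * a <= `|a * x + b| + `|b|.
    rewrite -{1}(gtr0_norm a0) -normrM mulrC -[X in `|X| <= _](addrK b).
    by rewrite (le_trans (ler_normB _ _)).
  by move=> H'; rewrite -(ltrD2r `|b|); exact: lt_le_trans H H'.
rewrite (cc1_FTC M0 cV dV) (cc1_FTC L0 uL dU) -mulrBr; congr (_ * _).
(* The primitive is constant on either side of the support, so its increments over the two boxes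
   agree. *)
have out x y : (L <= x /\ L <= y) \/ (x <= - L /\ y <= - L) -> U x = U y.
  move=> xy; apply/eqP; rewrite -subr_eq0 -normr_le0.
  wlog lxy : x y xy / x < y.
    move=> H; have [xy'|xy'|->] := ltgtP x y; last by rewrite subrr normr0.
      exact: H.
    by rewrite distrC H//; case: xy => -[]; [left|right].
  rewrite distrC; have [||c + ->] := @MVT R U u x y _ (fun x _ => dU x) => //.
    by apply: continuous_subspaceT => z; exact: is_derive_continuous1.
  rewrite in_itv/= => /andP[xc cy]; rewrite uL.2 ?mul0r ?normr0// ltr_normr.
  by case: xy => -[H1 H2]; apply/orP; [left; exact: le_lt_trans xc|right; rewrite ltrNr; exact: lt_le_trans H2].
have aM : a * M = L + `|b| by rewrite /M mulrC divfK ?gt_eqF.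
congr (_ - _); apply: out; rewrite ?mulrN aM.
  left; split=> //; rewrite -addrA lerDl -lerBlDr sub0r.
  by rewrite -normrN ler_norm.
right; split=> //; rewrite opprD -addrA gerDl addrC subr_le0 ler_norm//.
Qed.

Lemma int1_ge0 u : (forall x, 0 <= u x) -> 0 <= int1 u.
Proof. by move=> u0; apply: Rintegral_ge0. Qed.

(** The primitive is nondecreasing, and its mean-value slope is positive on an interval [0, m] where
    u stays above u(0)/2. *)
Lemma int1_gt0 L u : 0 < L -> cc1 L u -> (forall x, 0 <= u x) -> 0 < u 0 -> 0 < int1 u.
Proof.
move=> L0 uL u0 u00.
have [U dU _] := cc1_primitive L0 uL; rewrite (cc1_FTC L0 uL dU).
have cU a b : {within `[a, b], continuous U}.
  by apply: continuous_subspaceT => z; exact: is_derive_continuous1.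
have Ule x y : x <= y -> U x <= U y.
  rewrite le_eqVlt => /predU1P[->//|xy].
  have [c _ H] := @MVT R U u x y xy (fun x _ => dU x) (cU _ _).
  by rewrite -subr_ge0 H mulr_ge0// subr_ge0 ltW.
have h0 : 0 < u 0 / 2 by rewrite divr_gt0.
have /cvg_eps/(_ _ h0)[D D0 HD] := uL.1 0.
pose m := Num.min (D / 2) L.
have m0 : 0 < m by rewrite /m lt_min L0 divr_gt0.
have [c + H] := @MVT R U u 0 m m0 (fun x _ => dU x) (cU _ _).
rewrite in_itv/= => /andP[c0 cm].
have uc : 0 < u c.
  have := HD c; rewrite subr0 gtr0_norm// => /(_ _)/wrap[].
    apply: lt_trans cm _; rewrite gt_min; apply/orP; left.
    by rewrite ltr_pdivrMr// ltr_pMr// ltr1n.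
  rewrite distrC => /(le_trans (ler_norm _)); rewrite lerBlDr => H1.
  rewrite -(ltrD2l (u 0 / 2)) addr0; apply: lt_le_trans H1.
  by rewrite ltr_pdivrMr// ltr_pMr// ltr1n.
rewrite subr_gt0; apply: le_lt_trans (Ule _ 0 _) _; first by rewrite oppr_le0 ltW.
apply: lt_le_trans (Ule m _ _); last by rewrite ge_min lexx orbT.
by rewrite -subr_gt0 H mulr_gt0// subr0.
Qed.

End OneDim.

(** * Splitting off the first coordinate *)

Section ConsVector.
Context {R : realType} {d : nat}.
Implicit Types (x : R) (y : 'rV[R]_d).

Definition cons_rv x y : 'rV[R]_d.+1 := row_mx (x%:M : 'rV[R]_1) y.

Lemma cons_rv0 x y : cons_rv x y ord0 ord0 = x.
Proof.
rewrite /cons_rv (_ : ord0 = lshift d (ord0 : 'I_1)); last exact: val_inj.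
by rewrite (row_mxEl (x%:M : 'rV[R]_1)) mxE eqxx mulr1n.
Qed.

Lemma cons_rvS x y j : cons_rv x y ord0 (lift ord0 j) = y ord0 j.
Proof.
rewrite /cons_rv (_ : lift ord0 j = rshift 1 j); last exact: val_inj.
by rewrite (row_mxEr (x%:M : 'rV[R]_1)).
Qed.

Lemma cons_rv_ext (z w : 'rV[R]_d.+1) : z ord0 ord0 = w ord0 ord0 ->
  (forall j, z ord0 (lift ord0 j) = w ord0 (lift ord0 j)) -> z = w.
Proof.
move=> H0 H1; apply/rowP => j; by have [k ->|->] := unliftP ord0 j.
Qed.

Lemma cons_rvD x x' y y' : cons_rv (x + x') (y + y') = cons_rv x y + cons_rv x' y'.
Proof.
by apply: cons_rv_ext => [|j]; rewrite [RHS]mxE ?cons_rv0 ?cons_rvS// mxE.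
Qed.

Lemma cons_rvZ a x y : cons_rv (a * x) (a *: y) = a *: cons_rv x y.
Proof.
by apply: cons_rv_ext => [|j]; rewrite [RHS]mxE ?cons_rv0 ?cons_rvS// mxE.
Qed.

Lemma norm_cons_rv_le x y M : 0 <= M -> `|x| <= M -> `|y| <= M -> `|cons_rv x y| <= M.
Proof.
move=> M0 xM yM; apply: norm_rV_le => // j; have [k ->|->] := unliftP ord0 j.
  by rewrite cons_rvS (le_trans (coord_le_norm _ _)).
by rewrite cons_rv0.
Qed.

Lemma norm_cons_rv1 x y : `|x| <= `|cons_rv x y|.
Proof. by have := coord_le_norm (cons_rv x y) ord0; rewrite cons_rv0. Qed.

Lemma norm_cons_rv2 x y : `|y| <= `|cons_rv x y|.
Proof.
apply: norm_rV_le => // j.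
by have := coord_le_norm (cons_rv x y) (lift ord0 j); rewrite cons_rvS.
Qed.

Lemma cons_rvB x x' y y' : cons_rv x y - cons_rv x' y' = cons_rv (x - x') (y - y').
Proof. by apply/eqP; rewrite subr_eq -cons_rvD !subrK. Qed.

Lemma cons_rvK (z : 'rV[R]_d.+1) : exists x y, z = cons_rv x y.
Proof.
exists (z ord0 ord0), (\row_j z ord0 (lift ord0 j)).
by apply: cons_rv_ext => [|j]; rewrite ?cons_rv0 ?cons_rvS ?mxE.
Qed.

End ConsVector.

(** * Linearity and weighted bounds for the iterated integral *)

Section MultiIntegral.
Context {R : realType}.

Definition cc d (L : R) (g : 'rV[R]_d -> R) :=
  continuous g /\ forall x, L < `|x| -> g x = 0.

Lemma integral_realS d (g : 'rV[R]_d.+1 -> R) :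
  integral_real g = int1 (fun x => integral_real (fun y => g (cons_rv x y))).
Proof. by []. Qed.

Lemma cc_lin d (L : R) a (g h : 'rV[R]_d -> R) : cc L g -> cc L h ->
  cc L (fun x => a * g x + h x).
Proof.
move=> [cg gL] [ch hL]; split; last by move=> x Lx; rewrite gL// hL// mulr0 addr0.
by move=> x; exact: (cvgD (cvgM (cvg_cst _) (cg x)) (ch x)).
Qed.

(** Two weights are used: the constant one, whose bound 2 L is the length of the interval, and the
    Cauchy density, whose bound pi is independent of [L] and so survives growing boxes. *)
Definition weight (L : R) (w : R -> R) (B : R) :=
  [/\ continuous w, forall x, 0 <= w x, 0 <= B &
   exists2 W : R -> R, forall x : R, is_derive x 1 W (w x) & W L - W (- L) <= B].

Lemma weight_cst L : 0 < L -> weight L (fun=> 1) (2 * L).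
Proof.
move=> L0; split; [exact: cst_continuous|by []|by rewrite mulr_ge0// ltW|].
by exists id; [move=> x; exact: is_derive_id|rewrite opprK mulr2n mulrDl !mul1r].
Qed.

Lemma weight_cauchy L : weight L (fun x => (1 + x ^+ 2)^-1) pi.
Proof.
split.
- move=> x; apply: cvgV; first by rewrite gt_eqF// ltr_pwDl// sqr_ge0.
  by apply: cvgD; [exact: cvg_cst|exact: exprn_continuous].
- by move=> x; rewrite invr_ge0 addr_ge0// sqr_ge0.
- exact: pi_ge0.
- exists atan; first exact: is_derive1_atan.
  rewrite [leRHS]splitr lerD//; first exact/ltW/atan_ltpi2.
  by rewrite lerNl; exact/ltW/atan_gtNpi2.
Qed.

Lemma box_compact d (L : R) : compact [set y : 'rV[R]_d | `|y| <= L].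
Proof.
apply: bounded_closed_compact.
  by exists L; split; [exact: num_real|move=> M LM y /= /le_trans; apply; exact: ltW].
rewrite (_ : mkset _ = (fun y : 'rV[R]_d => `|y|) @^-1` [set x | x <= L])//.
by apply: preimage_closed; [move=> x _; exact: norm_continuous|exact: closed_le].
Qed.

(** Compactness of the box makes joint continuity uniform in the second variable; outside the box
    both values are 0. This is what continuity and differentiation under the integral sign rest
    on. *)
Lemma tube (Z V : normedModType R) (G : Z -> V -> R) (L : R) (z0 : Z) :
  compact [set y : V | `|y| <= L] ->
  continuous (fun p : Z * V => G p.1 p.2) ->
  (forall z x, L < `|x| -> G z x = 0) ->
  forall e : R, 0 < e -> exists2 D : R, 0 < D &
    forall z, `|z - z0| < D -> forall y, `|G z y - G z0 y| <= e.
Proof.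
move=> cptL cG GL e e0.
have Hk : near_covering [set y : V | `|y| <= L].
  by apply/compact_near_coveringP.
have Hy (y : V) : [set y : V | `|y| <= L] y ->
    \forall y' \near y & z \near nbhs z0, `|G z y' - G z0 y'| <= e.
  move=> _; have e2 : 0 < e / 2 by rewrite divr_gt0.
  have /cvgrPdist_le/(_ _ e2) := cG (z0, y).
  move=> [[A B] /= [nA nB] H]; exists (B, A) => //= -[y' z] /= [By Az].
  have H1 := H (z, y') (conj Az By); have H2 := H (z0, y') (conj (nbhs_singleton nA) By).
  rewrite /= in H1 H2; rewrite [e]splitr -(subrKA (G z0 y)).
  by rewrite (le_trans (ler_normD _ _))// lerD// distrC.
have /nbhs_ballP[D /= D0 HD] :=
  Hk Z (nbhs z0) (fun z y => `|G z y - G z0 y| <= e) (nbhs_filter z0) Hy.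
exists D => // z zD y.
have [yL|Ly] := leP `|y| L; last by rewrite !GL// subrr normr0 ltW.
by apply: (HD z); rewrite // -ball_normE /= distrC.
Qed.

Lemma cons_rv_continuous d : continuous (fun p : R * 'rV[R]_d => cons_rv p.1 p.2).
Proof.
move=> p; apply/cvg_eps => e e0; exists e => // q pq.
rewrite cons_rvB; apply: norm_cons_rv_le; first exact: ltW.
  by apply: le_trans (ltW pq); rewrite [leRHS]/Num.norm/= le_max lexx.
by apply: le_trans (ltW pq); rewrite [leRHS]/Num.norm/= le_max lexx orbT.
Qed.

Lemma pair_continuous (T : topologicalType) (U V : normedModType R) (f : T -> U) (g : T -> V) :
  continuous f -> continuous g -> continuous (fun t => (f t, g t)).
Proof. by move=> cf cg t; apply: cvg_pair; [exact: cf|exact: cg]. Qed.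

Lemma cc_slice d (L : R) (g : 'rV[R]_d.+1 -> R) x : cc L g -> cc L (fun y => g (cons_rv x y)).
Proof.
move=> [cg gL]; split; last by move=> y Ly; apply: gL; exact: lt_le_trans (norm_cons_rv2 _ _).
move=> y; apply: (@continuous_comp _ _ _ (fun y => cons_rv x y) g); last exact: cg.
apply/cvg_eps => e e0; exists e => // y' yy'; rewrite cons_rvB subrr.
by apply: norm_cons_rv_le; rewrite ?normr0 ltW.
Qed.

Lemma cc_slice2 d (L : R) (g : 'rV[R]_d.+1 -> R) : cc L g ->
  continuous (fun p : R * 'rV[R]_d => g (cons_rv p.1 p.2)).
Proof.
move=> [cg _] p; apply: continuous_comp; [exact: cons_rv_continuous|exact: cg].
Qed.

(** The two properties are proved together by induction: in dimension d + 1 the slice integrals must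
    first be seen to be continuous in the first coordinate, and this takes both properties in
    dimension d. *)
Definition good_integral d := forall L : R, 0 < L ->
  (forall a (g h : 'rV[R]_d -> R), cc L g -> cc L h ->
     integral_real (fun x => a * g x + h x) = a * integral_real g + integral_real h) /\
  (forall w B M (g : 'rV[R]_d -> R), weight L w B -> cc L g -> 0 <= M ->
     (forall x, `|g x| <= M * \prod_j w (x ord0 j)) ->
     `|integral_real g| <= M * B ^+ d).

Lemma good_param d (Z : normedModType R) (G : Z -> 'rV[R]_d -> R) (L : R) :
  good_integral d -> 0 < L ->
  continuous (fun p : Z * 'rV[R]_d => G p.1 p.2) ->
  (forall z x, L < `|x| -> G z x = 0) ->
  continuous (fun z => integral_real (G z)).
Proof.
move=> good L0 cG GL z0; have [lin bnd] := good _ L0.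
have ccG z : cc L (G z).
  split; last exact: GL.
  move=> y; apply: (@continuous_comp _ _ _ (fun y => (z, y)) (fun p => G p.1 p.2)); last exact: cG.
  exact: (pair_continuous (@cst_continuous _ _ z) (fun y => cvg_id)).
apply/cvg_eps => e e0; pose M := e / ((2 * L) ^+ d + 1).
have M0 : 0 < M by rewrite divr_gt0// ltr_wpDl// exprn_ge0// mulr_ge0// ltW.
have [D D0 HD] := tube z0 (@box_compact d L) cG GL M0; exists D => // z zD.
have := bnd _ _ M _ (weight_cst L0) (cc_lin (-1) (ccG z0) (ccG z)) (ltW M0).
rewrite lin// mulN1r addrC => /(_ _)/wrap[].
  by move=> y; rewrite big1// mulr1 mulN1r addrC; exact: HD.
move=> /le_trans; apply; rewrite /M -mulrA -[leRHS]mulr1 ler_wpM2l ?(ltW e0)//.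
by rewrite mulrC ler_pdivrMr ?mul1r ?lerDl// ltr_wpDl// exprn_ge0// mulr_ge0// ltW.
Qed.

Lemma good_slice d (L : R) (g : 'rV[R]_d.+1 -> R) : good_integral d -> 0 < L -> cc L g ->
  cc1 L (fun x => integral_real (fun y => g (cons_rv x y))).
Proof.
move=> good L0 gL; have [cf fL] := gL; split.
  apply: (@good_param d R (fun x y => g (cons_rv x y)) L good L0 (cc_slice2 gL)).
  by move=> z x Lx; apply: fL; exact: lt_le_trans (norm_cons_rv2 _ _).
move=> x Lx; have [_ bnd] := good _ L0; apply/eqP; rewrite -normr_le0.
have := bnd _ _ 0 _ (weight_cst L0) (cc_slice x gL) (lexx _).
by rewrite !mul0r; apply=> y; rewrite fL ?normr0//; exact: lt_le_trans (norm_cons_rv1 _ _).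
Qed.

Lemma good_integralP d : good_integral d.
Proof.
elim: d => [|d IH] L L0; split.
- by [].
- move=> w B M g _ _ _ /(_ 0); rewrite big_ord0 !mulr1; exact.
- move=> a g h gL hL; rewrite !integral_realS.
  have [lin _] := IH _ L0.
  rewrite -(cc1_lin a (good_slice IH L0 gL) (good_slice IH L0 hL)); congr int1; apply/funext => x.
  by rewrite lin//; exact: cc_slice.
- move=> w B M g wB gL M0 H; rewrite integral_realS.
  have [cw w0 B0 [W dW WB]] := wB; have [lin bnd] := IH _ L0.
  rewrite exprSr mulrA.
  apply: (cc1_weight L0 (good_slice IH L0 gL) cw dW WB).
    by rewrite mulr_ge0// exprn_ge0.
  move=> x xL; rewrite mulrAC.
  apply: (bnd w B _ _ wB (cc_slice x gL)); first exact: mulr_ge0.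
  move=> y; apply: le_trans (H _) _; rewrite big_ord_recl cons_rv0 mulrA.
  rewrite le_eqVlt; apply/orP; left; apply/eqP; congr (_ * _).
  by apply: eq_bigr => j _; rewrite cons_rvS.
Qed.

End MultiIntegral.

(** * Substitution, differentiation under the integral, parts and Fubini *)

Section IntegralCalculus.
Context {R : realType}.
Implicit Types (L : R).

Lemma int_lin d L a (g h : 'rV[R]_d -> R) : 0 < L -> cc L g -> cc L h ->
  integral_real (fun x => a * g x + h x) = a * integral_real g + integral_real h.
Proof. by move=> L0; have [lin _] := @good_integralP R d L L0; exact: lin. Qed.

Lemma int_bound d L M (g : 'rV[R]_d -> R) : 0 < L -> cc L g -> 0 <= M ->
  (forall x, `|g x| <= M) -> `|integral_real g| <= M * (2 * L) ^+ d.
Proof.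
move=> L0 gL M0 H; have [_ bnd] := @good_integralP R d L L0.
by apply: (bnd _ _ _ _ (weight_cst L0) gL M0) => x; rewrite big1// mulr1.
Qed.

Lemma int_cauchy d L M (g : 'rV[R]_d -> R) : 0 < L -> cc L g -> 0 <= M ->
  (forall x, `|g x| <= M * \prod_j (1 + x ord0 j ^+ 2)^-1) ->
  `|integral_real g| <= M * pi ^+ d.
Proof.
move=> L0 gL M0 H; have [_ bnd] := @good_integralP R d L L0.
exact: (bnd _ _ _ _ (weight_cauchy L) gL M0).
Qed.

Lemma int_param_continuous d (Z : normedModType R) (G : Z -> 'rV[R]_d -> R) L : 0 < L ->
  continuous (fun p : Z * 'rV[R]_d => G p.1 p.2) ->
  (forall z x, L < `|x| -> G z x = 0) -> continuous (fun z => integral_real (G z)).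
Proof. by move=> L0; apply: good_param => //; exact: good_integralP. Qed.

Lemma cc0 d L : cc L (fun _ : 'rV[R]_d => 0 : R).
Proof. by split => //; exact: cst_continuous. Qed.

Lemma int0 d : integral_real (fun _ : 'rV[R]_d => 0 : R) = 0.
Proof.
apply/eqP; rewrite -normr_le0.
have := @int_bound d 1 0 _ ltr01 (@cc0 d 1) (lexx _).
by rewrite mul0r; apply=> x; rewrite normr0.
Qed.

Lemma cc_int_slice d L (g : 'rV[R]_d.+1 -> R) : 0 < L -> cc L g ->
  cc1 L (fun x => integral_real (fun y => g (cons_rv x y))).
Proof. by move=> L0; apply: good_slice => //; exact: good_integralP. Qed.

Lemma intZ d L a (g : 'rV[R]_d -> R) : 0 < L -> cc L g ->
  integral_real (fun x => a * g x) = a * integral_real g.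
Proof.
move=> L0 gL; have := int_lin a L0 gL (cc0 _ L); rewrite int0 addr0 => <-.
by congr integral_real; apply/funext => x; rewrite addr0.
Qed.

Lemma intD d L (g h : 'rV[R]_d -> R) : 0 < L -> cc L g -> cc L h ->
  integral_real (fun x => g x + h x) = integral_real g + integral_real h.
Proof.
move=> L0 gL hL; have := int_lin 1 L0 gL hL; rewrite mul1r => <-.
by congr integral_real; apply/funext => x; rewrite mul1r.
Qed.

Lemma intB d L (g h : 'rV[R]_d -> R) : 0 < L -> cc L g -> cc L h ->
  integral_real (fun x => g x - h x) = integral_real g - integral_real h.
Proof.
move=> L0 gL hL; have := int_lin (-1) L0 hL gL; rewrite mulN1r addrC => <-.
by congr integral_real; apply/funext => x; rewrite mulN1r addrC.
Qed.

Lemma int_ge0 d (g : 'rV[R]_d -> R) : (forall x, 0 <= g x) -> 0 <= integral_real g.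
Proof.
elim: d g => [|d IH] g g0; first exact: g0.
by apply: int1_ge0 => x; exact: IH.
Qed.

Lemma int_gt0 d L (g : 'rV[R]_d -> R) : 0 < L -> cc L g -> (forall x, 0 <= g x) ->
  0 < g 0 -> 0 < integral_real g.
Proof.
move=> L0; elim: d g => [|d IH] g gL g0 g00; first exact: g00.
rewrite integral_realS; apply: (int1_gt0 L0 (cc_int_slice L0 gL)).
  by move=> x; exact: int_ge0.
apply: IH => //; first exact: cc_slice.
by rewrite (_ : cons_rv 0 0 = 0)//; apply: cons_rv_ext => [|j]; rewrite ?cons_rv0 ?cons_rvS !mxE.
Qed.

Lemma int_le d L (g h : 'rV[R]_d -> R) : 0 < L -> cc L g -> cc L h ->
  (forall x, g x <= h x) -> integral_real g <= integral_real h.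
Proof.
move=> L0 gL hL gh; rewrite -subr_ge0 -(intB L0 hL gL).
by apply: int_ge0 => x; rewrite subr_ge0.
Qed.

Lemma int_affine d L a (b : 'rV[R]_d) (g : 'rV[R]_d -> R) : 0 < L -> 0 < a -> cc L g ->
  integral_real (fun x => g (a *: x + b)) = a ^- d * integral_real g.
Proof.
move=> L0 a0; elim: d b g => [|d IH] b g gL.
  by rewrite expr0 invr1 mul1r /= scaler0 add0r; congr g; apply/rowP => -[].
have [b0 [b' ->]] := cons_rvK b.
rewrite !integral_realS.
transitivity (int1 (fun x => a ^- d * (fun x => integral_real (fun y => g (cons_rv x y))) (a * x + b0))).
  congr int1; apply/funext => x /=; rewrite -(IH b' (fun y => g (cons_rv _ y))); last exact: cc_slice.
  by congr integral_real; apply/funext => y; rewrite -cons_rvZ -cons_rvD.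
have cS := cc_int_slice L0 gL.
transitivity (a ^- d * int1 (fun x => (fun x => integral_real (fun y => g (cons_rv x y))) (a * x + b0))).
  pose M := (L + `|b0|) / a.
  have cM : cc1 M (fun x => (fun x => integral_real (fun y => g (cons_rv x y))) (a * x + b0)).
    split.
      have : continuous ((fun x => integral_real (fun y => g (cons_rv x y))) \o (fun x => a * x + b0)).
        move=> x; apply: continuous_comp; last exact: cS.1.
        exact: (cvgD (cvgM (cvg_cst _) cvg_id) (cvg_cst _)).
      exact.
    move=> x; rewrite /M ltr_pdivrMr// => H; apply: cS.2.
    have : `|x| * a <= `|a * x + b0| + `|b0|.
      rewrite -{1}(gtr0_norm a0) -normrM mulrC -[X in `|X| <= _](addrK b0).
      by rewrite (le_trans (ler_normB _ _)).
    by move=> H'; rewrite -(ltrD2r `|b0|); exact: lt_le_trans H H'.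
  have c0 : cc1 M (fun _ : R => 0 : R) by split => //; exact: cst_continuous.
  have i0 : int1 (fun _ : R => 0 : R) = 0 by rewrite /int1 /Rintegral integral0.
  have := cc1_lin (a ^- d) cM c0; rewrite i0 addr0 => <-.
  by congr int1; apply/funext => x; rewrite addr0.
by rewrite (int1_affine _ L0 a0 cS) mulrA exprSr invfM mulrC mulrA.
Qed.

Lemma derivative_boxed d L (A B : R -> 'rV[R]_d -> R) :
  (forall t x, L < `|x| -> A t x = 0) ->
  (forall x (t : R), is_derive t 1 (fun t => A t x) (B t x)) ->
  forall t x, L < `|x| -> B t x = 0.
Proof.
move=> AL dA t x Lx; have [_ <-] := dA x t.
rewrite (_ : (fun t => A t x) = cst 0) ?derive_cst//.
by apply/funext => s; exact: AL.
Qed.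

(** The mean value theorem bounds the remainder at each x by |s| times the oscillation of [B] in t,
    and [tube] makes this oscillation small uniformly in x. *)
Lemma int_derive d L (A B : R -> 'rV[R]_d -> R) : 0 < L ->
  (forall t, cc L (A t)) -> (forall x (t : R), is_derive t 1 (fun t => A t x) (B t x)) ->
  continuous (fun p : R * 'rV[R]_d => B p.1 p.2) ->
  forall t : R, is_derive t 1 (fun t => integral_real (A t)) (integral_real (B t)).
Proof.
move=> L0 AL dA cB t.
have BL := derivative_boxed (fun t => (AL t).2) dA.
have ccB s : cc L (B s).
  split; last exact: BL.
  move=> y; apply: (@continuous_comp _ _ _ (fun y => (s, y)) (fun p => B p.1 p.2)); last exact: cB.
  exact: (pair_continuous (@cst_continuous _ _ s) (fun y => cvg_id)).
apply/is_derive_eps => e e0; pose M := e / ((2 * L) ^+ d + 1).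
have L1 : 0 < (2 * L) ^+ d + 1 by rewrite ltr_wpDl// exprn_ge0// mulr_ge0// ltW.
have M0 : 0 < M by rewrite divr_gt0.
have [D D0 HD] := tube t (@box_compact R d L) cB BL M0; exists D => // s sD.
rewrite [s *: 1]mulr1 -(intB L0 (AL _) (AL _)) -(intZ _ L0 (ccB t)).
have cAB : cc L (fun x => A (s + t) x - A t x).
  have [c1 e1] := cc_lin (-1) (AL t) (AL (s + t)).
  rewrite (_ : (fun x => _) = (fun x => -1 * A t x + A (s + t) x))//.
  by apply/funext => x; rewrite mulN1r addrC.
have cZ : cc L (fun x => s * B t x).
  by have := cc_lin s (ccB t) (cc0 d L); under eq_fun do rewrite addr0.
have cABZ : cc L (fun x => A (s + t) x - A t x - s * B t x).
  have := cc_lin (-1) cZ cAB; rewrite (_ : (fun x => -1 * _ + _) = (fun x => A (s + t) x - A t x - s * B t x))//.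
  by apply/funext => x; rewrite mulN1r addrC.
rewrite -(intB L0 cAB cZ).
apply: le_trans (int_bound L0 cABZ (M := M * `|s|) _ _) _.
- by rewrite mulr_ge0// ltW.
- move=> x; apply: (mvt_bound (fun u => dA x u)) => u us.
  by apply: HD; exact: le_lt_trans sD.
- rewrite /M mulrAC ler_wpM2r// mulrAC ler_pdivrMr// ler_wpM2l ?(ltW e0)//.
  by rewrite lerDl.
Qed.

(** A direction other than the first is a direction of every slice, where induction applies. For the
    first direction, the slice integral of [g] is a primitive of the slice integral of its
    derivative, and it vanishes at both ends. *)
Lemma int_partial d L (g : 'rV[R]_d -> R) (j : 'I_d) : 0 < L -> cc L g ->
  (forall x, derivable g x (delta_mx ord0 j)) -> continuous (partial_real j g) ->
  integral_real (partial_real j g) = 0.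
Proof.
move=> L0; elim: d j g => [[]//|d IH] j g gL dg cg.
have dl (z v : 'rV[R]_d.+1) (dz : derivable g z v) : is_derive z v g ('D_v g z) by [].
rewrite integral_realS; have [k jk|jk] := unliftP ord0 j.
  have ev (s : R) x (y : 'rV[R]_d) : cons_rv x (s *: delta_mx ord0 k + y) =
      s *: (delta_mx ord0 j : 'rV[R]_d.+1) + cons_rv x y.
    have -> : (delta_mx ord0 j : 'rV[R]_d.+1) = cons_rv 0 (delta_mx ord0 k).
      apply: cons_rv_ext => [|i]; first by rewrite cons_rv0 mxE jk.
      by rewrite cons_rvS !mxE jk (inj_eq lift_inj).
    by rewrite -cons_rvZ -cons_rvD mulr0 add0r.
  have dgx x (y : 'rV[R]_d) : is_derive y (delta_mx ord0 k : 'rV[R]_d) (fun y => g (cons_rv x y))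
      (partial_real j g (cons_rv x y)).
    apply/is_derive_eps => e e0.
    have /is_derive_eps/(_ _ e0)[D D0 HD] := dl _ _ (dg (cons_rv x y)).
    by exists D => // s sD; rewrite ev; exact: HD.
  have E x : (fun y => partial_real j g (cons_rv x y)) = partial_real k (fun y => g (cons_rv x y)).
    by apply/funext => y; have [_ <-] := dgx x y.
  rewrite (_ : (fun x => _) = fun=> 0); first by rewrite /int1 /Rintegral integral0.
  apply/funext => x; rewrite E; apply: IH.
  - exact: cc_slice.
  - by move=> y; have [] := dgx x y.
  - rewrite -E => y; apply: (@continuous_comp _ _ _ (fun y => cons_rv x y)); last exact: cg.
    apply: (@continuous_comp _ _ _ (fun y => (x, y)) (fun p => cons_rv p.1 p.2)).
      exact: (pair_continuous (@cst_continuous _ _ x) (fun y => cvg_id)).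
    exact: cons_rv_continuous.
have dgx (y : 'rV[R]_d) (x : R) : is_derive x 1 (fun x => g (cons_rv x y))
    (partial_real j g (cons_rv x y)).
  apply/is_derive_eps => e e0.
  have /is_derive_eps/(_ _ e0)[D D0 HD] := dl _ _ (dg (cons_rv x y)).
  exists D => // s sD.
  have -> : cons_rv (s *: 1 + x) y = s *: (delta_mx ord0 j : 'rV[R]_d.+1) + cons_rv x y.
    have -> : (delta_mx ord0 j : 'rV[R]_d.+1) = cons_rv 1 0.
      by apply: cons_rv_ext => [|i]; rewrite ?cons_rv0 ?cons_rvS !mxE jk.
    by rewrite -cons_rvZ -cons_rvD scaler0 add0r.
  exact: HD.
have cgj : continuous (fun p : R * 'rV[R]_d => partial_real j g (cons_rv p.1 p.2)).
  by move=> p; apply: continuous_comp; [exact: cons_rv_continuous|exact: cg].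
have dI := int_derive L0 (fun x => cc_slice x gL) dgx cgj.
have bx : forall x (y : 'rV[R]_d), L < `|y| -> partial_real j g (cons_rv x y) = 0.
  apply: derivative_boxed dgx => t x Lx; apply: gL.2; exact: lt_le_trans (norm_cons_rv2 _ _).
(* The box is enlarged by 1 so that its end points lie strictly outside the support, where slice
   integrals are known to be 0. It also leaves room for the increments [s <= 1] below. *)
have cI : cc1 (L + 1) (fun x => integral_real (fun y => partial_real j g (cons_rv x y))).
  split; first exact: (int_param_continuous L0 cgj bx).
  move=> x Lx; rewrite (_ : (fun y => _) = fun=> 0) ?int0//; apply/funext => y.
  have [_ <-] := dgx y x.
  apply/eqP; rewrite -normr_le0; apply/ler_addgt0Pl => e e0; rewrite addr0.
  have /is_derive_eps/(_ _ e0)[D D0 HD] := dgx y x.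
  pose s := Num.min (D / 2) 1.
  have s0 : 0 < s by rewrite lt_min divr_gt0/=.
  have := HD s; rewrite gtr0_norm// => /(_ _)/wrap[].
    by rewrite gt_min ltr_pdivrMr// ltr_pMr// ltr1n.
  rewrite [s *: 1]mulr1 !gL.2.
  - rewrite subrr sub0r normrN normrM (gtr0_norm s0) mulrC ler_pM2r//.
    by have [_ ->] := dgx y x.
  - apply: lt_le_trans (norm_cons_rv1 _ _); apply: lt_trans Lx.
    by rewrite ltrDl.
  - apply: lt_le_trans (norm_cons_rv1 _ _).
    have : `|x| <= `|s + x| + `|s|.
      by rewrite -{1}(addKr s x) addrC (le_trans (ler_normB _ _)).
    rewrite (gtr0_norm s0); have : s <= 1 by rewrite ge_min lexx orbT.
    move: Lx; lra.
have L10 : 0 < L + 1 by rewrite addr_gt0.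
rewrite (cc1_FTC L10 cI dI).
have out x : L < `|x| -> integral_real (fun y => g (cons_rv x y)) = 0.
  by move=> Lx; exact: (cc_int_slice L0 gL).2.
rewrite !out ?subrr// ?normrN gtr0_norm// ltrDl//.
Qed.

(** Fubini reduces to differentiation under the integral: if [A t x] is the primitive of [H] in t
    that vanishes at [- L], the integral of [A t] over x is a primitive of the integral of [H t],
    and both sides are its value at [L]. *)
Lemma int1_int_swap d L (H : R -> 'rV[R]_d -> R) : 0 < L ->
  continuous (fun p : R * 'rV[R]_d => H p.1 p.2) ->
  (forall t x, L < `|x| -> H t x = 0) -> (forall t x, L < `|t| -> H t x = 0) ->
  int1 (fun t => integral_real (H t)) = integral_real (fun x => int1 (fun t => H t x)).
Proof.
move=> L0 cH HL HL'.
have cHx x : cc1 L (fun t => H t x).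
  split; last by move=> t; exact: HL'.
  move=> t; apply: (@continuous_comp _ _ _ (fun t => (t, x)) (fun p => H p.1 p.2)); last exact: cH.
  exact: (pair_continuous (fun y => cvg_id) (@cst_continuous _ _ x)).
have /(_ _)/cid2 P x := cc1_primitive L0 (cHx x).
pose A t x := projT1 (P x) t.
have dA x (t : R) : is_derive t 1 (fun t => A t x) (H t x) by rewrite /A; case: (P x).
have A0 x : A (- L) x = 0 by rewrite /A; case: (P x).
have AE x : A L x = int1 (fun t => H t x) by rewrite (cc1_FTC L0 (cHx x) (dA x)) A0 subr0.
have cH' : continuous (fun p : 'rV[R]_d * R => H p.2 p.1).
  have : continuous ((fun p : R * 'rV[R]_d => H p.1 p.2) \o (fun p : 'rV[R]_d * R => (p.2, p.1))).
    move=> p; apply: continuous_comp; last exact: cH.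
    by apply: pair_continuous => q; [exact: cvg_snd|exact: cvg_fst].
  exact.
have cptR : compact [set y : R | `|y| <= L].
  rewrite (_ : mkset _ = `[(- L), L]%classic); first exact: segment_compact.
  by apply/funext => y; rewrite /= in_itv/= ler_norml.
(* Continuity in x: two primitives that agree at [- L] differ at t by at most |t + L| times the
   supremum of the difference of their derivatives. *)
have cA t : cc L (A t).
  split.
    move=> x; apply/cvg_eps => e e0.
    pose M := e / (`|t + L| + 1).
    have M0 : 0 < M by rewrite divr_gt0// ltr_wpDl.
    have [D D0 HD] := tube x cptR cH' (fun x t => HL' t x) M0.
    exists D => // y yD.
    have := deriveB_bound (- L) t (dA y) (dA x) (HD _ yD).
    rewrite !A0 subrr subr0 opprK => /le_trans; apply.
    by rewrite /M mulrAC ler_pdivrMr ?ltr_wpDl// ler_wpM2l ?(ltW e0)// lerDl.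
  move=> x Lx; rewrite -(A0 x); apply: (@derive0_const _ (fun t => A t x)) => s.
  by have := dA x s; rewrite HL.
have dI := int_derive L0 cA dA cH.
have cI : cc1 L (fun t => integral_real (H t)).
  split; first exact: (int_param_continuous L0 cH HL).
  move=> t Lt; rewrite (_ : H t = fun=> 0) ?int0//.
  by apply/funext => x; exact: HL'.
rewrite (cc1_FTC L0 cI dI).
rewrite (_ : A (- L) = fun=> 0) ?int0 ?subr0; last exact/funext.
by congr integral_real; exact/funext.
Qed.

Lemma int_swap d e L (G : 'rV[R]_d -> 'rV[R]_e -> R) : 0 < L ->
  continuous (fun p : 'rV[R]_d * 'rV[R]_e => G p.1 p.2) ->
  (forall x y, L < `|x| -> G x y = 0) -> (forall x y, L < `|y| -> G x y = 0) ->
  integral_real (fun x => integral_real (G x)) =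
  integral_real (fun y => integral_real (fun x => G x y)).
Proof.
move=> L0; elim: d G => [|d IH] G cG GL GL'; first by [].
have cS t : continuous (fun p : 'rV[R]_d * 'rV[R]_e => G (cons_rv t p.1) p.2).
  have : continuous ((fun p : 'rV[R]_d.+1 * 'rV[R]_e => G p.1 p.2) \o
     (fun p : 'rV[R]_d * 'rV[R]_e => (cons_rv t p.1, p.2))).
    move=> p; apply: continuous_comp; last exact: cG.
    apply: pair_continuous => q; last exact: cvg_snd.
    apply: (@continuous_comp _ _ _ fst (fun y => cons_rv t y)); first exact: cvg_fst.
    apply: (@continuous_comp _ _ _ (fun y => (t, y)) (fun p => cons_rv p.1 p.2)).
      exact: (pair_continuous (@cst_continuous _ _ t) (fun y => cvg_id)).
    exact: cons_rv_continuous.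
  exact.
have cS2 : continuous (fun p : (R * 'rV[R]_e) * 'rV[R]_d => G (cons_rv p.1.1 p.2) p.1.2).
  have : continuous ((fun p : 'rV[R]_d.+1 * 'rV[R]_e => G p.1 p.2) \o
     (fun p : (R * 'rV[R]_e) * 'rV[R]_d => (cons_rv p.1.1 p.2, p.1.2))).
    move=> p; apply: continuous_comp; last exact: cG.
    apply: pair_continuous => q; last first.
      by apply: (@continuous_comp _ _ _ fst snd); [exact: cvg_fst|exact: cvg_snd].
    apply: (@continuous_comp _ _ _ (fun p : (R * 'rV[R]_e) * 'rV[R]_d => (p.1.1, p.2)) (fun p => cons_rv p.1 p.2)).
      apply: pair_continuous => u; last exact: cvg_snd.
      by apply: (@continuous_comp _ _ _ fst fst); exact: cvg_fst.
    exact: cons_rv_continuous.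
  exact.
rewrite integral_realS.
transitivity (int1 (fun t => integral_real (fun y => integral_real (fun x => G (cons_rv t x) y)))).
  congr int1; apply/funext => t; apply: IH; first exact: cS.
  - by move=> x y Lx; apply: GL; exact: lt_le_trans (norm_cons_rv2 _ _).
  - by move=> x y; exact: GL'.
rewrite (int1_int_swap L0)//.
- have := @int_param_continuous d _ (fun (z : R * 'rV[R]_e) x => G (cons_rv z.1 x) z.2) L L0 cS2.
  by apply=> z x Lx; apply: GL; exact: lt_le_trans (norm_cons_rv2 _ _).
- move=> t y Ly; rewrite (_ : (fun x => _) = fun=> 0) ?int0//.
  by apply/funext => x; exact: GL'.
- move=> t y Lt; rewrite (_ : (fun x => _) = fun=> 0) ?int0//.
  by apply/funext => x; apply: GL; exact: lt_le_trans (norm_cons_rv1 _ _).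
Qed.

End IntegralCalculus.

Section ContinuityRules.
Context {R : realType} {T : topologicalType}.
Implicit Types f g : T -> R.

Lemma contD f g : continuous f -> continuous g -> continuous (fun x => f x + g x).
Proof. by move=> cf cg x; exact: (cvgD (cf x) (cg x)). Qed.

Lemma contM f g : continuous f -> continuous g -> continuous (fun x => f x * g x).
Proof. by move=> cf cg x; exact: (cvgM (cf x) (cg x)). Qed.

Lemma contN f : continuous f -> continuous (fun x => - f x).
Proof. by move=> cf x; exact: (cvgN (cf x)). Qed.

Lemma cont_sum n (f : 'I_n -> T -> R) : (forall i, continuous (f i)) ->
  continuous (fun x => \sum_(i < n) f i x).
Proof.
elim: n f => [|n IH] f cf.
  rewrite (_ : (fun x => _) = cst 0); first exact: cst_continuous.
  by apply/funext => x; rewrite big_ord0.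
rewrite (_ : (fun x => _) = fun x => f ord0 x + \sum_(i < n) f (lift ord0 i) x).
  by apply: contD => //; exact: IH.
by apply/funext => x; rewrite big_ord_recl.
Qed.

End ContinuityRules.

(** * The Fourier transform of test functions *)

Section ComplexExponential.
Context {R : realType} {d : nat}.
Implicit Types (a l x : 'rV[R]_d).

Definition ech a l : R[i] := expi (edot a l).

Lemma normc_ech a l : normc (ech a l) = 1.
Proof. exact: normc_expi. Qed.

Lemma edotDl a b l : edot (a + b) l = edot a l + edot b l.
Proof. by rewrite -big_split; apply: eq_bigr => j _; rewrite mxE mulrDl. Qed.

Lemma edotZl s a l : edot (s *: a) l = s * edot a l.
Proof. by rewrite /edot mulr_sumr; apply: eq_bigr => j _; rewrite mxE mulrA. Qed.

Lemma edotC a l : edot a l = edot l a.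
Proof. by apply: eq_bigr => j _; rewrite mulrC. Qed.

Lemma edotNl a l : edot (- a) l = - edot a l.
Proof. by rewrite -scaleN1r edotZl mulN1r. Qed.

Lemma edot_delta j l : edot (delta_mx ord0 j) l = l ord0 j.
Proof.
rewrite /edot (bigD1 j)//= mxE !eqxx mul1r big1 ?addr0// => k kj.
by rewrite mxE (negbTE kj) andbF mul0r.
Qed.

Lemma edot0l l : edot 0 l = 0.
Proof. by rewrite /edot big1// => j _; rewrite mxE mul0r. Qed.

Lemma echDl a b l : ech (a + b) l = ech a l * ech b l.
Proof. by rewrite /ech edotDl expiD. Qed.

Lemma smooth_expr_edot a : smooth_expr (fun l => edot a l).
Proof.
apply: smooth_expr_sum => j.
by apply: (@SmMul _ _ (cst _)); [exact: SmCst|exact: smooth_expr_coord].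
Qed.

Definition trig_span : set (R -> R) :=
  [set h | exists p q : R, h = fun t => p * cos t + q * sin t].

Lemma trig_span_closed : derive_closed trig_span.
Proof.
move=> _ [p [q ->]]; exists (fun t => q * cos t + - p * sin t); first by exists q, (- p).
move=> t; have dc := @is_deriveZ R R R _ p t 1 _ (is_derive_cos t).
have ds := @is_deriveZ R R R _ q t 1 _ (is_derive_sin t).
have := is_deriveD dc ds.
by rewrite [p *: - sin t]mulrN [X in is_derive _ _ _ X]addrC mulNr.
Qed.

Lemma smooth_ech a : smooth (ech a).
Proof.
apply: smoothP.
  apply: (@SmComp _ _ _ cos _ trig_span_closed); last exact: smooth_expr_edot.
  by exists 1, 0; apply/funext => t; rewrite mul1r mul0r addr0.
apply: (@SmComp _ _ _ sin _ trig_span_closed); last exact: smooth_expr_edot.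
by exists 0, 1; apply/funext => t; rewrite mul1r mul0r add0r.
Qed.

Lemma is_derive_edot a l j :
  is_derive l (delta_mx ord0 j : 'rV[R]_d) (fun l => edot a l) (a ord0 j).
Proof.
apply/is_derive_eps => e e0; exists 1 => // s _.
rewrite ![edot a _]edotC edotDl edotZl edot_delta addrK subrr normr0.
by rewrite mulr_ge0// ltW.
Qed.

Lemma partial_ech a j : partial j (ech a) = fun l => Complex 0 (a ord0 j) * ech a l.
Proof.
apply/funext => l; have D := is_derive_edot a l j.
have [D1 D2] := D.
have [_ Hc] := is_derive_comp_real (is_derive_cos (edot a l)) D1.
have [_ Hs] := is_derive_comp_real (is_derive_sin (edot a l)) D1.
apply: complex_ext; rewrite ?ReM ?ImM /= /partial_real ?Hc ?Hs D2; ring.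
Qed.

Lemma cont_edot2 : continuous (fun p : 'rV[R]_d * 'rV[R]_d => edot p.1 p.2).
Proof.
apply: cont_sum => j; apply: contM => p.
  by apply: (@continuous_comp _ _ _ fst (fun x : 'rV[R]_d => x ord0 j));
    [exact: cvg_fst|exact: coord_continuous].
by apply: (@continuous_comp _ _ _ snd (fun x : 'rV[R]_d => x ord0 j));
    [exact: cvg_snd|exact: coord_continuous].
Qed.

End ComplexExponential.

Section ComplexIntegral.
Context {R : realType} {d : nat}.
Implicit Types (f g phi : 'rV[R]_d -> R[i]) (L : R).

Definition ccc L f := cc L (fun x => complex.Re (f x)) /\ cc L (fun x => complex.Im (f x)).

Definition cont f := continuous (fun x => complex.Re (f x)) /\
  continuous (fun x => complex.Im (f x)).

Lemma cccP L f : ccc L f <-> cont f /\ forall x, L < `|x| -> f x = 0.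
Proof.
split=> [[[c1 e1] [c2 e2]]|[[c1 c2] e]].
  by split=> // x Lx; apply: complex_ext; rewrite ?e1 ?e2.
by split; split=> // x Lx; rewrite e.
Qed.

Lemma contcM f g : cont f -> cont g -> cont (fun x => f x * g x).
Proof.
move=> [f1 f2] [g1 g2]; split.
  under eq_fun do rewrite ReM; apply: contD; first exact: contM.
  by apply: contN; exact: contM.
by under eq_fun do rewrite ImM; apply: contD; exact: contM.
Qed.

Lemma contcD f g : cont f -> cont g -> cont (fun x => f x + g x).
Proof.
move=> [f1 f2] [g1 g2]; split.
  by under eq_fun do rewrite ReD; exact: contD.
by under eq_fun do rewrite ImD; exact: contD.
Qed.

Lemma contc_cst (c : R[i]) : cont (fun=> c).
Proof. by split; exact: cst_continuous. Qed.

Lemma cccMr L f g : ccc L f -> cont g -> ccc L (fun x => f x * g x).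
Proof.
move=> /cccP[cf fL] cg; apply/cccP; split; first exact: contcM.
by move=> x Lx; rewrite fL// mul0r.
Qed.

Lemma cccMl L f g : ccc L f -> cont g -> ccc L (fun x => g x * f x).
Proof. by move=> fL cg; under eq_fun do rewrite mulrC; exact: cccMr. Qed.

Lemma cccD L f g : ccc L f -> ccc L g -> ccc L (fun x => f x + g x).
Proof.
move=> /cccP[cf fL] /cccP[cg gL]; apply/cccP; split; first exact: contcD.
by move=> x Lx; rewrite fL// gL// addr0.
Qed.

Lemma cccZ L c f : ccc L f -> ccc L (fun x => c * f x).
Proof. by move=> fL; apply: cccMl => //; exact: contc_cst. Qed.

Lemma smooth_cont f : smooth f -> cont f.
Proof. exact: smooth_continuous. Qed.

Lemma icD L f g : 0 < L -> ccc L f -> ccc L g ->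
  integral_complex (fun x => f x + g x) = integral_complex f + integral_complex g.
Proof.
move=> L0 [f1 f2] [g1 g2]; apply: complex_ext; rewrite ?ReD ?ImD /=.
  by rewrite -(intD L0 f1 g1); congr integral_real; apply/funext => x; rewrite ReD.
by rewrite -(intD L0 f2 g2); congr integral_real; apply/funext => x; rewrite ImD.
Qed.

Lemma icZ L c f : 0 < L -> ccc L f ->
  integral_complex (fun x => c * f x) = c * integral_complex f.
Proof.
move=> L0 [f1 f2].
have z1 a := cc_lin a f1 (cc0 d L); have z2 a := cc_lin a f2 (cc0 d L).
apply: complex_ext; rewrite ?ReM ?ImM /=.
  transitivity (integral_real (fun x => complex.Re c * complex.Re (f x) +
    (- complex.Im c * complex.Im (f x) + 0))).
    by congr integral_real; apply/funext => x; rewrite ReM addr0 mulNr.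
  rewrite (int_lin _ L0 f1 (z2 _)) (int_lin _ L0 f2 (cc0 d L)) int0 addr0 mulNr.
  by [].
transitivity (integral_real (fun x => complex.Re c * complex.Im (f x) +
    (complex.Im c * complex.Re (f x) + 0))).
  by congr integral_real; apply/funext => x; rewrite ImM addr0.
by rewrite (int_lin _ L0 f2 (z1 _)) (int_lin _ L0 f1 (cc0 d L)) int0 addr0.
Qed.

Lemma icB L f g : 0 < L -> ccc L f -> ccc L g ->
  integral_complex (fun x => f x - g x) = integral_complex f - integral_complex g.
Proof.
move=> L0 fL gL; rewrite -mulN1r -(icZ _ L0 gL) -(icD L0 fL (cccZ _ gL)).
by congr integral_complex; apply/funext => x; rewrite mulN1r.
Qed.

Lemma ic_bound L M f : 0 < L -> ccc L f -> 0 <= M -> (forall x, normc (f x) <= M) ->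
  normc (integral_complex f) <= 2 * (M * (2 * L) ^+ d).
Proof.
move=> L0 [f1 f2] M0 H; apply: le_trans (normc_le _) _.
rewrite mulrDl !mul1r lerD//=.
  by apply: (int_bound L0 f1 M0) => x; apply: le_trans (H x); exact: normc_Re.
by apply: (int_bound L0 f2 M0) => x; apply: le_trans (H x); exact: normc_Im.
Qed.

Lemma ic_cauchy L M f : 0 < L -> ccc L f -> 0 <= M ->
  (forall x, normc (f x) <= M * \prod_j (1 + x ord0 j ^+ 2)^-1) ->
  normc (integral_complex f) <= 2 * (M * pi ^+ d).
Proof.
move=> L0 [f1 f2] M0 H; apply: le_trans (normc_le _) _.
rewrite mulrDl !mul1r lerD//=.
  by apply: (int_cauchy L0 f1 M0) => x; apply: le_trans (H x); exact: normc_Re.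
by apply: (int_cauchy L0 f2 M0) => x; apply: le_trans (H x); exact: normc_Im.
Qed.

Lemma ic_partial L f j : 0 < L -> smooth f -> ccc L f ->
  integral_complex (partial j f) = 0.
Proof.
move=> L0 Sf [f1 f2]; have [D1 D2] : (forall x, derivable (fun y => complex.Re (f y)) x (delta_mx ord0 j))
   /\ (forall x, derivable (fun y => complex.Im (f y)) x (delta_mx ord0 j)).
  by split=> x; have [] := smooth_derivable Sf x (ex_intro _ j erefl).
have [C1 C2] := smooth_continuous (smooth_partial j Sf).
apply: complex_ext => /=.
  exact: (int_partial L0 f1 D1 C1).
exact: (int_partial L0 f2 D2 C2).
Qed.

(** The quantitative form of [test_function]: the constants in the estimates below depend on the box
    and not on the function. *)
Definition tbox L phi := smooth phi /\ forall x, L < `|x| -> phi x = 0.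

Lemma tbox_ccc L phi : tbox L phi -> ccc L phi.
Proof. by move=> [Sp pL]; apply/cccP; split=> //; exact: smooth_cont. Qed.

Lemma partial_near0 f j x : (\forall y \near x, f y = 0) -> partial j f x = 0.
Proof.
move=> nx; apply: complex_ext; rewrite /= /partial_real;
  rewrite (@near_eq_derive _ _ _ _ (cst 0)) ?derive_cst//; by apply: filterS nx => y ->.
Qed.

Lemma partial_boxed L phi j : (forall x, L < `|x| -> phi x = 0) ->
  forall x, L < `|x| -> partial j phi x = 0.
Proof.
move=> pL x Lx; apply: partial_near0.
have : \forall y \near x, L < `|y|.
  have := cvgr_gt _ (@norm_continuous _ _ x) _ Lx; exact.
by apply: filterS => y; exact: pL.
Qed.

Lemma tbox_partial L phi j : tbox L phi -> tbox L (partial j phi).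
Proof. by move=> [Sp pL]; split; [exact: smooth_partial|exact: partial_boxed]. Qed.

Lemma tboxMr L phi g : tbox L phi -> smooth g -> tbox L (fun x => phi x * g x).
Proof.
by move=> [Sp pL] Sg; split; [exact: smoothM|move=> x Lx; rewrite pL// mul0r].
Qed.

Lemma tboxMl L phi g : tbox L phi -> smooth g -> tbox L (fun x => g x * phi x).
Proof. by move=> tp Sg; under eq_fun do rewrite mulrC; exact: tboxMr. Qed.

Lemma test_functionP phi : test_function phi <-> exists2 L, 0 < L & tbox L phi.
Proof.
split=> [[Sp cp]|[L L0 [Sp pL]]].
  have [M [Mr HM]] := compact_bounded cp.
  exists (`|M| + 1); first by rewrite ltr_wpDl.
  split=> // x Mx; apply/eqP; apply: contraTT Mx => px; rewrite -leNgt.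
  apply: (HM (`|M| + 1)); first by rewrite (le_lt_trans (ler_norm _))// ltrDl.
  exact: subset_closure.
split=> //; apply: subclosed_compact (@box_compact R d L) _; first exact: closed_closure.
have cl : closed [set y : 'rV[R]_d | `|y| <= L].
  rewrite (_ : mkset _ = (fun y : 'rV[R]_d => `|y|) @^-1` [set x | x <= L])//.
  by apply: preimage_closed; [move=> x _; exact: norm_continuous|exact: closed_le].
rewrite ((closure_id _).1 cl); apply: closureS => x /=; apply: contra_neqT.
by rewrite -ltNge => /pL.
Qed.

End ComplexIntegral.

(** * Smoothness and decay of transforms *)

Section FourierTransform.
Context {R : realType} {d : nat}.
Implicit Types (phi f g : 'rV[R]_d -> R[i]) (L M : R).

Definition Ftr phi : 'rV[R]_d -> R[i] :=
  fun l => integral_complex (fun x => phi x * ech (- l) x).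

Definition fourier_cst : R[i] := real_complex R ((2 * pi) `^ (- (d%:R / 2))).

Lemma fourierE phi : fourier phi = fun l => fourier_cst * Ftr phi l.
Proof.
apply/funext => l; rewrite /fourier /Ftr; congr (_ * integral_complex _).
by apply/funext => x; rewrite /ech /expi edotNl cosN sinN.
Qed.

Lemma fourier_cst_neq0 : fourier_cst != 0.
Proof.
rewrite /fourier_cst fmorph_eq0 gt_eqF// powR_gt0// mulr_gt0//.
exact: pi_gt0.
Qed.

Lemma cont_ech a : cont (@ech R d a).
Proof. exact/smooth_cont/smooth_ech. Qed.

Lemma ccc_ech L phi l : ccc L phi -> ccc L (fun x => phi x * ech l x).
Proof. by move=> pL; apply: cccMr => //; exact: cont_ech. Qed.

Lemma FtrZ L c phi : 0 < L -> ccc L phi -> Ftr (fun x => c * phi x) = fun l => c * Ftr phi l.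
Proof.
move=> L0 pL; apply/funext => l; rewrite /Ftr -(icZ c L0 (ccc_ech _ pL)).
by congr integral_complex; apply/funext => x; rewrite mulrA.
Qed.

Lemma FtrD L f g : 0 < L -> ccc L f -> ccc L g ->
  Ftr (fun x => f x + g x) = fun l => Ftr f l + Ftr g l.
Proof.
move=> L0 fL gL; apply/funext => l; rewrite /Ftr -(icD L0 (ccc_ech _ fL) (ccc_ech _ gL)).
by congr integral_complex; apply/funext => x; rewrite mulrDl.
Qed.

Lemma cont_Re_kernel L phi : ccc L phi ->
  continuous (fun p : 'rV[R]_d * 'rV[R]_d => complex.Re (phi p.2 * ech (- p.1) p.2)).
Proof.
move=> [[c1 _] [c2 _]].
have ce : continuous (fun p : 'rV[R]_d * 'rV[R]_d => edot (- p.1) p.2).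
  by under eq_fun do rewrite edotNl; apply: contN; exact: cont_edot2.
have cs (h : R -> R) : continuous h ->
    continuous (fun p : 'rV[R]_d * 'rV[R]_d => h (edot (- p.1) p.2)).
  by move=> ch p; exact: (continuous_comp (ce p) (ch _)).
have csnd (h : 'rV[R]_d -> R) : continuous h -> continuous (fun p : 'rV[R]_d * 'rV[R]_d => h p.2).
  move=> ch p; exact: (@continuous_comp _ _ _ snd h p cvg_snd (ch _)).
have H := contD (contM (csnd _ c1) (cs _ (@continuous_cos R)))
  (contN (contM (csnd _ c2) (cs _ (@continuous_sin R)))).
by under eq_fun do rewrite ReM /=.
Qed.

(** Multiplication by - i x_j, the counterpart of [partial j] on the other side of the transform. *)
Definition mulx (j : 'I_d) phi := fun x : 'rV[R]_d => Complex 0 (- x ord0 j) * phi x.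

Lemma smooth_mulI j : smooth (fun x : 'rV[R]_d => Complex 0 (- x ord0 j)).
Proof.
apply: smoothP => /=; first exact: SmCst.
rewrite (_ : (fun x => _) = cst (-1) * (fun x : 'rV[R]_d => x ord0 j)).
  by apply: SmMul; [exact: SmCst|exact: smooth_expr_coord].
by apply/funext => x; rewrite -[LHS]mulN1r.
Qed.

Lemma ccc_mulx L j phi : ccc L phi -> ccc L (mulx j phi).
Proof. by move=> pL; apply: cccMl => //; exact/smooth_cont/smooth_mulI. Qed.

Lemma tbox_mulx L j phi : tbox L phi -> tbox L (mulx j phi).
Proof. by move=> pL; apply: tboxMl => //; exact: smooth_mulI. Qed.

Lemma is_derive_Re_Ftr L j phi l : 0 < L -> ccc L phi ->
  is_derive l (delta_mx ord0 j : 'rV[R]_d) (fun l => complex.Re (Ftr phi l))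
    (complex.Re (Ftr (mulx j phi) l)).
Proof.
move=> L0 pL.
pose A (t : R) x := complex.Re (phi x * ech (- (t *: (delta_mx ord0 j : 'rV[R]_d) + l)) x).
pose B (t : R) x := complex.Re (mulx j phi x * ech (- (t *: (delta_mx ord0 j : 'rV[R]_d) + l)) x).
have dA x (t : R) : is_derive t 1 (fun t => A t x) (B t x).
  pose u (t : R) := - (t * x ord0 j) - edot l x.
  have du : is_derive t 1 u (- x ord0 j).
    apply/is_derive_eps => e e0; exists 1 => // s _; rewrite [s *: 1]mulr1 /u.
    rewrite [X in `|X|](_ : _ = 0) ?normr0 ?mulr_ge0 ?(ltW e0)//; ring.
  have Eu s : edot (- (s *: (delta_mx ord0 j : 'rV[R]_d) + l)) x = u s.
    by rewrite edotNl edotDl edotZl edot_delta opprD.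
  have dc := @is_deriveZ R R R _ (complex.Re (phi x)) t 1 _ (is_derive1_comp (is_derive_cos (u t)) du).
  have ds := @is_deriveZ R R R _ (- complex.Im (phi x)) t 1 _ (is_derive1_comp (is_derive_sin (u t)) du).
  have := is_deriveD dc ds.
  rewrite (_ : _ + _ = fun t => A t x); last first.
    by apply/funext => s; rewrite /A ReM /= Eu -mulNr.
  rewrite (_ : _ + _ = B t x)// /B /mulx ReM ReM ImM /= Eu.
  by rewrite /GRing.scale /=; ring.
have cB : continuous (fun p : R * 'rV[R]_d => B p.1 p.2).
  have : continuous ((fun p : 'rV[R]_d * 'rV[R]_d => complex.Re (mulx j phi p.2 * ech (- p.1) p.2)) \o
     (fun p : R * 'rV[R]_d => (p.1 *: (delta_mx ord0 j : 'rV[R]_d) + l, p.2))).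
    move=> p; apply: continuous_comp; last exact: (cont_Re_kernel (ccc_mulx j pL)).
    apply: pair_continuous => q; last exact: cvg_snd.
    apply: (@continuous_comp _ _ _ fst (fun t : R => t *: (delta_mx ord0 j : 'rV[R]_d) + l)).
      exact: cvg_fst.
    apply/cvg_eps => e e0; exists e => // y yq.
    rewrite opprD addrACA subrr addr0 -scalerBl normrZ -[leRHS]mulr1.
    apply: ler_pM => //; first exact: ltW.
    by apply: norm_rV_le => // k; rewrite mxE; case: (_ && _); rewrite ?normr1 ?normr0.
  exact.
have AL t : cc L (A t) by have [] := ccc_ech (- (t *: (delta_mx ord0 j : 'rV[R]_d) + l)) pL.
have /is_derive_eps H := int_derive L0 AL dA cB 0.
apply/is_derive_eps => e e0; have [D D0 HD] := H _ e0; exists D => // s sD.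
by have := HD s sD; rewrite /A /B [s *: 1]mulr1 addr0 scale0r add0r.
Qed.

(** As Im z = Re (- i z), differentiability has to be examined for real parts only. *)
Lemma Im_Ftr L phi : 0 < L -> ccc L phi ->
  (fun l => complex.Im (Ftr phi l)) = fun l => complex.Re (Ftr (fun x => Complex 0 (-1) * phi x) l).
Proof.
move=> L0 pL; apply/funext => l; rewrite (FtrZ _ L0 pL) ReM /=; ring.
Qed.

Lemma mulxZ j c phi : mulx j (fun x => c * phi x) = fun x => c * mulx j phi x.
Proof. by apply/funext => x; rewrite /mulx mulrCA. Qed.

Lemma is_derive_Im_Ftr L j phi l : 0 < L -> ccc L phi ->
  is_derive l (delta_mx ord0 j : 'rV[R]_d) (fun l => complex.Im (Ftr phi l))
    (complex.Im (Ftr (mulx j phi) l)).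
Proof.
move=> L0 pL; rewrite (Im_Ftr L0 pL).
have -> : complex.Im (Ftr (mulx j phi) l) = complex.Re (Ftr (mulx j (fun x => Complex 0 (-1) * phi x)) l).
  by have := congr1 (fun h => h l) (Im_Ftr L0 (ccc_mulx j pL)); rewrite mulxZ.
by apply: is_derive_Re_Ftr L0 _; exact: cccZ.
Qed.

(** For classes whose members have all their partial derivatives in the class again, such as real
    parts of transforms, this avoids any description of higher derivatives. *)
Lemma smooth_real_coind (H : ('rV[R]_d -> R) -> Prop) (g : 'rV[R]_d -> R) :
  (forall h : 'rV[R]_d -> R, H h -> continuous h /\ (forall j x, derivable h x (delta_mx ord0 j)) /\
     forall j, H (partial_real j h)) -> H g -> smooth_real g.
Proof.
move=> HH Hg s; suff Hs : H (foldr partial_real g s) by have [? []] := HH _ Hs.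
by elim: s => //= j s IH; have [_ []] := HH _ IH.
Qed.

Lemma smooth_Ftr L phi : 0 < L -> ccc L phi -> smooth (Ftr phi).
Proof.
move=> L0 pL.
have HRe f : ccc L f -> smooth_real (fun l => complex.Re (Ftr f l)).
  move=> fL; refine (@smooth_real_coind (fun g : 'rV[R]_d -> R =>
    exists2 f, ccc L f & g = fun l => complex.Re (Ftr f l)) _ _ _); last by exists f.
  move=> _ [h hL ->]; split; last split.
  - apply: (int_param_continuous L0 (cont_Re_kernel hL)) => z x Lx.
    by have /cccP[_ ->] := hL; rewrite // mul0r.
  - by move=> j x; have [] := is_derive_Re_Ftr j x L0 hL.
  - move=> j; exists (mulx j h); first exact: ccc_mulx.
    by apply/funext => l; have [_] := is_derive_Re_Ftr j l L0 hL.
split; first exact: HRe.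
by rewrite (Im_Ftr L0 pL); apply: HRe; exact: cccZ.
Qed.

Lemma partial_Ftr L j phi : 0 < L -> ccc L phi -> partial j (Ftr phi) = Ftr (mulx j phi).
Proof.
move=> L0 pL; apply/funext => l; apply: complex_ext => /=.
  by have [_] := is_derive_Re_Ftr j l L0 pL.
by have [_] := is_derive_Im_Ftr j l L0 pL.
Qed.

Lemma foldr_partial_Ftr L s phi : 0 < L -> ccc L phi ->
  foldr partial (Ftr phi) s = Ftr (foldr mulx phi s).
Proof.
move=> L0 pL; elim: s => //= j s ->; apply: partial_Ftr L0 _.
by elim: s => //= k s IH; exact: ccc_mulx.
Qed.

(** The integral of the j-th derivative of phi times the exponential is 0. *)
Lemma coord_Ftr L j phi (l : 'rV[R]_d) : 0 < L -> tbox L phi ->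
  Complex 0 (l ord0 j) * Ftr phi l = Ftr (partial j phi) l.
Proof.
move=> L0 pL; have Sp := pL.1; have Se := @smooth_ech R d (- l).
have := ic_partial j L0 (smoothM Sp Se) (tbox_ccc (tboxMr pL Se)).
rewrite (partialM j Sp Se) partial_ech.
have c1 := tbox_ccc (tboxMr (tbox_partial j pL) Se).
have c2 : ccc L (fun x => phi x * (Complex 0 ((- l) ord0 j) * ech (- l) x)).
  by apply: cccMr; [exact: tbox_ccc|exact/smooth_cont/smoothZ].
rewrite (icD L0 c1 c2) => /eqP; rewrite addr_eq0 => /eqP E; rewrite [RHS]/Ftr E.
rewrite (_ : (fun x => phi x * _) = fun x => Complex 0 ((- l) ord0 j) * (phi x * ech (- l) x)); last first.
  by apply/funext => x; rewrite mulrCA.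
rewrite (icZ _ L0 (ccc_ech _ (tbox_ccc pL))) -mulNr; congr (_ * _).
by apply: complex_ext; rewrite /= ?oppr0// mxE opprK.
Qed.

Lemma Ftr_bound L M phi l : 0 < L -> ccc L phi -> 0 <= M -> (forall x, normc (phi x) <= M) ->
  normc (Ftr phi l) <= 2 * (M * (2 * L) ^+ d).
Proof.
move=> L0 pL M0 H; apply: ic_bound L0 (ccc_ech _ pL) M0 _ => x.
by rewrite normcM normc_ech mulr1.
Qed.

(* Only pure derivatives enter, so that no symmetry of mixed partial
   derivatives is needed to compare with [Ck_norm]. *)
Definition pbnd (k : nat) phi M := (forall x, normc (phi x) <= M) /\
  forall (j : 'I_d) i x, (i <= k)%N -> normc (iter i (partial j) phi x) <= M.

(** The coordinate is a linear function, so at most one derivative falls on it. For i = 0 the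
    default value [i.-1 = 0] is cancelled by the factor [i%:R]. *)
Lemma iter_partial_mulx j l i phi : smooth phi ->
  iter i (partial j) (mulx l phi) = fun x => mulx l (iter i (partial j) phi) x +
    (i%:R * (j == l)%:R) * Complex 0 (-1) * iter i.-1 (partial j) phi x.
Proof.
move=> Sp; have Sit n : smooth (iter n (partial j) phi).
  by elim: n => [|n IH]; [exact: Sp|exact: smooth_partial].
have Smx g : smooth g -> smooth (mulx l g).
  by move=> Sg; exact: (smoothM (smooth_mulI l) Sg).
have pmx g : smooth g -> partial j (mulx l g) =
    fun x => mulx l (partial j g) x + (j == l)%:R * Complex 0 (-1) * g x.
  move=> Sg; rewrite (partialM j (smooth_mulI l) Sg); apply/funext => x.
  rewrite addrC; congr (_ + _ * _).
  rewrite (_ : (fun x => _) = fun x : 'rV[R]_d => Complex 0 (-1) * (x ord0 l)%:C%C); last first.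
    by apply/funext => y; apply: complex_ext; rewrite ?ReM ?ImM /=; ring.
  rewrite (partialZ _ j (smooth_coord l)) partial_coord mulrC; congr (_ * _).
  by rewrite rmorph_nat.
elim: i => [|i IH].
  by apply/funext => x /=; rewrite !mul0r addr0.
rewrite /= IH (partialD j (Smx _ (Sit i)) (smoothZ _ (Sit i.-1))) (pmx _ (Sit i)).
rewrite (partialZ _ j (Sit i.-1)); apply/funext => x; rewrite -addrA; congr (_ + _).
case: i {IH} => [|i] /=; first by rewrite !mul0r addr0 mul1r.
by rewrite -[i.+2%:R]natr1; ring.
Qed.

(** [L] bounds the coordinate on the box and [k] the Leibniz coefficient. The summand 1 keeps the
    constant at least 1, so that its powers increase when the lemma is iterated. *)
Lemma pbnd_mulx L k l phi M : tbox L phi -> 0 < L -> pbnd k phi M ->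
  pbnd k (mulx l phi) ((L + k%:R + 1) * M).
Proof.
move=> [Sp pL] L0 [b0 b1].
have M0 : 0 <= M := le_trans (normc_ge0 _) (b0 0).
have bx g : (forall x, normc (g x) <= M) -> (forall x, L < `|x| -> g x = 0) ->
    forall x, normc (mulx l g x) <= L * M.
  move=> gM gL x; rewrite normcM.
  have [xL|Lx] := leP `|x| L; last by rewrite gL// normc0 mulr0 mulr_ge0// ltW.
  apply: ler_pM; rewrite ?normc_ge0//.
  rewrite /= expr0n add0r sqrtr_sqr normrN.
  by apply: le_trans xL; exact: coord_le_norm.
split.
  move=> x; apply: le_trans (bx _ b0 pL x) _.
  by rewrite ler_wpM2r// -addrA lerDl addr_ge0.
move=> j i x ik; rewrite iter_partial_mulx//; apply: le_trans (normcD _ _) _.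
rewrite !mulrDl -addrA; apply: lerD.
  have ti n : tbox L (iter n (partial j) phi).
    by elim: n => [|n IH]; [split|exact: tbox_partial].
  by apply: bx => [y|]; [exact: b1|exact: (ti i).2].
apply: ler_wpDr; first by rewrite mul1r.
rewrite !normcM !normc_nat; have -> : normc (Complex 0 (-1 : R)) = 1.
  by rewrite /= expr0n add0r sqrtr_sqr normrN1.
rewrite mulr1 -[leRHS]mulr1 -[leRHS]mulrA [M * 1]mulrC mulrA.
apply: ler_pM; rewrite ?mulr_ge0 ?normc_ge0//.
  by apply: ler_pM => //; rewrite ?ler_nat// lern1 leq_b1.
by apply: b1; exact: leq_trans (leq_pred _) ik.
Qed.

(** A Schwartz seminorm in the sup norm over lists of directions, stated as a bound, so that no
    supremum has to be shown finite. *)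
Definition sbnd (k : nat) g M := forall s x, (size s <= k)%N ->
  (1 + `|x|) ^+ k * normc (foldr partial g s x) <= M.

Lemma iter_coord_Ftr L j i phi (l : 'rV[R]_d) : 0 < L -> tbox L phi ->
  Complex 0 (l ord0 j) ^+ i * Ftr phi l = Ftr (iter i (partial j) phi) l /\
  tbox L (iter i (partial j) phi).
Proof.
move=> L0 pL; elim: i => [|i [IH1 IH2]]; first by rewrite mul1r.
by split; [rewrite exprS -mulrA IH1 (coord_Ftr _ _ L0 IH2)|exact: tbox_partial].
Qed.

(** For |l| > 1 some coordinate has |l_j| = |l| in the sup norm, and k derivatives in that single
    direction produce the factor |l|^k. The factor 2^k comes from 1 + |l| <= 2 max (1, |l|). *)
Lemma Ftr_decay L k phi M (l : 'rV[R]_d) : 0 < L -> tbox L phi -> pbnd k phi M ->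
  (1 + `|l|) ^+ k * normc (Ftr phi l) <= 2 ^+ k * (2 * (M * (2 * L) ^+ d)).
Proof.
move=> L0 pL [b0 b1]; have M0 : 0 <= M := le_trans (normc_ge0 _) (b0 0).
have [l1|l1] := leP `|l| 1.
  apply: ler_pM; rewrite ?exprn_ge0 ?addr_ge0 ?normc_ge0//.
    by apply: lerXn2r; rewrite ?nnegrE ?addr_ge0// lerD2l.
  exact: (Ftr_bound l L0 (tbox_ccc pL) M0 b0).
have [|[i j] /= lj] := @mx_norm_neq0 _ _ _ l; first by rewrite gt_eqF// (lt_trans _ l1).
rewrite (ord1 i) in lj; have {}lj : `|l| = `|l ord0 j| := lj.
have [E tb] := iter_coord_Ftr j k l L0 pL.
have := Ftr_bound l L0 (tbox_ccc tb) M0 (fun x => b1 j k x (leqnn _)).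
rewrite -E normcM normcX /= expr0n add0r sqrtr_sqr -lj => H.
apply: le_trans (_ : (2 * `|l|) ^+ k * normc (Ftr phi l) <= _).
  rewrite ler_wpM2r ?normc_ge0//; apply: lerXn2r; rewrite ?nnegrE ?addr_ge0 ?mulr_ge0//.
  by rewrite mulrDl mul1r lerD2r ltW.
by rewrite exprMn -mulrA ler_wpM2l// exprn_ge0.
Qed.

Lemma sbnd_Ftr k L : 0 < L -> exists2 C, 0 <= C & forall phi M, tbox L phi ->
  pbnd k phi M -> sbnd k (Ftr phi) (C * M).
Proof.
move=> L0; pose K := L + k%:R + 1.
have K1 : 1 <= K by rewrite /K lerDr addr_ge0// ltW.
have K0 : 0 <= K := le_trans ler01 K1.
exists (2 ^+ k * (2 * (2 * L) ^+ d) * K ^+ k).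
  by rewrite !mulr_ge0 ?exprn_ge0// mulr_ge0// ltW.
move=> phi M pL pb s x sk; rewrite (foldr_partial_Ftr s L0 (tbox_ccc pL)).
have M0 : 0 <= M := le_trans (normc_ge0 _) (pb.1 0).
have [ts ps] : tbox L (foldr mulx phi s) /\ pbnd k (foldr mulx phi s) (K ^+ size s * M).
  elim: s {sk} => [|j s [IH1 IH2]]; first by rewrite mul1r.
  split; first exact: tbox_mulx.
  by rewrite [foldr _ _ _]/= exprS -mulrA; exact: pbnd_mulx IH1 L0 IH2.
apply: le_trans (Ftr_decay x L0 ts ps) _.
rewrite -!mulrA ler_wpM2l ?exprn_ge0// ler_wpM2l//.
rewrite [leRHS](_ : _ = K ^+ k * (M * (2 * L) ^+ d)); last by ring.
by rewrite ler_wpM2r ?ler_weXn2l// mulr_ge0// exprn_ge0// mulr_ge0// ltW.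
Qed.

End FourierTransform.

(** * Tempered distributions and their order *)

Section StrongSchwartz.
Context {R : realType} {d : nat}.
Implicit Types (phi psi f g : 'rV[R]_d -> R[i]) (L M C : R).
Implicit Types (T : ('rV[R]_d -> R[i]) -> R[i]).

Lemma norm_le_enorm (x : 'rV[R]_d) : `|x| <= enorm x.
Proof.
apply: norm_rV_le; first exact: sqrtr_ge0.
move=> j; rewrite -sqrtr_sqr ler_wsqrtr// (bigD1 j)//= lerDl.
by apply: sumr_ge0 => k _; exact: sqr_ge0.
Qed.

Lemma enorm_le_norm (x : 'rV[R]_d) : enorm x <= d%:R * `|x|.
Proof.
rewrite -[leRHS]ger0_norm ?mulr_ge0// -sqrtr_sqr ler_wsqrtr//.
apply: le_trans (_ : \sum_(j < d) `|x| ^+ 2 <= _).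
  apply: ler_sum => j _; rewrite -real_normK ?num_real//.
  by apply: lerXn2r; rewrite ?nnegrE//; exact: coord_le_norm.
rewrite sumr_const card_ord -[leLHS]mulr_natl exprMn ler_wpM2r ?sqr_ge0//.
by rewrite -natrX ler_nat; case: (d) => // n; rewrite leq_pmulr.
Qed.

Lemma enorm1_le (x : 'rV[R]_d) k : (1 + enorm x) ^+ k <= (1 + d%:R) ^+ k * (1 + `|x|) ^+ k.
Proof.
rewrite -exprMn; apply: lerXn2r; rewrite ?nnegrE ?mulr_ge0 ?addr_ge0 ?sqrtr_ge0//.
rewrite mulrDl mul1r mulrDr mulr1 -addrA lerD2l.
apply: le_trans (enorm_le_norm x) _.
by rewrite addrA lerDr addr_ge0.
Qed.

(** There are finitely many lists of length at most [k], so separate bounds add up to a common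
    one. *)
Lemma list_bound (Q : seq 'I_d -> R -> Prop) :
  (forall s M M', M <= M' -> Q s M -> Q s M') -> (forall s, exists M, Q s M) ->
  forall k, exists2 M, 0 <= M & forall s, (size s <= k)%N -> Q s M.
Proof.
move=> mono ex k; elim: k Q mono ex => [|k IH] Q mono ex.
  have [M QM] := ex [::]; exists `|M| => // -[|//] _.
  exact: mono (ler_norm _) QM.
have [M0 Q0] := ex [::].
have /choice[F HF] (j : 'I_d) : exists M, 0 <= M /\ forall s, (size s <= k)%N -> Q (j :: s) M.
  by have [||M M0' H] := IH (fun s => Q (j :: s)) => [s M M'|s|]; [exact: mono|exact: ex|exists M].
exists (`|M0| + \sum_j F j).
  by rewrite addr_ge0// sumr_ge0// => j _; have [] := HF j.
move=> [_|j s sk].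
  apply: mono Q0; apply: le_trans (ler_norm _) _; rewrite lerDl sumr_ge0// => j _.
  by have [] := HF j.
have [_ H] := HF j; apply: mono (H s sk).
apply: ler_wpDl => //; rewrite (bigD1 j)//= lerDl sumr_ge0// => i _.
by have [] := HF i.
Qed.

(* Iterated derivatives are indexed by arbitrary sequences of directions, which
   avoids the symmetry of second derivatives. *)
Definition sschwartz g := smooth g /\ forall k, exists M, sbnd k g M.

Definition lbnd (k : nat) g M := forall s x, (size s <= k)%N ->
  normc (foldr partial g s x) <= M.

Lemma sschwartzP g : smooth g -> (forall s k, exists M, forall x,
  (1 + `|x|) ^+ k * normc (foldr partial g s x) <= M) -> sschwartz g.
Proof.
move=> Sg H; split=> // k.
have [||M _ HM] := @list_bound (fun s M => forall x,
    (1 + `|x|) ^+ k * normc (foldr partial g s x) <= M) _ _ k.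
- by move=> s M M' MM' HM x; apply: le_trans MM'.
- by move=> s; exact: H.
- by exists M => s x sk; exact: HM.
Qed.

Lemma sschwartz_bound g s k : sschwartz g -> exists2 M, 0 <= M & forall x,
  (1 + `|x|) ^+ k * normc (foldr partial g s x) <= M.
Proof.
move=> [_ /(_ (maxn k (size s)))[M HM]]; exists M => [|x].
  apply: le_trans (HM s 0 (leq_maxr _ _)).
  by rewrite mulr_ge0 ?normc_ge0// exprn_ge0// addr_ge0.
apply: le_trans (HM s x (leq_maxr _ _)); rewrite ler_wpM2r ?normc_ge0//.
by rewrite ler_weXn2l ?leq_maxl// lerDl.
Qed.

Lemma sschwartz_schwartz g : sschwartz g -> schwartz g.
Proof.
move=> Sg; split=> [|k m]; first by case: Sg.
rewrite mpartialE; set s := mseq _.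
have [M M0 HM] := sschwartz_bound s k Sg.
exists ((1 + d%:R) ^+ k * M) => x.
apply: le_trans (_ : (1 + d%:R) ^+ k * ((1 + `|x|) ^+ k * normc (foldr partial g s x)) <= _).
  by rewrite mulrA ler_wpM2r ?normc_ge0// enorm1_le.
by rewrite ler_wpM2l// exprn_ge0// addr_ge0.
Qed.

Lemma foldr_partialZ c g s : smooth g ->
  foldr partial (fun x => c * g x) s = fun x => c * foldr partial g s x.
Proof. by move=> Sg; elim: s => //= j s ->; rewrite (partialZ c j (smooth_foldr s Sg)). Qed.

Lemma sbndZ k c g M : smooth g -> sbnd k g M -> sbnd k (fun x => c * g x) (normc c * M).
Proof.
move=> Sg H s x sk; rewrite foldr_partialZ// normcM mulrCA.
by rewrite ler_wpM2l ?normc_ge0//; exact: H.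
Qed.

Lemma sschwartzZ c g : sschwartz g -> sschwartz (fun x => c * g x).
Proof.
move=> [Sg H]; split; first exact: smoothZ.
by move=> k; have [M HM] := H k; exists (normc c * M); exact: sbndZ.
Qed.

Lemma sschwartz_partial j g : sschwartz g -> sschwartz (partial j g).
Proof.
move=> Sg; apply: sschwartzP; first by apply: smooth_partial; case: Sg.
move=> s k; have [M _ HM] := sschwartz_bound (rcons s j) k Sg.
by exists M => x; have := HM x; rewrite foldr_rcons.
Qed.

Lemma tbox_foldr L s phi : tbox L phi -> tbox L (foldr partial phi s).
Proof. by move=> H; elim: s => [|j s IH]; [exact: H|exact: tbox_partial]. Qed.

Lemma ccc_bounded L phi : ccc L phi -> exists2 M, 0 <= M & forall x, normc (phi x) <= M.
Proof.
move=> /cccP[[c1 c2] pL].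
have B (g : 'rV[R]_d -> R) : continuous g -> exists M, forall x, `|x| <= L -> `|g x| <= M.
  move=> cg; have : compact (g @` [set y : 'rV[R]_d | `|y| <= L]).
    apply: continuous_compact; last exact: box_compact.
    exact: continuous_subspaceT.
  move=> /compact_bounded[M [_ HM]]; exists (M + 1) => x xL.
  by apply: (HM (M + 1)); [rewrite ltrDl|exists x].
have [M1 H1] := B _ c1; have [M2 H2] := B _ c2.
exists (`|M1| + `|M2|); first by rewrite addr_ge0.
move=> x; have [xL|Lx] := leP `|x| L; last by rewrite pL// normc0 addr_ge0.
apply: le_trans (normc_le _) _; apply: lerD.
  exact: le_trans (H1 x xL) (ler_norm _).
exact: le_trans (H2 x xL) (ler_norm _).
Qed.

Lemma tbox_bounded L phi : tbox L phi -> exists2 M, 0 <= M & forall x, normc (phi x) <= M.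
Proof. by move/tbox_ccc/ccc_bounded. Qed.

Lemma tbox_lbnd L phi k : tbox L phi -> exists2 M, 0 <= M & lbnd k phi M.
Proof.
move=> tp; have [||M M0 HM] := @list_bound (fun s M => forall x,
    normc (foldr partial phi s x) <= M) _ _ k.
- by move=> s M M' MM' HM x; apply: le_trans MM'.
- by move=> s; have [M _ HM] := tbox_bounded (tbox_foldr s tp); exists M.
- by exists M => // s x sk; exact: HM.
Qed.

Lemma lbnd_sbnd L phi k M : 0 < L -> tbox L phi -> lbnd k phi M ->
  sbnd k phi ((1 + L) ^+ k * M).
Proof.
move=> L0 tp H s x sk; have M0 : 0 <= M := le_trans (normc_ge0 _) (H [::] 0 isT).
have [xL|Lx] := leP `|x| L; last first.
  rewrite (tbox_foldr s tp).2// normc0 mulr0 mulr_ge0// exprn_ge0// addr_ge0// (ltW L0)//.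
apply: ler_pM; rewrite ?normc_ge0 ?exprn_ge0 ?addr_ge0//; last exact: H.
by apply: lerXn2r; rewrite ?nnegrE ?addr_ge0 ?(ltW L0)// lerD2l.
Qed.

Lemma tbox_sschwartz L phi : 0 < L -> tbox L phi -> sschwartz phi.
Proof.
move=> L0 tp; split; first by case: tp.
move=> k; have [M _ HM] := tbox_lbnd k tp.
by exists ((1 + L) ^+ k * M); exact: lbnd_sbnd.
Qed.

Lemma lbnd_pbnd k phi M : lbnd k phi M -> pbnd k phi M.
Proof.
move=> H; split=> [x|j i x ik]; first exact: (H [::] x).
rewrite (_ : iter i (partial j) phi = foldr partial phi (nseq i j)).
  by apply: H; rewrite size_nseq.
by elim: i {ik} => //= i ->.
Qed.

Lemma sschwartz_Ftr L phi : 0 < L -> tbox L phi -> sschwartz (Ftr phi).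
Proof.
move=> L0 tp; split; first exact: smooth_Ftr L0 (tbox_ccc tp).
move=> k; have [C C0 HC] := @sbnd_Ftr R d k L L0; have [M _ HM] := tbox_lbnd k tp.
by exists (C * M); apply: HC => //; exact: lbnd_pbnd.
Qed.

(** Weaker than [tempered_distribution], as [sschwartz] functions are [schwartz]. It is enough,
    because [T] is evaluated only at test functions, their transforms and functions built from
    these, for which bounds over all lists are available. *)
Definition strong_tempered T :=
  (forall (a : R[i]) phi psi, sschwartz phi -> sschwartz psi ->
     T (fun x => a * phi x + psi x) = a * T phi + T psi) /\
  (exists k C, 0 <= C /\ forall phi M, sschwartz phi -> sbnd k phi M ->
     normc (T phi) <= C * M).

Lemma tempered_strong T : tempered_distribution T -> strong_tempered T.
Proof.
move=> [lin [k [C HC]]]; split.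
  by move=> a phi psi Sp Sq; apply: lin; exact: sschwartz_schwartz.
exists k, (`|C| * (1 + d%:R) ^+ k); split.
  by rewrite mulr_ge0// exprn_ge0// addr_ge0.
move=> phi M Sp HM; apply: le_trans (HC _ (sschwartz_schwartz Sp)) _.
have M0 : 0 <= M.
  apply: le_trans (HM [::] 0 isT).
  by rewrite mulr_ge0 ?normc_ge0// exprn_ge0// addr_ge0.
(* [C] may be negative, so it is replaced by its absolute value; this takes the lower bound 0, and
   for that the supremum must be over a set known to be bounded. *)
have nM : 0 <= schwartz_norm k phi <= (1 + d%:R) ^+ k * M.
  have ub : ubound [set r | exists (m : mpoly.multinom d) (x : 'rV[R]_d),
      (mpoly.mdeg m <= k)%N /\ r = (1 + enorm x) ^+ k * normc (mpartial m phi x)]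
      ((1 + d%:R) ^+ k * M).
    move=> _ [m [x [mk ->]]]; rewrite mpartialE; set s := mseq _.
    apply: le_trans (_ : (1 + d%:R) ^+ k * ((1 + `|x|) ^+ k * normc (foldr partial phi s x)) <= _).
      by rewrite mulrA ler_wpM2r ?normc_ge0// enorm1_le.
    rewrite ler_wpM2l ?exprn_ge0 ?addr_ge0//; apply: HM.
    by rewrite size_mseq.
  have mem : [set r | exists (m : mpoly.multinom d) (x : 'rV[R]_d),
      (mpoly.mdeg m <= k)%N /\ r = (1 + enorm x) ^+ k * normc (mpartial m phi x)]
      ((1 + enorm (0 : 'rV[R]_d)) ^+ k * normc (mpartial (mpoly.mnm0 (n := d)) phi 0)).
    by exists (mpoly.mnm0 (n := d)), 0; rewrite mpoly.mdeg0.
  apply/andP; split; last by apply: ge_sup => //; eexists; exact: mem.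
  apply: le_trans (_ : (1 + enorm (0 : 'rV[R]_d)) ^+ k * normc (mpartial (mpoly.mnm0 (n := d)) phi 0) <= _).
    by rewrite mulr_ge0 ?normc_ge0// exprn_ge0// addr_ge0// sqrtr_ge0.
  by apply: ub_le_sup => //; exists ((1 + d%:R) ^+ k * M).
have /andP[n0 nM'] := nM.
apply: le_trans (_ : `|C| * schwartz_norm k phi <= _).
  by rewrite ler_wpM2r// ler_norm.
by rewrite -mulrA ler_wpM2l.
Qed.

Lemma strong_temperedZ T a phi : strong_tempered T -> sschwartz phi ->
  T (fun x => a * phi x) = a * T phi.
Proof.
move=> [lin _] Sp.
have S0 : sschwartz (fun=> 0 : R[i]).
  have := sschwartzZ 0 Sp; rewrite (_ : (fun x => _) = fun=> 0)//.
  by apply/funext => x; rewrite mul0r.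
have T0 : T (fun=> 0) = 0.
  have := lin (-1) _ _ Sp Sp; rewrite mulN1r addNr.
  rewrite (_ : (fun x => _) = fun=> 0)//.
  by apply/funext => x; rewrite mulN1r addNr.
have := lin a _ _ Sp S0; rewrite T0 addr0 => <-; congr T.
by apply/funext => x; rewrite addr0.
Qed.

Lemma strong_temperedD T phi psi : strong_tempered T -> sschwartz phi -> sschwartz psi ->
  T (fun x => phi x + psi x) = T phi + T psi.
Proof.
move=> [lin _] Sp Sq; have := lin 1 _ _ Sp Sq; rewrite mul1r => <-; congr T.
by apply/funext => x; rewrite mul1r.
Qed.

Section Order.
Variable T : ('rV[R]_d -> R[i]) -> R[i].
Hypothesis ST : strong_tempered T.

Let S := fourier_dist T.

Lemma fourier_distE L phi : 0 < L -> tbox L phi -> S phi = @fourier_cst R d * T (Ftr phi).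
Proof.
move=> L0 tp; rewrite /S /fourier_dist fourierE strong_temperedZ//.
exact: sschwartz_Ftr tp.
Qed.

Lemma tboxD L phi psi : tbox L phi -> tbox L psi -> tbox L (fun x => phi x + psi x).
Proof.
move=> [Sp pL] [Sq qL]; split; first exact: smoothD.
by move=> x Lx; rewrite pL// qL// addr0.
Qed.

Lemma tboxZ L c phi : tbox L phi -> tbox L (fun x => c * phi x).
Proof. by move=> H; apply: tboxMl => //; exact: smooth_cst. Qed.

Lemma fourier_distD L phi psi : 0 < L -> tbox L phi -> tbox L psi ->
  S (fun x => phi x + psi x) = S phi + S psi.
Proof.
move=> L0 tp tq; rewrite (fourier_distE L0 tp) (fourier_distE L0 tq).
rewrite (fourier_distE L0 (tboxD tp tq)) (FtrD L0 (tbox_ccc tp) (tbox_ccc tq)).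
by rewrite (strong_temperedD ST (sschwartz_Ftr L0 tp) (sschwartz_Ftr L0 tq)) mulrDr.
Qed.

Lemma fourier_distZ L c phi : 0 < L -> tbox L phi -> S (fun x => c * phi x) = c * S phi.
Proof.
move=> L0 tp; rewrite (fourier_distE L0 tp) (fourier_distE L0 (tboxZ c tp)).
rewrite (FtrZ c L0 (tbox_ccc tp)) strong_temperedZ//; first by rewrite mulrCA.
exact: sschwartz_Ftr tp.
Qed.

(** The index [k] precedes the box: it comes from the seminorm that controls [T], and only the
    constant depends on [L]. This is why [F T] has finite order. *)
Lemma fourier_dist_bound : exists k, forall L, 0 < L -> exists2 C, 0 <= C &
  forall phi M, tbox L phi -> pbnd k phi M -> normc (S phi) <= C * M.
Proof.
have [_ [k [C [C0 HC]]]] := ST; exists k => L L0.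
have [C1 C10 H1] := @sbnd_Ftr R d k L L0.
exists (normc (@fourier_cst R d) * (C * C1)); first by rewrite !mulr_ge0 ?normc_ge0.
move=> phi M tp pb; rewrite (fourier_distE L0 tp) normcM -!mulrA ler_wpM2l ?normc_ge0//.
by apply: HC; [exact: sschwartz_Ftr tp|exact: H1].
Qed.

(** The index of the previous bound is an admissible order, and the least one exists by
    well-ordering. *)
Lemma fourier_dist_has_order : exists N, has_order S N.
Proof.
have [k Hk] := fourier_dist_bound.
have Ok : exists n, `[< order_at_most S n >].
  exists k; apply/asboolP => K cK.
  have [B [_ HB]] := compact_bounded cK.
  have L0 : 0 < `|B| + 1 :> R by rewrite ltr_wpDl.
  have [C C0 HC] := Hk _ L0; exists C => phi tp pK.
  have tb : tbox (`|B| + 1) phi.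
    split; first by case: tp.
    move=> x Bx; apply/eqP; apply: contraTT Bx => px; rewrite -leNgt.
    apply: (HB (`|B| + 1)); first by rewrite (le_lt_trans (ler_norm _))// ltrDl.
    by apply: pK; exact: subset_closure.
  apply: (HC _ _ tb).
  have [M M0 HM] := tbox_lbnd k tb.
  have ub : has_ubound [set r | exists (m : mpoly.multinom d) (x : 'rV[R]_d),
      (mpoly.mdeg m <= k)%N /\ r = normc (mpartial m phi x)].
    exists M => _ [m [x [mk ->]]]; rewrite mpartialE; apply: HM.
    by rewrite size_mseq.
  split=> [x|j i x ik].
    apply: ub_le_sup => //; exists (mpoly.mnm0 (n := d)), x; rewrite mpoly.mdeg0.
    split=> //; rewrite mpartialE (_ : mseq _ = [::])//.
    by apply/eqP; rewrite -size_eq0 size_mseq mpoly.mdeg0.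
  (* [Ck_norm] ranges over multi-indices, and a pure derivative is one of these. *)
  apply: ub_le_sup => //; have [m mi E] := mpartial_pure j i phi.
  by exists m, x; rewrite mi E.
have [N /asboolP ON minN] := ex_minnP Ok; exists N; split=> // M OM.
by apply: minN; exact/asboolP.
Qed.

(** The comparison opposite to the one before: every multi-index is a list of directions, so a bound
    over lists dominates [Ck_norm]. *)
Lemma order_bound N L : order_at_most S N -> 0 < L -> exists2 C, 0 <= C &
  forall phi M, tbox L phi -> lbnd N phi M -> normc (S phi) <= C * M.
Proof.
move=> ON L0; have [C HC] := ON _ (@box_compact R d L).
exists `|C| => // phi M tp HM.
have tf : test_function phi by apply/test_functionP; exists L.
apply: le_trans (HC _ tf _) _.
  have cl : closed [set y : 'rV[R]_d | `|y| <= L].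
    rewrite (_ : mkset _ = (fun y : 'rV[R]_d => `|y|) @^-1` [set x | x <= L])//.
    by apply: preimage_closed; [move=> x _; exact: norm_continuous|exact: closed_le].
  rewrite ((closure_id _).1 cl); apply: closureS => x /=; apply: contra_neqT.
  by rewrite -ltNge => /tp.2.
have ub : ubound [set r | exists (m : mpoly.multinom d) (x : 'rV[R]_d),
    (mpoly.mdeg m <= N)%N /\ r = normc (mpartial m phi x)] M.
  by move=> _ [m [x [mk ->]]]; rewrite mpartialE; apply: HM; rewrite size_mseq.
have mem : [set r | exists (m : mpoly.multinom d) (x : 'rV[R]_d),
    (mpoly.mdeg m <= N)%N /\ r = normc (mpartial m phi x)]
    (normc (mpartial (mpoly.mnm0 (n := d)) phi 0)).
  by exists (mpoly.mnm0 (n := d)), 0; rewrite mpoly.mdeg0.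
have k0 : 0 <= Ck_norm N phi.
  apply: le_trans (normc_ge0 (mpartial (mpoly.mnm0 (n := d)) phi 0)) _.
  by apply: ub_le_sup => //; exists M.
apply: le_trans (_ : `|C| * Ck_norm N phi <= _).
  by rewrite ler_wpM2r// ler_norm.
by rewrite ler_wpM2l//; apply: ge_sup => //; eexists; exact: mem.
Qed.

End Order.
End StrongSchwartz.

(** * Dilations and the convergence of cut-offs *)

Section Scaling.
Context {R : realType} {d : nat}.
Implicit Types (f g h G u : 'rV[R]_d -> R[i]).

Lemma is_derive_affine (g : 'rV[R]_d -> R) (a : R) (b x v : 'rV[R]_d) :
  derivable g (a *: x + b) v ->
  is_derive x v (fun x => g (a *: x + b)) (a * 'D_v g (a *: x + b)).
Proof.
move=> dg; apply/is_derive_eps => e e0.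
have a1 : 0 < `|a| + 1 by rewrite ltr_wpDl.
have /is_derive_eps/(_ _ (divr_gt0 e0 a1))[D D0 HD] : is_derive (a *: x + b) v g ('D_v g (a *: x + b)) by [].
exists (D / (`|a| + 1)); first by rewrite divr_gt0.
move=> s; rewrite ltr_pdivlMr// => sD.
have -> : a *: (s *: v + x) + b = (a * s) *: v + (a *: x + b).
  by rewrite scalerDr scalerA addrA.
have := HD (a * s); rewrite normrM => /(_ _)/wrap[].
  by apply: le_lt_trans sD; rewrite mulrC ler_wpM2l// lerDl.
rewrite [s * (a * _)]mulrA [s * a]mulrC => /le_trans; apply.
rewrite -mulrA ler_wpM2l ?(ltW e0)// mulrA ler_piMl//.
by rewrite mulrC ler_pdivrMr// mul1r lerDl.
Qed.

Lemma smooth_real_affine (g : 'rV[R]_d -> R) (a : R) (b : 'rV[R]_d) : smooth_real g ->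
  smooth_real (fun x => g (a *: x + b)).
Proof.
move=> Sg; refine (@smooth_real_coind R d (fun k : 'rV[R]_d -> R =>
  exists c : R, exists2 g : 'rV[R]_d -> R, smooth_real g & k = fun x => c * g (a *: x + b)) _ _ _);
  last by exists 1, g => //; apply/funext => x; rewrite mul1r.
move=> _ {g Sg} [c [g Sg ->]]; have /smooth_realP[cg [dg sg]] := Sg.
have D j x := @is_deriveZ R _ _ _ c x (delta_mx ord0 j) _ (is_derive_affine (dg j (a *: x + b))).
split; last split.
- apply: contM; first exact: cst_continuous.
  suff ca : continuous (fun x : 'rV[R]_d => a *: x + b).
    by move=> x; exact: (continuous_comp (ca x) (cg _)).
  move=> x; apply/cvg_eps => e e0; have a1 : 0 < `|a| + 1 by rewrite ltr_wpDl.
  exists (e / (`|a| + 1)); first by rewrite divr_gt0.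
  move=> y; rewrite ltr_pdivlMr// => yx.
  rewrite opprD addrACA subrr addr0 -scalerBr normrZ.
  by apply: le_trans (ltW yx); rewrite mulrC ler_wpM2l// lerDl.
- by move=> j x; have [] := D j x.
- move=> j; exists (c * a), (partial_real j g); first exact: sg.
  by apply/funext => x; have [_ E] := D j x; rewrite /partial_real -mulrA; exact: E.
Qed.

Lemma smooth_affine f (a : R) (b : 'rV[R]_d) : smooth f -> smooth (fun x => f (a *: x + b)).
Proof. by move=> [S1 S2]; split; [exact: (smooth_real_affine a b S1)|exact: (smooth_real_affine a b S2)]. Qed.

Lemma partial_affine f (a : R) (b : 'rV[R]_d) j : smooth f ->
  partial j (fun x => f (a *: x + b)) = fun x => a%:C%C * partial j f (a *: x + b).
Proof.
move=> Sf; apply/funext => x.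
have [d1 d2] := smooth_derivable Sf (a *: x + b) (ex_intro _ j erefl).
have [_ E1] := is_derive_affine d1; have [_ E2] := is_derive_affine d2.
apply: complex_ext; rewrite ?ReM ?ImM /= ?mul0r ?subr0 ?addr0; [exact: E1|exact: E2].
Qed.

(** Only partial derivatives are available, so the way from y to x is taken parallel to the axes,
    one coordinate at a time; each of the d segments contributes at most M |x - y|. *)
Lemma lipschitz_real (g : 'rV[R]_d -> R) (M : R) : 0 <= M ->
  (forall j x, derivable g x (delta_mx ord0 j)) -> (forall j x, `|partial_real j g x| <= M) ->
  forall x y, `|g x - g y| <= d%:R * M * `|x - y|.
Proof.
move=> M0 dg HM x y.
have H (r : seq 'I_d) : `|g (\sum_(j <- r) ((x - y) ord0 j *: (delta_mx ord0 j : 'rV[R]_d)) + y) - g y|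
    <= (size r)%:R * M * `|x - y|.
  elim: r => [|j r IH]; first by rewrite big_nil add0r subrr normr0 !mul0r.
  rewrite big_cons -addrA; set z := _ + y in IH *; set c := (x - y) ord0 j.
  have dh (t : R) : is_derive t 1 (fun t : R => g (t *: (delta_mx ord0 j : 'rV[R]_d) + z))
      (partial_real j g (t *: (delta_mx ord0 j : 'rV[R]_d) + z)).
    apply/is_derive_eps => e e0.
    have /is_derive_eps/(_ _ e0)[D D0 HD] : is_derive (t *: (delta_mx ord0 j : 'rV[R]_d) + z)
      (delta_mx ord0 j : 'rV[R]_d) g (partial_real j g (t *: (delta_mx ord0 j : 'rV[R]_d) + z)) by exact: derivableP.
    exists D => // s sD; have := HD s sD.
    by rewrite [s *: 1]mulr1 [_ *: _ + (_ + z)]addrA -scalerDl.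
  have dk (t : R) : is_derive t 1 (fun _ : R => 0 : R) (0 : R) by exact: is_derive_cst.
  have := deriveB_bound 0 c dh dk (e := M).
  rewrite !subr0 scale0r add0r => /(_ (fun t => _)) K.
  have {}K : `|g (c *: (delta_mx ord0 j : 'rV[R]_d) + z) - g z| <= M * `|c|.
    by apply: K => t; rewrite subr0.
  rewrite -(subrKA (g z)) [size _]/= -[(size r).+1%:R]natr1 !mulrDl mul1r [leRHS]addrC.
  apply: le_trans (ler_normD _ _) _; apply: lerD => //.
  by apply: le_trans K _; rewrite ler_wpM2l//; exact: coord_le_norm.
have := H (index_enum 'I_d); rewrite -row_sum_delta subrK.
by rewrite /index_enum -enumT size_enum_ord.
Qed.

Lemma lipschitz_complex f M : smooth f -> (forall j x, normc (partial j f x) <= M) ->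
  exists2 C, 0 <= C & forall x y, normc (f x - f y) <= C * `|x - y|.
Proof.
move=> Sf HM; exists (2 * (d%:R * `|M|)); first by rewrite !mulr_ge0.
have [D1 D2] : (forall j x, derivable (fun y => complex.Re (f y)) x (delta_mx ord0 j))
   /\ (forall j x, derivable (fun y => complex.Im (f y)) x (delta_mx ord0 j)).
  by split=> j x; have [] := smooth_derivable Sf x (ex_intro _ j erefl).
move=> x y; apply: le_trans (normc_le _) _; rewrite ReD ImD ReN ImN.
rewrite mulrDl mul1r mulrDl; apply: lerD.
  apply: (lipschitz_real _ D1) => // j z; apply: le_trans (ler_norm M).
  exact: le_trans (normc_Re (partial j f z)) (HM j z).
apply: (lipschitz_real _ D2) => // j z; apply: le_trans (ler_norm M).
exact: le_trans (normc_Im (partial j f z)) (HM j z).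
Qed.

Lemma foldr_partialD f g s : smooth f -> smooth g ->
  foldr partial (fun x => f x + g x) s = fun x => foldr partial f s x + foldr partial g s x.
Proof.
move=> Sf Sg; elim: s => //= j s ->.
by rewrite (partialD j (smooth_foldr s Sf) (smooth_foldr s Sg)).
Qed.

Definition cbounded h := smooth h /\ forall s, exists M, forall x,
  normc (foldr partial h s x) <= M.

Lemma cbounded_partial j h : cbounded h -> cbounded (partial j h).
Proof.
move=> [Sh H]; split; first exact: smooth_partial.
by move=> s; have [M HM] := H (rcons s j); exists M => x; have := HM x; rewrite foldr_rcons.
Qed.

Lemma tbox_cbounded L h : tbox L h -> cbounded h.
Proof.
move=> th; split; first by case: th.
by move=> s; have [M _ HM] := tbox_bounded (tbox_foldr s th); exists M.
Qed.

Lemma cbounded_cst c : cbounded (fun _ : 'rV[R]_d => c).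
Proof.
split; first exact: smooth_cst.
move=> s; have : exists c', foldr partial (fun _ : 'rV[R]_d => c) s = fun=> c'.
  elim: s => [|j s [c' E]]; first by exists c.
  by exists 0; rewrite /= E partial_cst.
by move=> [c' ->]; exists (normc c').
Qed.

Lemma cboundedD f g : cbounded f -> cbounded g -> cbounded (fun x => f x + g x).
Proof.
move=> [Sf Hf] [Sg Hg]; split; first exact: smoothD.
move=> s; have [M HM] := Hf s; have [N HN] := Hg s; exists (M + N) => x.
by rewrite foldr_partialD//; apply: le_trans (normcD _ _) _; exact: lerD.
Qed.

Lemma cboundedZ c f : cbounded f -> cbounded (fun x => c * f x).
Proof.
move=> [Sf Hf]; split; first exact: smoothZ.
move=> s; have [M HM] := Hf s; exists (normc c * M) => x.
by rewrite foldr_partialZ// normcM ler_wpM2l// normc_ge0.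
Qed.

(** The seminorm with derivatives [s] and weight [b] is O(C n). For C n = 1/(n+1) and all [s], [b],
    the sequence tends to 0 in the Schwartz topology. *)
Definition unull (C : nat -> R) (phi : nat -> 'rV[R]_d -> R[i]) s (b : nat) :=
  exists2 M : R, 0 <= M & forall n x,
    (1 + `|x|) ^+ b * normc (foldr partial (phi n) s x) <= M * C n.

Lemma unullD C phi psi s b : (forall n, smooth (phi n)) -> (forall n, smooth (psi n)) ->
  unull C phi s b -> unull C psi s b -> unull C (fun n x => phi n x + psi n x) s b.
Proof.
move=> Sp Sq [M M0 HM] [N N0 HN]; exists (M + N); first exact: addr_ge0.
move=> n x; rewrite foldr_partialD// mulrDl; apply: le_trans (lerD (HM n x) (HN n x)).
by rewrite -mulrDr ler_wpM2l ?normcD// exprn_ge0// addr_ge0.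
Qed.

Lemma unullZ C C' phi s b (c : nat -> R) : (forall n, smooth (phi n)) -> (forall n, `|c n| * C n <= C' n) ->
  unull C phi s b -> unull C' (fun n x => (c n)%:C%C * phi n x) s b.
Proof.
move=> Sp cC [M M0 HM]; exists M => // n x; rewrite foldr_partialZ// normcM normc_real.
rewrite mulrCA; apply: le_trans (_ : `|c n| * (M * C n) <= _).
  by rewrite ler_wpM2l.
by rewrite mulrCA ler_wpM2l.
Qed.

Let c_ (n : nat) : R := n.+1%:R^-1.

Lemma c_bounds n : 0 < c_ n <= 1.
Proof. by rewrite invr_gt0 ltr0n/= invf_le1 ?ltr0n// ler1n. Qed.

Lemma smooth_scale h n : smooth h -> smooth (fun x => h (c_ n *: x)).
Proof.
move=> Sh; have := smooth_affine (c_ n) 0 Sh.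
by rewrite (_ : (fun x => h (_ + 0)) = fun x => h (c_ n *: x))//; apply/funext => x; rewrite addr0.
Qed.

Lemma partial_scale h n j : smooth h ->
  partial j (fun x => h (c_ n *: x)) = fun x => (c_ n)%:C%C * partial j h (c_ n *: x).
Proof.
move=> Sh; have := partial_affine (c_ n) 0 j Sh.
rewrite (_ : (fun x => h (_ + 0)) = fun x => h (c_ n *: x)); last by apply/funext => x; rewrite addr0.
by move=> ->; apply/funext => x; rewrite addr0.
Qed.

Lemma scaled_bounded h G s b : cbounded h -> sschwartz G ->
  unull (fun=> 1) (fun n x => h (c_ n *: x) * G x) s b.
Proof.
elim/last_ind: s h G => [|s j IH] h G bh sG; have [Sh Hh] := bh; have SG := sG.1.
  have [M HM] := Hh [::]; have [N N0 HN] := sschwartz_bound [::] b sG.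
  have M0 : 0 <= M := le_trans (normc_ge0 _) (HM 0).
  exists (M * N); first exact: mulr_ge0.
  move=> n x; rewrite /= normcM mulr1 mulrCA; apply: ler_pM; rewrite ?normc_ge0//.
  by rewrite mulr_ge0 ?normc_ge0// exprn_ge0// addr_ge0.
have S1 n : smooth (fun x => partial j h (c_ n *: x) * G x).
  by apply: smoothM SG; apply: smooth_scale; exact: smooth_partial.
have S2 n : smooth (fun x => h (c_ n *: x) * partial j G x).
  by apply: (smoothM (smooth_scale n Sh)); exact: smooth_partial.
have := unullD (fun n => smoothZ (c_ n)%:C%C (S1 n)) S2
  (@unullZ (fun=> 1) (fun=> 1) _ s b c_ S1 _ (IH _ _ (cbounded_partial j bh) sG)) (IH _ _ bh (sschwartz_partial j sG)).
have cb n : `|c_ n| * 1 <= 1 by have /andP[/ltW c0 c1] := c_bounds n; rewrite mulr1 ger0_norm.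
move=> /(_ cb) [M M0 HM]; exists M => // n x; have := HM n x.
rewrite foldr_rcons (partialM j (smooth_scale n Sh) SG) (partial_scale n j Sh).
by rewrite (_ : (fun x => (c_ n)%:C%C * _ + _) = (fun x => (c_ n)%:C%C * partial j h (c_ n *: x) * G x +
   h (c_ n *: x) * partial j G x))//; apply/funext => y; rewrite mulrA.
Qed.

(** [h] is Lipschitz, so |h(x/n) - h(0)| is at most a multiple of |x|/n, and one more order of decay
    of [G] absorbs |x|. A derivative that falls on [h] brings the factor 1/n by itself, and
    [scaled_bounded] covers what remains. *)
Lemma scaled_null h G s b : cbounded h -> sschwartz G ->
  unull c_ (fun n x => (h (c_ n *: x) - h 0) * G x) s b.
Proof.
(* The last entry of the list is differentiated first; both terms of the product rule then have the
   same shape, with other [h] and [G]. *)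
elim/last_ind: s h G => [|s j IH] h G bh sG; have [Sh Hh] := bh; have SG := sG.1.
  have [M0 HM0] : exists M, forall j x, normc (partial j h x) <= M.
    have /choice[F HF] (j : 'I_d) : exists M, forall x, normc (partial j h x) <= M := Hh [:: j].
    exists (\sum_j `|F j|) => j x; apply: le_trans (HF j x) _; apply: le_trans (ler_norm _) _.
    by rewrite (bigD1 j)//= lerDl sumr_ge0.
  have [C C0 HC] := lipschitz_complex Sh HM0.
  have [N N0 HN] := sschwartz_bound [::] b.+1 sG.
  exists (C * N); first exact: mulr_ge0.
  move=> n x; rewrite /= normcM.
  have /andP[c0 c1] := c_bounds n.
  have H1 : normc (h (c_ n *: x) - h 0) <= C * (c_ n * (1 + `|x|)).
    apply: le_trans (HC _ _) _; rewrite subr0 normrZ gtr0_norm// ler_wpM2l//.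
    by rewrite ler_wpM2l ?(ltW c0)// lerDr.
  have := HN x; rewrite /= exprS => H2.
  have e0 : 0 <= (1 + `|x|) ^+ b by rewrite exprn_ge0// addr_ge0.
  apply: le_trans (_ : (1 + `|x|) ^+ b * (C * (c_ n * (1 + `|x|)) * normc (G x)) <= _).
    by rewrite ler_wpM2l// ler_wpM2r// normc_ge0.
  rewrite [leLHS](_ : _ = C * c_ n * ((1 + `|x|) * (1 + `|x|) ^+ b * normc (G x))); last by ring.
  rewrite [leRHS](_ : _ = C * c_ n * N); last by ring.
  by rewrite ler_wpM2l// mulr_ge0// ltW.
have Sc n : smooth (fun x => h (c_ n *: x) - h 0).
  by apply: smoothD; [exact: smooth_scale|exact: smooth_cst].
have S1 n : smooth (fun x => partial j h (c_ n *: x) * G x).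
  by apply: smoothM SG; apply: smooth_scale; exact: smooth_partial.
have S2 n : smooth (fun x => (h (c_ n *: x) - h 0) * partial j G x).
  by apply: (smoothM (Sc n)); exact: smooth_partial.
have := unullD (fun n => smoothZ (c_ n)%:C%C (S1 n)) S2
  (@unullZ (fun=> 1) c_ _ s b c_ S1 _ (@scaled_bounded _ _ s b (cbounded_partial j bh) sG)) (IH _ _ bh (sschwartz_partial j sG)).
have cb n : `|c_ n| * 1 <= c_ n by have /andP[/ltW c0 c1] := c_bounds n; rewrite mulr1 ger0_norm.
move=> /(_ cb) [M M0 HM]; exists M => // n x; have := HM n x.
rewrite foldr_rcons (partialM j (Sc n) SG).
rewrite (partialD j (smooth_scale n Sh) (smooth_cst _)) partial_cst (partial_scale n j Sh).
by rewrite (_ : (fun x => (c_ n)%:C%C * _ + _) = (fun x => ((c_ n)%:C%C * partial j h (c_ n *: x) + 0) * G x +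
   (h (c_ n *: x) - h 0) * partial j G x))//; apply/funext => y; rewrite addr0 mulrA.
Qed.

(** Where u is nonzero, n |x - x0| >= n r, so decay of order a + 1 turns the factor n^a into O(1/n).
    A derivative that falls on [G] brings a further n, which is why [a] is arbitrary in the
    induction. *)
Lemma off_diagonal_null u G (x0 : 'rV[R]_d) (r : R) (a : nat) s b : 0 < r -> cbounded u ->
  (forall x, `|x - x0| < r -> u x = 0) -> sschwartz G ->
  unull c_ (fun n x => (n.+1%:R ^+ a)%:C%C * (u x * G (n.+1%:R *: x - n.+1%:R *: x0))) s b.
Proof.
move=> r0; elim/last_ind: s a u G => [|s j IH] a u G bu ur sG; have [Su Hu] := bu; have SG := sG.1.
  have [M HM] := Hu [::]; have M0 : 0 <= M := le_trans (normc_ge0 _) (HM 0).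
  have [N N0 HN] := sschwartz_bound [::] (a.+1 + b) sG.
  pose r' := Num.min r 1; have r'0 : 0 < r' by rewrite lt_min r0 ltr01.
  pose K := r'^-1 ^+ a.+1 * (1 + `|x0|) ^+ b.
  have K0 : 0 <= K by rewrite mulr_ge0 ?exprn_ge0 ?invr_ge0 ?(ltW r'0) ?addr_ge0.
  exists (M * N * K); first exact: mulr_ge0 (mulr_ge0 M0 N0) K0.
  move=> n x; rewrite /= !normcM normc_real.
  set m : R := n.+1%:R; have m1 : 1 <= m by rewrite ler1n.
  have m0 : 0 < m := lt_le_trans ltr01 m1.
  have RHS0 : 0 <= M * N * K * c_ n.
    by have /andP[/ltW cn _] := c_bounds n; exact: mulr_ge0 (mulr_ge0 (mulr_ge0 M0 N0) K0) cn.
  have [xr|rx] := ltP `|x - x0| r.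
    by rewrite (ur _ xr) normc0 mul0r !mulr0.
  rewrite -scalerBr; set y := x - x0 in rx *.
  have ny : 0 <= `|y| by [].
  have H1 := HN (m *: y); rewrite /= normrZ (gtr0_norm m0) exprD in H1.
  have L1 : r' ^+ a.+1 * m ^+ a.+1 <= (1 + m * `|y|) ^+ a.+1.
    rewrite -exprMn; apply: lerXn2r; rewrite ?nnegrE ?addr_ge0 ?mulr_ge0 ?(ltW r'0) ?(ltW m0)//.
    rewrite mulrC; apply: ler_wpDl => //; rewrite ler_wpM2l ?(ltW m0)//.
    by apply: le_trans rx; rewrite ge_min lexx.
  (* Peetre's inequality: the weight at x is compared with the weight at m (x - x0), using m >=
     1. *)
  have L2 : (1 + `|x|) ^+ b <= (1 + `|x0|) ^+ b * (1 + m * `|y|) ^+ b.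
    rewrite -exprMn; apply: lerXn2r; rewrite ?nnegrE ?mulr_ge0 ?addr_ge0 ?mulr_ge0 ?(ltW m0)//.
    have : `|x| <= `|y| + `|x0| by rewrite -{1}(subrK x0 x) ler_normD.
    have : `|y| <= m * `|y| by rewrite ler_peMl.
    have : 0 <= `|x0| * (m * `|y|) by rewrite !mulr_ge0// ltW.
    by nra.
  rewrite ger0_norm ?exprn_ge0 ?(ltW m0)//.
  set g := normc (G _) in H1 *; have g0 : 0 <= g := normc_ge0 _.
  have uM := HM x; rewrite /= in uM.
  apply: le_trans (_ : (1 + `|x0|) ^+ b * (1 + m * `|y|) ^+ b * (m ^+ a * (M * g)) <= _).
    apply: ler_pM; rewrite ?mulr_ge0 ?exprn_ge0 ?addr_ge0 ?normc_ge0 ?(ltW m0)//.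
    by rewrite ler_wpM2l ?exprn_ge0 ?(ltW m0)// ler_wpM2r.
  have Hm : m ^+ a * ((1 + m * `|y|) ^+ b * g) <= r'^-1 ^+ a.+1 * N * m^-1.
    rewrite -(ler_pM2r m0) divfK ?gt_eqF// exprVn.
    rewrite [leRHS]mulrC ler_pdivlMr ?exprn_gt0//; apply: le_trans H1.
    rewrite [leLHS](_ : _ = (r' ^+ a.+1 * m ^+ a.+1) * ((1 + m * `|y|) ^+ b * g)); last by rewrite [m ^+ a.+1]exprSr; ring.
    by rewrite -[leRHS]mulrA ler_wpM2r// mulr_ge0// exprn_ge0// addr_ge0// mulr_ge0// ltW.
  rewrite [leLHS](_ : _ = (1 + `|x0|) ^+ b * M * (m ^+ a * ((1 + m * `|y|) ^+ b * g))); last by ring.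
  apply: le_trans (ler_wpM2l _ Hm) _; first by rewrite mulr_ge0// exprn_ge0// addr_ge0.
  by rewrite le_eqVlt; apply/orP; left; apply/eqP; rewrite /K /c_ -/m; ring.
have SGn n : smooth (fun x => G (n.+1%:R *: x - n.+1%:R *: x0)).
  exact: (smooth_affine n.+1%:R (- (n.+1%:R *: x0)) SG).
have SdGn n : smooth (fun x => partial j G (n.+1%:R *: x - n.+1%:R *: x0)).
  exact: (smooth_affine n.+1%:R (- (n.+1%:R *: x0)) (smooth_partial j SG)).
have dur x : `|x - x0| < r -> partial j u x = 0.
  move=> xr; have nx : \forall y \near x, u y = 0.
    have cn : {for x, continuous (fun y : 'rV[R]_d => `|y - x0|)}.
      apply/cvg_eps => e e0; exists e => // y yx; apply: le_trans (ler_dist_dist _ _) _.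
      by rewrite opprB addrA subrK ltW.
    have nr : \forall y \near x, `|y - x0| < r by exact: (cvgr_lt _ cn _ xr).
    by apply: filterS nr => y; exact: ur.
  apply: complex_ext; rewrite /= /partial_real.
    rewrite (@near_eq_derive _ _ _ _ (cst 0)) ?derive_cst//.
    by apply: filterS nx => y ->.
  rewrite (@near_eq_derive _ _ _ _ (cst 0)) ?derive_cst//.
  by apply: filterS nx => y ->.
have I1 := IH a _ _ (cbounded_partial j bu) dur sG.
have I2 := IH a.+1 _ _ bu ur (sschwartz_partial j sG).
have S1 n := smoothZ (n.+1%:R ^+ a)%:C%C (smoothM (smooth_partial j Su) (SGn n)).
have S2 n := smoothZ (n.+1%:R ^+ a.+1)%:C%C (smoothM Su (SdGn n)).
have [M M0 HM] := unullD S1 S2 I1 I2; exists M => // n x; have := HM n x.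
rewrite foldr_rcons (partialZ _ j (smoothM Su (SGn n))) (partialM j Su (SGn n)).
rewrite (partial_affine n.+1%:R (- (n.+1%:R *: x0)) j SG).
set A := (fun x => _ + _); set B := (fun x => _ * _).
rewrite (_ : A = B)//; apply/funext => z; rewrite /A /B exprS.
by rewrite [(n.+1%:R * _)%:C%C]rmorphM /=; ring.
Qed.

End Scaling.

(** * Cut-off functions and supports *)

Section Cutoff.
Context {R : realType} {d : nat}.
Implicit Types (K U V : set 'rV[R]_d) (phi psi : 'rV[R]_d -> R[i]).

Definition is_bump U (th : 'rV[R]_d -> R) :=
  [/\ smooth_real th, forall x, 0 <= th x <= 1, closure [set x | th x != 0] `<=` U &
   exists2 L : R, 0 < L & forall x, L < `|x| -> th x = 0].

Lemma closed_box (p : 'rV[R]_d) (L : R) : closed [set y : 'rV[R]_d | `|y - p| <= L].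
Proof.
rewrite (_ : mkset _ = (fun y : 'rV[R]_d => `|y - p|) @^-1` [set x | x <= L])//.
apply: preimage_closed; last exact: closed_le.
move=> x _; apply/cvg_eps => e e0; exists e => // y yx; apply: le_trans (ler_dist_dist _ _) _.
by rewrite opprB addrA subrK ltW.
Qed.

(** The neighbourhood may vary with the point: a constant [U] yields cut-off functions, a varying
    one passes from local to global vanishing of a distribution. *)
Lemma finite_bumps K (U : 'rV[R]_d -> set 'rV[R]_d) : compact K ->
  (forall p, K p -> open (U p) /\ U p p) ->
  exists (r : seq 'rV[R]_d) (th : 'rV[R]_d -> 'rV[R]_d -> R) V,
    [/\ forall p, p \in r -> K p /\ is_bump (U p) (th p), open V, K `<=` V &
        forall x, V x -> exists2 p, p \in r & th p x = 1].
Proof.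
move=> cK HU.
have bump p : exists th : 'rV[R]_d -> R, K p -> is_bump (U p) th /\
    exists2 e : R, 0 < e & forall x, `|x - p| <= e -> th x = 1.
  have [Kp|nKp] := pselect (K p); last by exists (fun=> 0).
  have [oU Up] := HU p Kp.
  have /nbhs_ballP[e /= e0 eU] : nbhs p (U p) by apply: open_nbhs_nbhs.
  (* With e/4 the bump lives in |x - p| < e/2, so even the closure of its support stays in the ball
     of radius e inside [U p]. *)
  have [|th [S1 S2 S3 S4]] := @box_bump R d p (e / 4); first by rewrite divr_gt0.
  exists th => _; split; last by exists (e / 4); [rewrite divr_gt0|].
  have in2 x : th x != 0 -> `|x - p| <= e / 2.
    by move=> /S4 /ltW /le_trans; apply; lra.
  split=> //.
    apply: (@subset_trans _ [set y : 'rV[R]_d | `|y - p| <= e / 2]).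
      by rewrite [X in _ `<=` X]((closure_id _).1 (@closed_box p (e / 2))); apply: closureS.
    move=> y /= yp; apply: eU; rewrite -ball_normE /= distrC.
    by apply: le_lt_trans yp _; rewrite ltr_pdivrMr// ltr_pMr// ltr1n.
  exists (`|p| + e); first by rewrite ltr_wpDl.
  move=> x px; apply/eqP; apply: contraTT px => /in2 xp; rewrite -leNgt.
  have : `|x| <= `|x - p| + `|p| by rewrite -{1}(subrK p x) ler_normD.
  by move: xp e0; lra.
have [th Hth] := choice bump.
have {}bump p := Hth p.
have /choice[e He] p : exists e : R, K p -> 0 < e /\ forall x, `|x - p| <= e -> th p x = 1.
  have [Kp|nKp] := pselect (K p); last by exists 0.
  by have [_ [e e0 H]] := bump p Kp; exists e.
have := cK; rewrite compact_cover => /(_ 'rV[R]_d K (fun p => ball p (e p))).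
case=> [p _|p Kp|D DK HD].
- by apply: ball_open; have [] := He p _.
- by exists p => //; apply: ballxx; have [] := He p Kp.
have DK' p : p \in finmap.enum_fset D -> K p by move=> pD; have := DK p pD; rewrite inE.
exists (finmap.enum_fset D), th, (\bigcup_(p in [set q | q \in finmap.enum_fset D]) ball p (e p)); split.
- by move=> p /DK' Kp; split=> //; have [] := bump p Kp.
- by apply: bigcup_open => p pD; apply: ball_open; have [] := He p (DK' p pD).
- exact: HD.
- move=> x [p pD xp]; exists p => //; have [_ H] := He p (DK' p pD).
  by apply: H; move: xp; rewrite -ball_normE /= distrC => /ltW.
Qed.

Lemma smooth_bump U th : is_bump U th -> smooth (fun x => (th x)%:C%C).
Proof. by move=> [S1 _ _ _]; apply: smooth_real_complex; exact: SmBase. Qed.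

Lemma cutoff K U : compact K -> open U -> K `<=` U ->
  exists chi : 'rV[R]_d -> R, is_bump U chi /\
    exists2 V, open V & K `<=` V /\ forall x, V x -> chi x = 1.
Proof.
move=> cK oU KU.
have [//|r [th [V [Hr oV KV V1]]]] := @finite_bumps K (fun=> U) cK.
  by move=> p /KU.
(* This is 1 as soon as one bump is 1 and 0 where all bumps vanish, so nothing has to be
   normalised. *)
exists (fun x => 1 - \prod_(p <- r) (1 - th p x)); split; last first.
  exists V => //; split=> // x /V1[p pr p1].
  by rewrite (big_rem p)//= p1 subrr mul0r subr0.
have B p : p \in r -> is_bump U (th p) by move=> /Hr[].
have nz x : 1 - \prod_(p <- r) (1 - th p x) != 0 -> exists2 p, p \in r & th p x != 0.
  apply: contra_neqP => H; rewrite big_seq big1 ?subrr// => p pr.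
  apply/eqP; rewrite subr_eq addrC -subr_eq subrr eq_sym; apply/negPn/negP => p0.
  by apply: H; exists p.
split.
- apply: smooth_expr_smooth; apply: (@SmAdd _ _ (cst 1)); first exact: SmCst.
  rewrite (_ : (fun x => _) = cst (-1) * (fun x => \prod_(p <- r) (1 - th p x))); last first.
    by apply/funext => x; rewrite -[LHS]mulN1r.
  apply: SmMul; first exact: SmCst.
  elim: r B {Hr V1 nz} => [|p r IH] B.
    rewrite (_ : (fun x => _) = cst 1); first exact: SmCst.
    by apply/funext => x; rewrite big_nil.
  rewrite (_ : (fun x => _) = (fun x => 1 - th p x) * (fun x => \prod_(p <- r) (1 - th p x))); last first.
    by apply/funext => x; rewrite big_cons.
  apply: SmMul; last by apply: IH => q qr; apply: B; rewrite inE qr orbT.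
  apply: (@SmAdd _ _ (cst 1)); first exact: SmCst.
  rewrite (_ : (fun x => _) = cst (-1) * th p); last by apply/funext => x; rewrite -[LHS]mulN1r.
  apply: SmMul; first exact: SmCst.
  by apply: SmBase; have [] := B p (mem_head _ _).
- move=> x; have H : 0 <= \prod_(p <- r) (1 - th p x) <= 1.
    rewrite big_seq; apply/andP; split.
      apply: prodr_ge0 => p pr; have [_ H _ _] := B p pr.
      by have /andP[_] := H x; rewrite subr_ge0.
    apply: prodr_ile1 => p pr; have [_ H _ _] := B p pr.
    by have /andP[H0 H1] := H x; rewrite subr_ge0 H1 gerBl.
  by have /andP[H0 H1] := H; rewrite subr_ge0 H1 gerBl.
- apply: (@subset_trans _ (\bigcup_(p in [set` r]) closure [set x | th p x != 0])); last first.
    by move=> x [p /= pr]; have [_ _ H _] := B p pr; exact: H.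
  have cl : closed (\bigcup_(p in [set` r]) closure [set x | th p x != 0]).
    by apply: closed_bigcup => [|p _]; [exact: finite_seq|exact: closed_closure].
  rewrite [X in _ `<=` X]((closure_id _).1 cl); apply: closureS => x /= /nz[p pr px].
  by exists p => //; exact: subset_closure.
- have /choice[L HL] p : exists L : R, p \in r -> 0 < L /\ forall x, L < `|x| -> th p x = 0.
    have [pr|npr] := pselect (p \in r); last by exists 0.
    by have [_ _ _ [L L0 H]] := B p pr; exists L.
  exists (1 + \sum_(p <- r) `|L p|); first by rewrite ltr_wpDr// sumr_ge0.
  move=> x Lx; apply/eqP; apply: contraTT Lx => /nz[p pr px]; rewrite -leNgt.
  have [L0 H] := HL p pr.
  have xL : `|x| <= L p by rewrite leNgt; apply: contra px => /H ->.
  apply: le_trans xL _; apply: le_trans (ler_norm _) _.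
  by rewrite (big_rem p)//= addrCA lerDl addr_ge0// sumr_ge0.
Qed.

(** Each factor 1 - [th p] changes the value by that at a test function supported in [U p], where
    the distribution vanishes. The product of all factors is 0 on the support of phi, so the value
    is 0. *)
Lemma fourier_dist_vanish (T : ('rV[R]_d -> R[i]) -> R[i]) phi :
  strong_tempered T -> test_function phi ->
  (forall x, fsupport phi x -> ~ dist_support (fourier_dist T) x) ->
  fourier_dist T phi = 0.
Proof.
move=> ST tp Hp; have [Sp cp] := tp.
have /choice[U HU] (p : 'rV[R]_d) : exists U : set 'rV[R]_d, fsupport phi p ->
    [/\ open U, U p & vanishes_on (fourier_dist T) U].
  have [pp|npp] := pselect (fsupport phi p); last by exists set0.
  by have /contrapT[V HV] := Hp p pp; exists V.
have [|r [th [V [Hr oV KV V1]]]] := @finite_bumps _ U cp.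
  by move=> p /HU[].
have /test_functionP[L L0 tL] := tp.
have main (r' : seq 'rV[R]_d) : {subset r' <= r} ->
    tbox L (fun x => phi x * (\prod_(p <- r') (1 - th p x))%:C%C) /\
    fourier_dist T phi = fourier_dist T (fun x => phi x * (\prod_(p <- r') (1 - th p x))%:C%C).
  elim: r' => [|p r' IH] sub.
    rewrite (_ : (fun x => _) = phi)//; apply/funext => x.
    by rewrite big_nil mulr1.
  have [q qr|t1 E1] := IH; first by apply: sub; rewrite inE qr orbT.
  have pr : p \in r by apply: sub; exact: mem_head.
  have [Kp bp] := Hr p pr; have [oU Up vU] := HU p Kp.
  set g := fun x => phi x * (\prod_(p <- r') _)%:C%C in t1 E1.
  have Sth := smooth_bump bp.
  have t2 : tbox L (fun x => g x * (th p x)%:C%C) := tboxMr t1 Sth.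
  have Eg : (fun x => phi x * (\prod_(q <- p :: r') (1 - th q x))%:C%C) =
      fun x => g x + -1 * (g x * (th p x)%:C%C).
    apply/funext => x; rewrite big_cons /g rmorphM rmorphB rmorph1 /=; ring.
  rewrite Eg; split; first exact: tboxD t1 (tboxZ (-1) t2).
  rewrite (fourier_distD ST L0 t1 (tboxZ (-1) t2)) (fourier_distZ ST (-1) L0 t2) E1.
  have v0 : fourier_dist T (fun x => g x * (th p x)%:C%C) = 0.
    apply: vU; first by apply/test_functionP; exists L.
    have [_ _ H _] := bp; apply: subset_trans H; apply: closureS => x /=.
    by apply: contra_neq => ->; rewrite mulr0.
  by rewrite v0 mulr0 addr0.
have [_ ->] := main r (fun _ => id).
rewrite (_ : (fun x => _) = fun x => 0 * phi x).
  by rewrite (fourier_distZ ST 0 L0 tL) mul0r.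
apply/funext => x; rewrite mul0r.
have [->|px] := eqVneq (phi x) 0; first by rewrite mul0r.
have /V1[p pr p1] : V x by apply: KV; exact: subset_closure.
by rewrite (big_rem p)//= p1 subrr mul0r mulr0.
Qed.

End Cutoff.

(** * Point evaluation through the Fourier side *)

Section Autocorrelation.
Context {R : realType} {d : nat}.
Implicit Types (g h : 'rV[R]_d -> R).

Lemma unit_bump : exists h : 'rV[R]_d -> R, [/\ smooth_real h, forall x, 0 <= h x <= 1,
  forall x, `|x| <= 1 -> h x = 1 & forall x, 2 <= `|x| -> h x = 0].
Proof.
have [h [h1 h2 h3 h4]] := @box_bump R d 0 1 ltr01; exists h; split=> //.
  by move=> x x1; apply: h3; rewrite subr0.
by move=> x x2; apply/eqP; apply: contraTT x2 => /h4; rewrite subr0 mulr1 -ltNge.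
Qed.

(** Two functions, although only [acorr h h] matters: differentiation acts on [g] alone and leads to
    [acorr h (partial_real j g)]. *)
Definition acorr h g : 'rV[R]_d -> R := fun l => integral_real (fun m => h m * g (m + l)).

Lemma shift_continuous (g : 'rV[R]_d -> R) (b : 'rV[R]_d) : continuous g ->
  continuous (fun x : 'rV[R]_d => g (x + b)).
Proof.
move=> cg; suff cb : continuous (fun x : 'rV[R]_d => x + b).
  by move=> x; exact: (continuous_comp (cb x) (cg _)).
move=> x; apply/cvg_eps => e e0; exists e => // y yx.
by rewrite opprD addrACA subrr addr0 ltW.
Qed.

Lemma cc_mulr L h g : cc L h -> continuous g -> cc L (fun x => h x * g x).
Proof.
move=> [ch hL] cg; split; first exact: contM.
by move=> x Lx; rewrite hL// mul0r.
Qed.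

Lemma add2_continuous : continuous (fun p : 'rV[R]_d * 'rV[R]_d => p.2 + p.1).
Proof. by move=> p; exact: (cvgD cvg_snd cvg_fst). Qed.

Lemma acorr_joint_continuous h g : continuous h -> continuous g ->
  continuous (fun p : 'rV[R]_d * 'rV[R]_d => h p.2 * g (p.2 + p.1)).
Proof.
move=> ch cg; apply: contM => p.
  exact: (@continuous_comp _ _ _ snd h p cvg_snd (ch _)).
exact: (continuous_comp (@add2_continuous p) (cg _)).
Qed.

Lemma is_derive_acorr L h g j l : 0 < L -> cc L h -> smooth_real g ->
  is_derive l (delta_mx ord0 j : 'rV[R]_d) (acorr h g) (acorr h (partial_real j g) l).
Proof.
move=> L0 hL /smooth_realP[cg [dg sg]]; have ch := hL.1.
have [cdg _] := (smooth_realP _).1 (sg j).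
pose e_ : 'rV[R]_d := delta_mx ord0 j.
have cB : continuous (fun p : R * 'rV[R]_d => h p.2 * partial_real j g (p.2 + (p.1 *: e_ + l))).
  have : continuous ((fun p : 'rV[R]_d * 'rV[R]_d => h p.2 * partial_real j g (p.2 + p.1)) \o
     (fun p : R * 'rV[R]_d => (p.1 *: e_ + l, p.2))).
    move=> p; apply: continuous_comp; last exact: acorr_joint_continuous.
    apply: pair_continuous => q; last exact: cvg_snd.
    apply: (@continuous_comp _ _ _ fst (fun t : R => t *: e_ + l)); first exact: cvg_fst.
    apply/cvg_eps => e e0; exists e => // y yq.
    rewrite opprD addrACA subrr addr0 -scalerBl normrZ -[leRHS]mulr1.
    apply: ler_pM => //; first exact: ltW.
    by apply: norm_rV_le => // k; rewrite mxE; case: (_ && _); rewrite ?normr1 ?normr0.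
  exact.
have dA m (t : R) : is_derive t 1 (fun t => h m * g (m + (t *: e_ + l)))
    (h m * partial_real j g (m + (t *: e_ + l))).
  apply: (@is_deriveZ R R R (fun t => g (m + (t *: e_ + l))) (h m) t 1).
  apply/is_derive_eps => e e0.
  have dgm : is_derive (m + (t *: e_ + l)) e_ g (partial_real j g (m + (t *: e_ + l))).
    exact: (derivableP (dg j _)).
  have /is_derive_eps/(_ _ e0)[D D0 HD] := dgm.
  exists D => // s sD; have := HD s sD.
  rewrite [s *: 1]mulr1 scalerDl.
  by rewrite [s *: e_ + (m + _)]addrCA [s *: e_ + (_ + l)]addrA.
have AL t : cc L (fun m => h m * g (m + (t *: e_ + l))).
  by apply: cc_mulr => //; exact: shift_continuous.
have /is_derive_eps H := int_derive L0 AL dA cB 0.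
apply/is_derive_eps => e e0; have [D D0 HD] := H _ e0; exists D => // s sD.
by have := HD s sD; rewrite [s *: 1]mulr1 addr0 !scale0r !add0r.
Qed.

Lemma smooth_acorr L h g : 0 < L -> cc L h -> smooth_real g -> smooth_real (acorr h g).
Proof.
move=> L0 hL Sg; refine (@smooth_real_coind R d
  (fun k : 'rV[R]_d -> R => exists2 g, smooth_real g & k = acorr h g) _ _ _); last by exists g.
move=> _ {g Sg} [g Sg ->]; have /smooth_realP[cg [dg sg]] := Sg.
split; last split.
- apply: (int_param_continuous L0 (@acorr_joint_continuous _ _ hL.1 cg)) => z x Lx.
  by rewrite hL.2// mul0r.
- by move=> j x; have [] := is_derive_acorr j x L0 hL Sg.
- move=> j; exists (partial_real j g); first exact: sg.
  by apply/funext => l; have [_] := is_derive_acorr j l L0 hL Sg.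
Qed.

Lemma cos_edot_continuous (a : 'rV[R]_d) : continuous (fun x => cos (edot a x)).
Proof. by have [] := @cont_ech R d a. Qed.

Lemma sin_edot_continuous (a : 'rV[R]_d) : continuous (fun x => sin (edot a x)).
Proof. by have [_] := @cont_ech R d a. Qed.

Lemma edotBr (a x y : 'rV[R]_d) : edot a (x - y) = edot a x - edot a y.
Proof. by rewrite edotC edotDl edotNl !(edotC _ a). Qed.

(* chi is an autocorrelation, so that its transform is a squared modulus. *)
Lemma positive_kernel : exists (chi : 'rV[R]_d -> R[i]) (L : R), [/\ 0 < L, tbox L chi,
  forall z, 0 <= complex.Re (Ftr chi z) & 0 < complex.Re (Ftr chi 0)].
Proof.
have [h [h1 h2 h3 hL2]] := unit_bump.
have [ch _] := (smooth_realP _).1 h1.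
(* [h] lives in |x| <= 2, so its autocorrelation lives in |l| <= 4. *)
have L0 : 0 < 4 :> R by [].
have hL : cc 4 h.
  by split=> // x x4; apply: hL2; apply: ltW; apply: lt_trans x4; rewrite ltr_nat.
have prod0 m l : 4 < `|l| -> h m * h (m + l) = 0.
  move=> l4; have [m2|m2] := leP 2 `|m|; first by rewrite hL2// mul0r.
  rewrite [h (m + l)]hL2 ?mulr0//.
  have : `|l| <= `|m + l| + `|m|.
    by rewrite -{1}(addKr m l) addrC (le_trans (ler_normB _ _)).
  by move: l4 m2; lra.
have a0 l : 4 < `|l| -> acorr h h l = 0.
  move=> l4; rewrite /acorr (_ : (fun m => _) = fun=> 0) ?int0//.
  by apply/funext => m; exact: prod0.
have Sa := smooth_acorr L0 hL h1.
have tchi : tbox 4 (fun l => (acorr h h l)%:C%C).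
  split; first by apply: smooth_real_complex; exact: SmBase.
  by move=> l l4; rewrite a0.
have Re_eq z : complex.Re (Ftr (fun l => (acorr h h l)%:C%C) z) =
    integral_real (fun m => h m * cos (edot (- z) m)) ^+ 2 +
    integral_real (fun m => h m * sin (edot (- z) m)) ^+ 2.
  set a := - z.
  have cC := cc_mulr hL (@cos_edot_continuous a); have cS := cc_mulr hL (@sin_edot_continuous a).
  set C := integral_real (fun m => h m * cos _); set S := integral_real (fun m => h m * sin _).
  rewrite /Ftr /=.
  transitivity (integral_real (fun l => integral_real (fun m => h m * h (m + l) * cos (edot a l)))).
    congr integral_real; apply/funext => l; rewrite mul0r subr0 -/a /acorr mulrC.
    rewrite -(intZ _ L0 (cc_mulr hL (@shift_continuous _ l ch))).
    by congr integral_real; apply/funext => m; rewrite mulrC.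
  rewrite (int_swap L0); last 3 first.
  - apply: contM; first exact: acorr_joint_continuous.
    move=> p; exact: (@continuous_comp _ _ _ fst (fun x => cos (edot a x)) p cvg_fst (@cos_edot_continuous _ _)).
  - by move=> l m l4; rewrite prod0// mul0r.
  - by move=> l m m4; rewrite hL.2// !mul0r.
  (* Substituting v = m + l and expanding cos (a.(v - m)) separates the variables and leaves C^2 +
     S^2. *)
  transitivity (integral_real (fun m => C * (h m * cos (edot a m)) + S * (h m * sin (edot a m)))).
    congr integral_real; apply/funext => m.
    pose g v := h v * cos (edot a (v - m)).
    have cg : cc 4 g.
      apply: cc_mulr => //; exact: (@shift_continuous _ (- m) (@cos_edot_continuous a)).
    have Eg : integral_real g = cos (edot a m) * C + sin (edot a m) * S.
      rewrite -(intZ _ L0 cS) -(int_lin _ L0 cC); last first.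
        by have := cc_lin (sin (edot a m)) cS (cc0 d 4); under eq_fun do rewrite addr0.
      by congr integral_real; apply/funext => v; rewrite /g edotBr cosB; ring.
    have := int_affine m L0 ltr01 cg; rewrite expr1n invr1 mul1r => E.
    transitivity (h m * integral_real g); last by rewrite Eg; ring.
    have Lm : 0 < 4 + `|m| by rewrite ltr_pwDl.
    have cg1 : cc (4 + `|m|) (fun x => g (1 *: x + m)).
      split.
        have := @shift_continuous _ m cg.1.
        rewrite (_ : (fun x => g (x + m)) = fun x => g (1 *: x + m))//.
        by apply/funext => x; rewrite scale1r.
      move=> x xm; apply: cg.2; rewrite scale1r.
      have : `|x| <= `|x + m| + `|m| by rewrite -{1}(addrK m x) ler_normB.
      by move: xm; lra.
    rewrite -E -(intZ _ Lm cg1); congr integral_real; apply/funext => l.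
    by rewrite /g scale1r addrK [l + m]addrC mulrA.
  have cS' : cc 4 (fun m => S * (h m * sin (edot a m))).
    by have := cc_lin S cS (cc0 d 4); under eq_fun do rewrite addr0.
  by rewrite (int_lin C L0 cC cS') (intZ S L0 cS) !expr2.
exists (fun l => (acorr h h l)%:C%C), 4; split=> //.
  by move=> z; rewrite Re_eq addr_ge0// sqr_ge0.
rewrite Re_eq ltr_pwDl ?sqr_ge0// exprn_gt0//.
apply: (int_gt0 L0).
- exact: (cc_mulr hL (@cos_edot_continuous (- 0))).
- move=> x; rewrite oppr0 edot0l cos0 mulr1.
  by have /andP[] := h2 x.
- by rewrite oppr0 edot0l cos0 mulr1 h3// normr0.
Qed.

End Autocorrelation.

(** * Concentration at a point under dilation *)

Section Concentration.
Context {R : realType} {d : nat}.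
Implicit Types (f w W phi psi : 'rV[R]_d -> R[i]).

Let c_ (n : nat) : R := n.+1%:R^-1.

Lemma ic_affine L a (b : 'rV[R]_d) f : 0 < L -> 0 < a -> ccc L f ->
  integral_complex (fun x => f (a *: x + b)) = (a ^- d)%:C%C * integral_complex f.
Proof.
move=> L0 a0 [f1 f2]; apply: complex_ext; rewrite ?ReM ?ImM /= !mul0r ?subr0 ?addr0.
  exact: (int_affine b L0 a0 f1).
exact: (int_affine b L0 a0 f2).
Qed.

Lemma cont_affine f (a : R) (b : 'rV[R]_d) : cont f -> cont (fun x => f (a *: x + b)).
Proof.
move=> [c1 c2]; suff ca : continuous (fun x : 'rV[R]_d => a *: x + b).
  by split=> x; [exact: (continuous_comp (ca x) (c1 _))|exact: (continuous_comp (ca x) (c2 _))].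
move=> x; apply/cvg_eps => e e0.
have a1 : 0 < `|a| + 1 by rewrite ltr_wpDl.
exists (e / (`|a| + 1)); first by rewrite divr_gt0.
move=> y; rewrite ltr_pdivlMr// => yx.
rewrite opprD addrACA subrr addr0 -scalerBr normrZ.
by apply: le_trans (ltW yx); rewrite mulrC ler_wpM2l// lerDl.
Qed.

Lemma ccc_scale L f n : ccc L f -> ccc (L * n.+1%:R) (fun x => f (c_ n *: x)).
Proof.
move=> /cccP[cf fL]; apply/cccP; split.
  have := cont_affine (c_ n) 0 cf.
  by rewrite (_ : (fun x => f (_ + 0)) = fun x => f (c_ n *: x))//; apply/funext => x; rewrite addr0.
move=> x Lx; apply: fL; rewrite normrZ gtr0_norm ?invr_gt0//.
by rewrite mulrC ltr_pdivlMr.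
Qed.

Lemma prod_coord_le (z : 'rV[R]_d) : \prod_j (1 + z ord0 j ^+ 2) <= (1 + `|z|) ^+ (2 * d).
Proof.
rewrite exprM -[X in _ ^+ X]card_ord -prodr_const.
apply: ler_prod => j _; apply/andP; split; first by rewrite addr_ge0 ?sqr_ge0.
have := coord_le_norm z j; rewrite -[z ord0 j ^+ 2]real_normK ?num_real//.
have := normr_ge0 (z ord0 j); nra.
Qed.

Lemma cauchy_weight_bound W : sschwartz W -> exists2 C : R, 0 <= C &
  forall z, (1 + `|z|) * normc (W z) <= C * \prod_j (1 + z ord0 j ^+ 2)^-1.
Proof.
move=> SW; have [C C0 HC] := sschwartz_bound [::] (2 * d).+1 SW; exists C => // z.
have p1 j : 0 < 1 + z ord0 j ^+ 2 by rewrite ltr_pwDl// sqr_ge0.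
have pp : 0 < \prod_(j < d) (1 + z ord0 j ^+ 2) by rewrite prodr_gt0.
rewrite prodfV ler_pdivlMr//; apply: le_trans (HC z).
rewrite exprS mulrC mulrA [X in _ <= X * _]mulrC ler_wpM2r ?normc_ge0//.
by rewrite ler_wpM2r ?addr_ge0// prod_coord_le.
Qed.

(** Continuity at 0 and boundedness give |w(y)| <= e1 + (M/D) |y|. At y = z/n the linear term is
    O(|z|/n), and the Cauchy weight integrates the factor |z| with a bound that ignores the growing
    box. *)
Lemma concentration L w W : 0 < L -> ccc L w -> w 0 = 0 -> sschwartz W ->
  forall e : R, 0 < e -> exists K : R, forall n,
    normc (integral_complex (fun z => w (c_ n *: z) * W z)) <= e + K * c_ n.
Proof.
move=> L0 wL w0 SW e e0; have [C C0 HC] := cauchy_weight_bound SW.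
have /cccP[[c1 c2] _] := wL.
have [M M0 HM] := ccc_bounded wL.
(* The factor 2 accounts for real and imaginary part; the 1 makes the constant positive. *)
pose C3 := 2 * (C * pi ^+ d) + 1.
have Cpi : 0 <= C * pi ^+ d by rewrite mulr_ge0// exprn_ge0// pi_ge0.
have C30 : 0 < C3 by rewrite ltr_wpDl// mulr_ge0.
pose e1 := e / C3; have e10 : 0 < e1 by rewrite divr_gt0.
have e2 : 0 < e1 / 2 by rewrite divr_gt0.
have [D1 D10 H1] := (cvg_eps _ _).1 (c1 0) _ e2.
have [D2 D20 H2] := (cvg_eps _ _).1 (c2 0) _ e2.
pose D := Num.min D1 D2; have D0 : 0 < D by rewrite lt_min D10.
have wb y : normc (w y) <= e1 + M / D * `|y|.
  have [yD|Dy] := ltP `|y| D.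
    apply: ler_wpDr; first by rewrite !mulr_ge0// invr_ge0 ltW.
    rewrite [leRHS]splitr; apply: le_trans (normc_le _) _; apply: lerD.
      have := H1 y; rewrite subr0 w0 subr0; apply.
      by apply: lt_le_trans yD _; rewrite ge_min lexx.
    have := H2 y; rewrite subr0 w0 subr0; apply.
    by apply: lt_le_trans yD _; rewrite ge_min lexx orbT.
  apply: ler_wpDl; first exact: ltW.
  by apply: le_trans (HM y) _; rewrite -mulrA ler_peMr// mulrC ler_pdivlMr// mul1r.
exists (M / D * C3) => n.
have cn : 0 < c_ n by rewrite invr_gt0.
set B := e1 + M / D * c_ n.
have B0 : 0 <= B by rewrite addr_ge0 ?(ltW e10)// !mulr_ge0// ?invr_ge0 ltW.
have Ln : 0 < L * n.+1%:R by rewrite mulr_gt0.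
have cW : ccc (L * n.+1%:R) (fun z => w (c_ n *: z) * W z).
  by apply: cccMr; [exact: ccc_scale|apply: smooth_cont; case: SW].
apply: le_trans (ic_cauchy (M := B * C) Ln cW _ _) _; first exact: mulr_ge0.
  move=> z; rewrite normcM -[leRHS]mulrA.
  apply: le_trans (_ : B * ((1 + `|z|) * normc (W z)) <= _); last by rewrite ler_wpM2l.
  rewrite mulrA ler_wpM2r ?normc_ge0//; apply: le_trans (wb _) _.
  rewrite normrZ (gtr0_norm cn) /B mulrDl mulrDr mulr1 -addrA lerD2l.
  have : 0 <= e1 * `|z| by rewrite mulr_ge0// ltW.
  have : 0 <= M / D * c_ n by rewrite !mulr_ge0// ?invr_ge0 ltW.
  nra.
apply: le_trans (_ : B * C3 <= _).
  rewrite /C3 mulrDr mulr1 -mulrA mulrCA; apply: ler_wpDr => //.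
by rewrite /B /e1 mulrDl divfK ?gt_eqF// mulrAC.
Qed.

Lemma le_limit (X Y : R) : (forall e, 0 < e -> exists K : R, forall n, (0 < n)%N ->
  X <= Y + e + K * c_ n) -> X <= Y.
Proof.
move=> H; apply/ler_addgt0Pr => e e0.
have e2 : 0 < e / 2 by rewrite divr_gt0.
have [K HK] := H _ e2.
pose n := Num.bound (`|K| / (e / 2)).
have Hn : `|K| / (e / 2) < n%:R by apply: archi_boundP; rewrite mulr_ge0// invr_ge0 ltW.
have n0 : (0 < n)%N by rewrite -(ltr0n R); apply: le_lt_trans Hn; rewrite mulr_ge0// invr_ge0 ltW.
apply: le_trans (HK n n0) _; rewrite -addrA lerD2l [leRHS]splitr lerD2l.
rewrite /c_ ler_pdivrMr//; apply: le_trans (ler_norm _) _.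
move: Hn; rewrite ltr_pdivrMr// => /ltW/le_trans; apply.
by rewrite mulrC ler_wpM2l ?(ltW e2)// ler_nat.
Qed.

Lemma Ftr_modulated L phi n (x0 x : 'rV[R]_d) : 0 < L -> tbox L phi ->
  Ftr (fun l => phi (c_ n *: l) * ech x0 l) x =
  (n.+1%:R ^+ d)%:C%C * Ftr phi (n.+1%:R *: x - n.+1%:R *: x0).
Proof.
move=> L0 tp; have cn : 0 < c_ n by rewrite invr_gt0.
set z := _ *: x - _; have := ic_affine 0 L0 cn (ccc_ech (- z) (tbox_ccc tp)).
rewrite /c_ exprVn invrK => <-; congr integral_complex; apply/funext => l.
rewrite addr0 -mulrA -echDl; congr (_ * _); rewrite /ech; congr expi.
rewrite /z -scalerBr -scalerN edotZl ![edot _ (_ *: l)]edotC edotZl mulrA divff ?mul1r//.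
by rewrite [LHS]edotC opprB.
Qed.

Lemma unull_sbnd (F : nat -> 'rV[R]_d -> R[i]) k :
  (forall s, unull c_ F s k) -> exists2 M, 0 <= M & forall n, sbnd k (F n) (M * c_ n).
Proof.
move=> H; have [||M M0 HM] := @list_bound R d (fun s M => forall n x,
    (1 + `|x|) ^+ k * normc (foldr partial (F n) s x) <= M * c_ n) _ _ k.
- move=> s M M' MM' HM n x; apply: le_trans (HM n x) _.
  by rewrite ler_wpM2r// invr_ge0.
- by move=> s; have [M _ HM] := H s; exists M.
- by exists M => // n s x sk; exact: HM.
Qed.

End Concentration.

Section Evaluation.
Context {R : realType} {d : nat}.
Implicit Types (f phi psi : 'rV[R]_d -> R[i]) (T : ('rV[R]_d -> R[i]) -> R[i]).

Let c_ (n : nat) : R := n.+1%:R^-1.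

Lemma unull_sschwartz (F : nat -> 'rV[R]_d -> R[i]) n : smooth (F n) ->
  (forall s b, unull c_ F s b) -> sschwartz (F n).
Proof.
move=> SF H; apply: sschwartzP => // s b; have [M _ HM] := H s b.
by exists (M * c_ n) => x; exact: HM.
Qed.

Lemma sbnd_pbnd k phi M : sbnd k phi M -> pbnd k phi M.
Proof.
move=> H; apply: lbnd_pbnd => s x sk; apply: le_trans (H s x sk).
by rewrite ler_peMl ?normc_ge0// exprn_ege1// lerDl.
Qed.

(* The test functions chi (l / n) e^(i x0 l) have transforms that concentrate
   at x0, because chi has a transform with nonnegative real part; this
   replaces the Fourier inversion formula. *)
Lemma evaluation_bound : exists2 c : R, 0 <= c & forall f T chi0 L, cont f ->
  strong_tempered T -> represents f T -> 0 < L -> tbox L chi0 ->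
  (forall psi, test_function psi ->
     fourier_dist T psi = fourier_dist T (fun l => chi0 l * psi l)) ->
  forall x0, normc (f x0) <= c * normc (fourier_dist T (fun l => chi0 l * ech x0 l)).
Proof.
have [chi [L1 [L10 tchi W0 W00]]] := @positive_kernel R d.
have [th [th1 th2 th3 th0]] := @unit_bump R d.
pose theta x : R[i] := (th x)%:C%C.
have Sth : smooth theta by apply: smooth_real_complex; exact: SmBase.
have [cth _] := (smooth_realP _).1 th1.
have tth : tbox 2 theta by split=> // x /ltW /th0; rewrite /theta => ->.
set W := Ftr chi in W0 W00 *.
have SW : sschwartz W := sschwartz_Ftr L10 tchi.
have [cW1 cW2] := smooth_cont SW.1.
have ccth : cc 2 th by split=> // x /ltW /th0.
pose a := integral_real (fun z => th z * complex.Re (W z)).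
have a0 : 0 < a.
  apply: (@int_gt0 R d 2 _ _ (cc_mulr ccth cW1)) => //.
    by move=> x; rewrite mulr_ge0//; have /andP[] := th2 x.
  by rewrite th3 ?mul1r// normr0.
pose A n := integral_complex (fun z => theta (c_ n *: z) * W z).
have cA n : ccc (2 * n.+1%:R) (fun z => theta (c_ n *: z) * W z).
  by apply: cccMr; [exact: (ccc_scale n (tbox_ccc tth))|exact: smooth_cont SW.1].
(* For n >= 1 and |z| < 2 the point z/(n+1) is in the unit ball, so theta is 1 there and dominates
   [th z]. As Re W >= 0, the integrals compare in the same way, and [A n] stays away from 0. *)
have aA n : (0 < n)%N -> a <= normc (A n).
  move=> n0; apply: le_trans (normc_Re _); apply: le_trans (ler_norm _).
  have n2 : 2 <= 2 * n.+1%:R :> R by rewrite ler_peMr// ler1n.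
  have L0 : 0 < 2 * n.+1%:R :> R by rewrite mulr_gt0.
  have cc1' : cc (2 * n.+1%:R) (fun z => th z * complex.Re (W z)).
    have [k1 k2] := cc_mulr ccth cW1; split=> // x xn; apply: k2; exact: le_lt_trans xn.
  have [cc2 _] := cA n; apply: (int_le L0 cc1' cc2) => z.
  rewrite ReM [complex.Re (theta _)]/= [complex.Im (theta _)]/= mul0r subr0.
  rewrite ler_wpM2r ?W0//.
  have [z2|z2] := leP 2 `|z|; first by rewrite th0//; have /andP[] := th2 (c_ n *: z).
  rewrite [leRHS]th3; first by have /andP[] := th2 z.
  rewrite normrZ gtr0_norm ?invr_gt0// mulrC ler_pdivrMr// mul1r.
  by apply: le_trans (ltW z2) _; rewrite ler_nat.
have fc0 : 0 < normc (@fourier_cst R d) by rewrite normc_gt0 fourier_cst_neq0.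
(* In the limit f(x0) [A n] equals S(psi n) divided by the Fourier constant, S(psi n) tends to
   chi(0) S(chi0 e_x0), and |[A n]| >= a. The constant depends on the kernel only, so the same one
   serves for [P(d)^n f] for all n. *)
exists ((normc (@fourier_cst R d))^-1 * normc (chi 0) / a).
  by rewrite !mulr_ge0 ?invr_ge0 ?normc_ge0// ltW.
move=> f T chi0 L cf ST fT L0 tchi0 HS x0.
set S := fourier_dist T in HS *; pose G l := chi0 l * ech x0 l.
have tG : tbox L G := tboxMr tchi0 (smooth_ech x0).
pose psi n l := chi (c_ n *: l) * ech x0 l.
have Ln n : 0 < L1 * n.+1%:R by rewrite mulr_gt0.
have tpsi n : tbox (L1 * n.+1%:R) (psi n).
  split; first by apply: smoothM (smooth_ech x0); apply: (@smooth_scale R d chi n); case: tchi.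
  move=> l Ll; rewrite /psi tchi.2 ?mul0r// normrZ gtr0_norm ?invr_gt0//.
  by rewrite mulrC ltr_pdivlMr.
have bchi := tbox_cbounded tchi.
(* Although the supports of [psi n] grow, multiplication by [chi0] brings them back into the box
   [L], where one continuity constant holds for all n. *)
have H1 : exists K, forall n, normc (S (psi n)) <= normc (chi 0) * normc (S G) + K * c_ n.
  have [k Hk] := fourier_dist_bound ST; have [C C0 HC] := Hk L L0.
  have SG := tbox_sschwartz L0 tG.
  have [M M0 HM] := unull_sbnd (fun s => @scaled_null R d chi G s k bchi SG).
  exists (C * M) => n.
  have t1 : tbox L (fun l => (chi (c_ n *: l) - chi 0) * G l).
    exact: (tboxMl tG (smoothD (@smooth_scale R d chi n tchi.1) (smooth_cst _))).
  rewrite (HS (psi n)); last by apply/test_functionP; exists (L1 * n.+1%:R).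
  rewrite (_ : (fun l => _) = fun l => chi 0 * G l + (chi (c_ n *: l) - chi 0) * G l); last first.
    by apply/funext => l; rewrite /psi /G; ring.
  rewrite /S (fourier_distD ST L0 (tboxZ _ tG) t1) (fourier_distZ ST _ L0 tG).
  apply: le_trans (normcD _ _) _; rewrite normcM lerD2l -mulrA.
  apply: (HC _ _ t1); apply: sbnd_pbnd; exact: HM.
have [K1 HK1] := H1.
(* eta splits the transform [F n]: near x0 it is a test function, which [represents] turns into an
   integral against [f]; away from x0 it tends to 0 in the Schwartz seminorms. *)
pose eta x := theta (x - x0).
have Seta : smooth eta.
  have := @smooth_affine R d theta 1 (- x0) Sth.
  by rewrite (_ : (fun x => theta (_ + _)) = eta)//; apply/funext => x; rewrite scale1r.
have Leta : 0 < 2 + `|x0| by rewrite ltr_pwDl.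
have teta : tbox (2 + `|x0|) eta.
  split=> // x Lx; rewrite /eta tth.2//.
  have : `|x| <= `|x - x0| + `|x0| by rewrite -{1}(subrK x0 x) ler_normD.
  by move: Lx; lra.
pose u x := 1 + -1 * eta x.
have bu : cbounded u := cboundedD (cbounded_cst 1) (cboundedZ (-1) (tbox_cbounded teta)).
have u0 x : `|x - x0| < 1 -> u x = 0.
  by move=> /ltW /th3 H; rewrite /u /eta /theta H mulr1 subrr.
pose F n := Ftr (psi n).
have FE n x : F n x = (n.+1%:R ^+ d)%:C%C * W (n.+1%:R *: x - n.+1%:R *: x0).
  exact: (Ftr_modulated n x0 x L10 tchi).
have SF n : sschwartz (F n) := sschwartz_Ftr (Ln n) (tpsi n).
have nF s b : unull c_ (fun n x => u x * F n x) s b.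
  suff -> : (fun n x => u x * F n x) = fun (n : nat) (x : 'rV[R]_d) =>
      (n.+1%:R ^+ d)%:C%C * (u x * W (n.+1%:R *: x - n.+1%:R *: x0)).
    exact: (off_diagonal_null d s b ltr01 bu u0 SW).
  by apply/funext => n; apply/funext => x; rewrite FE mulrCA.
have H2 : exists K, forall n, normc (T (fun x => u x * F n x)) <= K * c_ n.
  have [_ [k [C [C0 HC]]]] := ST.
  have [M M0 HM] := unull_sbnd (fun s => nF s k).
  exists (C * M) => n; rewrite -mulrA; apply: HC (HM n).
  by apply: unull_sschwartz nF; apply: smoothM; [case: bu|case: (SF n)].
have [K2 HK2] := H2.
(* The integrand near x0 after the substitution z = (n+1)(x - x0). *)
pose v n z := f (x0 + c_ n *: z) * (theta (c_ n *: z) * W z).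
have cfx : cont (fun z => f (z + x0)).
  have := cont_affine 1 x0 cf.
  by rewrite (_ : (fun x => f (_ + _)) = fun z => f (z + x0))//; apply/funext => x; rewrite scale1r.
have cv n : ccc (2 * n.+1%:R) (v n).
  apply: cccMl (cA n) _.
  have := cont_affine (c_ n) x0 cf.
  rewrite (_ : (fun x => f (_ + _)) = fun z => f (x0 + c_ n *: z))//.
  by apply/funext => z; rewrite addrC.
have L2n n : 0 < 2 * n.+1%:R :> R by rewrite mulr_gt0.
have TF n : T (F n) = integral_complex (v n) + T (fun x => u x * F n x).
  have tF : tbox (2 + `|x0|) (fun x => eta x * F n x) := tboxMr teta (SF n).1.
  have E : F n = fun x => eta x * F n x + u x * F n x.
    by apply/funext => x; rewrite /u; ring.
  rewrite {1}E (strong_temperedD ST (tbox_sschwartz Leta tF)); last first.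
    by apply: unull_sschwartz nF; apply: smoothM; [case: bu|case: (SF n)].
  congr (_ + _); rewrite fT; last by apply/test_functionP; exists (2 + `|x0|).
  have m0 : 0 < n.+1%:R :> R by [].
  have mn0 : n.+1%:R != 0 :> R by rewrite gt_eqF.
  have := ic_affine (- (n.+1%:R *: x0)) (L2n n) m0 (cv n).
  set I1 := integral_complex _ => E1.
  have cI : ccc (2 + `|x0|) (fun x => v n (n.+1%:R *: x - n.+1%:R *: x0)).
    apply/cccP; split; first by apply: cont_affine; case/cccP: (cv n).
    move=> x Lx; rewrite /v -scalerBr scalerA mulVf// scale1r.
    have := teta.2 x Lx; rewrite /eta => ->.
    by rewrite mul0r mulr0.
  transitivity ((n.+1%:R ^+ d)%:C%C * I1).
    rewrite -(icZ _ Leta cI); congr integral_complex; apply/funext => x.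
    rewrite FE /v -scalerBr scalerA mulVf// scale1r [x0 + _]addrC subrK /eta; ring.
  by rewrite E1 mulrA -rmorphM /= divff ?mul1r// expf_neq0.
(* The error of replacing f(x0 + z/(n+1)) by f(x0); it vanishes at 0, as [concentration]
   requires. *)
pose w y := (f (y + x0) - f x0) * theta y.
have cw : ccc 2 w.
  apply: cccMl (tbox_ccc tth) _; apply: contcD => //; exact: contc_cst.
have w00 : w 0 = 0 by rewrite /w add0r subrr mul0r.
have L2 : 0 < 2 :> R by [].
rewrite [leRHS]mulrAC ler_pdivlMr//.
apply: le_limit => e e0; have [K3 HK3] := concentration L2 cw w00 SW e0.
exists (K3 + (normc (@fourier_cst R d))^-1 * K1 + K2) => n n0.
have cw' : ccc (2 * n.+1%:R) (fun z => w (c_ n *: z) * W z).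
  by apply: cccMr; [exact: (ccc_scale n cw)|exact: smooth_cont SW.1].
have Ev : f x0 * A n = integral_complex (v n) - integral_complex (fun z => w (c_ n *: z) * W z).
  rewrite /A -(icZ _ (L2n n) (cA n)) -(icB (L2n n) (cv n) cw').
  by congr integral_complex; apply/funext => z; rewrite /v /w [x0 + _]addrC; ring.
have ES : integral_complex (v n) = (@fourier_cst R d)^-1 * S (psi n) - T (fun x => u x * F n x).
  rewrite /S (fourier_distE ST (Ln n) (tpsi n)) mulKf ?fourier_cst_neq0// -/(F n) TF.
  by rewrite addrK.
apply: le_trans (_ : normc (f x0 * A n) <= _).
  by rewrite normcM ler_wpM2l ?normc_ge0// aA.
rewrite Ev; apply: le_trans (normcB _ _) _.
apply: le_trans (lerD (lexx _) (HK3 n)) _.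
rewrite ES; apply: le_trans (lerD (normcB _ _) (lexx _)) _.
rewrite normcM normcV.
have h2 := HK2 n.
have h1 := ler_wpM2l (ltW (_ : 0 < (normc (@fourier_cst R d))^-1)) (HK1 n).
apply: le_trans (lerD (lerD (h1 _) h2) (lexx _)) _; first by rewrite invr_gt0.
rewrite -[fun l => chi0 l * _]/G -[n.+1%:R^-1]/(c_ n).
by move: (normc (S G)) (c_ n) => p q; lra.
Qed.

End Evaluation.

(** * Constant coefficient operators *)

Section Operators.
Context {R : realType} {d : nat}.
Implicit Types (f g phi psi : 'rV[R]_d -> R[i]) (L M : R) (s : seq 'I_d).
Implicit Types (P : mpoly.mpoly d R[i]) (m : mpoly.multinom d).

(* The formal transpose of [diffop P].  The derivatives are taken in reverse
   order, which spares the symmetry of second derivatives. *)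
Definition adjop P phi : 'rV[R]_d -> R[i] := fun x =>
  \sum_(m <- mpoly.msupp P)
    mpoly.mcoeff m P * (-1) ^+ size (mseq m) * foldr partial phi (rev (mseq m)) x.

Lemma ic_sum L (I : Type) (r : seq I) (F : I -> 'rV[R]_d -> R[i]) : 0 < L ->
  (forall i, ccc L (F i)) ->
  ccc L (fun x => \sum_(i <- r) F i x) /\
  integral_complex (fun x => \sum_(i <- r) F i x) = \sum_(i <- r) integral_complex (F i).
Proof.
move=> L0 cF; elim: r => [|i r [cr IH]].
  have c0 : ccc L (fun _ : 'rV[R]_d => 0) by apply/cccP; split; [exact: contc_cst|].
  rewrite big_nil (_ : (fun _ => _) = fun=> 0 * (0 : R[i])); last first.
    by apply/funext => x; rewrite big_nil mul0r.
  by split; [exact: cccZ c0|rewrite (icZ _ L0 c0) mul0r].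
rewrite big_cons -IH (_ : (fun _ => _) = fun x => F i x + \sum_(j <- r) F j x).
  by split; [exact: (cccD (cF i) cr)|exact: (icD L0 (cF i) cr)].
by apply/funext => x; rewrite big_cons.
Qed.

Lemma integral_parts L f phi s : 0 < L -> smooth f -> tbox L phi ->
  integral_complex (fun x => foldr partial f s x * phi x) =
  (-1) ^+ size s * integral_complex (fun x => f x * foldr partial phi (rev s) x).
Proof.
move=> L0 Sf; elim: s phi => [|j s IH] phi tp; first by rewrite mul1r.
have Sg := smooth_foldr s Sf; have Sp := tp.1.
rewrite rev_cons foldr_rcons exprS -mulrA -(IH _ (tbox_partial j tp)) mulN1r.
set g := foldr partial f s in Sg *.
have t1 : tbox L (fun x => g x * phi x) := tboxMl tp Sg.
have := ic_partial j L0 t1.1 (tbox_ccc t1); rewrite (partialM j Sg Sp).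
rewrite (icD L0 (tbox_ccc (tboxMl tp (smooth_partial j Sg)))
   (tbox_ccc (tboxMl (tbox_partial j tp) Sg))) => /eqP.
by rewrite addr_eq0 => /eqP.
Qed.

Lemma diffopE P f : diffop P f = fun x =>
  \sum_(m <- mpoly.msupp P) mpoly.mcoeff m P * foldr partial f (mseq m) x.
Proof. by apply/funext => x; apply: eq_bigr => m _; rewrite mpartialE. Qed.

Lemma smooth_diffop P f : smooth f -> smooth (diffop P f).
Proof.
move=> Sf; rewrite diffopE; apply: smooth_sum => m.
exact: smoothZ (smooth_foldr _ Sf).
Qed.

Lemma smooth_adjop P phi : smooth phi -> smooth (adjop P phi).
Proof. by move=> Sf; apply: smooth_sum => m; exact: smoothZ (smooth_foldr _ Sf). Qed.

Lemma tbox_adjop P L phi : tbox L phi -> tbox L (adjop P phi).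
Proof.
move=> tp; split=> [|x Lx]; first by apply: smooth_adjop; case: tp.
rewrite /adjop big1 // => m _; have [_ ->] := tbox_foldr (rev (mseq m)) tp; first exact: mulr0.
by [].
Qed.

Lemma diffop_parts P L f phi : 0 < L -> smooth f -> tbox L phi ->
  integral_complex (fun x => diffop P f x * phi x) =
  integral_complex (fun x => f x * adjop P phi x).
Proof.
move=> L0 Sf tp.
pose F m x := mpoly.mcoeff m P * (foldr partial f (mseq m) x * phi x).
pose G m x := mpoly.mcoeff m P * (-1) ^+ size (mseq m) *
  (f x * foldr partial phi (rev (mseq m)) x).
have tF m : tbox L (fun x => foldr partial f (mseq m) x * phi x).
  exact: (tboxMl tp (smooth_foldr _ Sf)).
have tG m : tbox L (fun x => f x * foldr partial phi (rev (mseq m)) x).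
  exact: (tboxMl (tbox_foldr _ tp) Sf).
rewrite (_ : (fun x => _) = fun x => \sum_(m <- mpoly.msupp P) F m x); last first.
  apply/funext => x; rewrite diffopE mulr_suml; apply: eq_bigr => m _.
  by rewrite /F mulrA.
rewrite (_ : (fun x => f x * _) = fun x => \sum_(m <- mpoly.msupp P) G m x); last first.
  apply/funext => x; rewrite /adjop mulr_sumr; apply: eq_bigr => m _.
  by rewrite /G mulrCA.
rewrite (ic_sum _ L0 (fun m => cccZ _ (tbox_ccc (tF m)))).2.
rewrite (ic_sum _ L0 (fun m => cccZ _ (tbox_ccc (tG m)))).2.
apply: eq_bigr => m _; rewrite (icZ _ L0 (tbox_ccc (tF m))) (icZ _ L0 (tbox_ccc (tG m))).
by rewrite (integral_parts _ L0 Sf tp) mulrA.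
Qed.

Lemma foldr_mulx s phi x :
  foldr mulx phi s x = (\prod_(j <- s) Complex 0 (- x ord0 j)) * phi x.
Proof. by elim: s => [|j s IH]; rewrite ?big_nil ?mul1r // big_cons /= /mulx IH mulrA. Qed.

Lemma symbolE P (l : 'rV[R]_d) : symbol P l =
  \sum_(m <- mpoly.msupp P) mpoly.mcoeff m P * \prod_(j <- mseq m) Complex 0 (l ord0 j).
Proof.
rewrite /symbol mpoly.mevalE; apply: eq_bigr => m _; congr (_ * _).
rewrite big_flatten /= big_map big_enum.
by apply: eq_bigr => j _; rewrite big_nseq iter_mulr_1.
Qed.

Lemma smooth_symbol P : smooth (symbol P : 'rV[R]_d -> R[i]).
Proof.
rewrite (_ : symbol P = fun l => \sum_(m <- mpoly.msupp P) mpoly.mcoeff m P *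
    \prod_(j <- mseq m) (Complex 0 1 * (l ord0 j)%:C%C)).
  apply: smooth_sum => m; apply: smoothZ; elim: (mseq m) => [|j s IH].
    rewrite (_ : (fun _ => _) = fun=> 1); first exact: smooth_cst.
    by apply/funext => l; rewrite big_nil.
  rewrite (_ : (fun _ => _) = fun l : 'rV[R]_d => Complex 0 1 * (l ord0 j)%:C%C *
      \prod_(j <- s) (Complex 0 1 * (l ord0 j)%:C%C)).
    exact: (smoothM (smoothZ _ (smooth_coord j)) IH).
  by apply/funext => l; rewrite big_cons.
apply/funext => l; rewrite symbolE; apply: eq_bigr => m _; congr (_ * _).
apply: eq_bigr => j _.
by apply: complex_ext; rewrite ?ReM ?ImM/=; ring.
Qed.

(** Each derivative of the transform multiplies by - i l_j, and the sign in [adjop] turns this into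
    i l_j. *)
Lemma adjop_Ftr P L psi : 0 < L -> tbox L psi ->
  adjop P (Ftr psi) = Ftr (fun l => symbol P l * psi l).
Proof.
move=> L0 tp; apply/funext => x; rewrite /adjop.
pose F m (l : 'rV[R]_d) := (-1) ^+ size (mseq m) *
  (foldr mulx psi (rev (mseq m)) l * ech (- x) l).
have cF m : ccc L (fun l => foldr mulx psi (rev (mseq m)) l * ech (- x) l).
  apply: ccc_ech; elim: (rev _) => [|j s IH]; first exact: tbox_ccc.
  exact: ccc_mulx.
rewrite [RHS](_ : _ = integral_complex (fun l => \sum_(m <- mpoly.msupp P)
  mpoly.mcoeff m P * F m l)); last congr integral_complex.
  rewrite (ic_sum _ L0 (fun m => cccZ _ (cccZ _ (cF m)))).2; apply: eq_bigr => m _.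
  rewrite (icZ _ L0 (cccZ _ (cF m))) (icZ _ L0 (cF m)) mulrA; congr (_ * _).
  by rewrite -/(Ftr psi) (foldr_partial_Ftr _ L0 (tbox_ccc tp)).
apply/funext => l; rewrite symbolE !mulr_suml; apply: eq_bigr => m _.
rewrite /F foldr_mulx !mulrA; congr (_ * _ * _); rewrite -mulrA; congr (_ * _).
rewrite (perm_big _ (permEl (perm_rev _))) /=.
elim: (mseq m) => [|j s IH]; first by rewrite !big_nil mul1r.
rewrite !big_cons IH /= exprS mulrACA; congr (_ * _).
by apply: complex_ext; rewrite ?ReM ?ImM/=; ring.
Qed.

Lemma iter_adjop_Ftr P n L psi : 0 < L -> tbox L psi ->
  iter n (adjop P) (Ftr psi) = Ftr (fun l => symbol P l ^+ n * psi l).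
Proof.
move=> L0 tp; elim: n => [|n IH].
  by congr Ftr; apply/funext => l; rewrite mul1r.
rewrite iterS IH (adjop_Ftr P L0 (tboxMl tp (smoothX n (smooth_symbol P)))).
by congr Ftr; apply/funext => l; rewrite mulrA exprS.
Qed.

Lemma adjop_linear P a phi psi : smooth phi -> smooth psi ->
  adjop P (fun x => a * phi x + psi x) = fun x => a * adjop P phi x + adjop P psi x.
Proof.
move=> Sp Sq; apply/funext => x; rewrite /adjop mulr_sumr -big_split /=.
apply: eq_bigr => m _.
by rewrite (foldr_partialD _ (smoothZ a Sp) Sq) (foldr_partialZ _ _ Sp); ring.
Qed.

Lemma sbnd_foldr k p s phi M : (size s <= p)%N -> 0 <= M ->
  sbnd (k + p) phi M -> sbnd k (foldr partial phi s) M.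
Proof.
move=> sp M0 H t x tk; rewrite -foldr_cat.
apply: le_trans (H (t ++ s) x _); last by rewrite size_cat leq_add.
rewrite ler_wpM2r ?normc_ge0 // ler_weXn2l ?leq_addr //.
by rewrite lerDl normr_ge0.
Qed.

Lemma sbnd_ge0 k phi M : sbnd k phi M -> 0 <= M.
Proof.
move=> H; apply: le_trans (H [::] 0 _) => //.
by rewrite mulr_ge0 ?normc_ge0 // exprn_ge0 // addr_ge0.
Qed.

Lemma sbndD k f g M M' : smooth f -> smooth g -> sbnd k f M -> sbnd k g M' ->
  sbnd k (fun x => f x + g x) (M + M').
Proof.
move=> Sf Sg Hf Hg s x sk; rewrite (foldr_partialD _ Sf Sg).
apply: le_trans (lerD (Hf s x sk) (Hg s x sk)); rewrite -mulrDr.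
by rewrite ler_wpM2l ?normcD // exprn_ge0 // addr_ge0.
Qed.

Lemma sbnd_adjop P k : exists p C, 0 <= C /\ forall phi M, smooth phi -> sbnd (k + p) phi M ->
  sbnd k (adjop P phi) (C * M).
Proof.
(* The sum of the degrees is at least each of them, and it splits along the induction over the
   monomials. *)
exists (\sum_(m <- mpoly.msupp P) size (mseq m))%N.
exists (\sum_(m <- mpoly.msupp P) normc (mpoly.mcoeff m P * (-1) ^+ size (mseq m))).
split=> [|phi M Sf Hf]; first by apply: sumr_ge0 => m _; exact: normc_ge0.
have M0 := sbnd_ge0 Hf; rewrite mulr_suml /adjop.
suff H r p : (\sum_(m <- r) size (mseq m) <= p)%N -> sbnd (k + p) phi M ->
  sbnd k (fun x => \sum_(m <- r) mpoly.mcoeff m P * (-1) ^+ size (mseq m) *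
    foldr partial phi (rev (mseq m)) x)
  (\sum_(m <- r) normc (mpoly.mcoeff m P * (-1) ^+ size (mseq m)) * M).
  exact: H (leqnn _) Hf.
elim: r => [_ _|m r IH].
  rewrite big_nil (_ : (fun _ => _) = fun=> 0); last by apply/funext => x; rewrite big_nil.
  move=> s x _; suff -> : foldr partial (fun=> 0 : R[i]) s x = 0 by rewrite normc0 mulr0.
  by elim: s x => //= j s IH x; rewrite (_ : foldr _ _ s = fun=> 0) ?partial_cst //; apply/funext.
rewrite big_cons => rp Hp.
rewrite big_cons (_ : (fun _ => _) = fun x => mpoly.mcoeff m P * (-1) ^+ size (mseq m) *
    foldr partial phi (rev (mseq m)) x + \sum_(m <- r) mpoly.mcoeff m P * (-1) ^+ size (mseq m) *
    foldr partial phi (rev (mseq m)) x); last by apply/funext => x; rewrite big_cons.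
have S1 := smooth_foldr (rev (mseq m)) Sf.
apply: (sbndD (smoothZ _ S1)).
- by apply: smooth_sum => n; exact: smoothZ (smooth_foldr _ Sf).
- apply: sbndZ S1 _; apply: sbnd_foldr M0 Hp; rewrite size_rev.
  exact: leq_trans (leq_addr _ _) rp.
- by apply: IH Hp; exact: leq_trans (leq_addl _ _) rp.
Qed.

Lemma sschwartz_adjop P phi : sschwartz phi -> sschwartz (adjop P phi).
Proof.
move=> [Sf Hf]; split=> [|k]; first exact: smooth_adjop.
have [p [C [_ HC]]] := sbnd_adjop P k; have [M HM] := Hf (k + p)%N.
by exists (C * M); exact: HC.
Qed.

Section Transpose.
Variable P : mpoly.mpoly d R[i].
Implicit Types T : ('rV[R]_d -> R[i]) -> R[i].

Lemma strong_tempered_adjop T : strong_tempered T ->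
  strong_tempered (fun phi => T (adjop P phi)).
Proof.
move=> [lT [k [C [C0 HC]]]]; split=> [a phi psi Sf Sg|].
  by rewrite (adjop_linear _ _ Sf.1 Sg.1) lT //; exact: sschwartz_adjop.
have [p [C' [C'0 HC']]] := sbnd_adjop P k.
exists (k + p)%N, (C * C'); split=> [|phi M Sf Hf]; first exact: mulr_ge0.
rewrite -mulrA; apply: HC; first exact: sschwartz_adjop.
by apply: HC' Hf; case: Sf.
Qed.

(** The distribution [P(d)^n T]; the signs are already in [adjop]. *)
Definition transpose_iter n T phi := T (iter n (adjop P) phi).

Lemma transpose_iterS n T phi :
  transpose_iter n.+1 T phi = transpose_iter n T (adjop P phi).
Proof. by rewrite /transpose_iter iterSr. Qed.

Lemma strong_tempered_iter T n : strong_tempered T -> strong_tempered (transpose_iter n T).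
Proof.
move=> ST; elim: n => [|n IH] //.
have := strong_tempered_adjop IH; congr strong_tempered.
by apply/funext => phi; rewrite transpose_iterS.
Qed.

Lemma smooth_iter f n : smooth f -> smooth (iter n (diffop P) f).
Proof. by move=> Sf; elim: n => [|n IH]; [exact: Sf|exact: (smooth_diffop P IH)]. Qed.

Lemma represents_iter f T n : smooth f -> represents f T ->
  represents (iter n (diffop P) f) (transpose_iter n T).
Proof.
move=> Sf fT; elim: n => [|n IH] // phi /test_functionP[L L0 tp].
have ta := tbox_adjop P tp; rewrite transpose_iterS IH; last by apply/test_functionP; exists L.
by rewrite iterS (diffop_parts P L0 (smooth_iter n Sf) tp).
Qed.

Lemma fourier_iter T n L psi : strong_tempered T -> 0 < L -> tbox L psi ->
  fourier_dist (transpose_iter n T) psi = fourier_dist T (fun l => symbol P l ^+ n * psi l).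
Proof.
move=> ST L0 tp; rewrite (fourier_distE (strong_tempered_iter n ST) L0 tp).
rewrite (fourier_distE ST L0 (tboxMl tp (smoothX n (smooth_symbol P)))).
by rewrite /transpose_iter (iter_adjop_Ftr P n L0 tp).
Qed.

End Transpose.

End Operators.

(** * Derivatives of high powers *)

Section PowerGrowth.
Context {R : realType} {d : nat}.
Implicit Types (f g h Q : 'rV[R]_d -> R[i]) (A : set 'rV[R]_d).

Lemma partial_vanish A h j : closed A -> (forall l, ~ A l -> h l = 0) ->
  forall l, ~ A l -> partial j h l = 0.
Proof.
move=> cA hA l Al; apply: partial_near0.
have : nbhs l (~` A) by apply: open_nbhs_nbhs; split; [exact: closed_openC|].
by apply: filterS => y; exact: hA.
Qed.

Lemma partial_power Q n j : smooth Q -> partial j (fun l => Q l ^+ n) =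
  fun l => n%:R * (Q l ^+ n.-1 * partial j Q l).
Proof.
move=> SQ; case: n => [|n]; last exact: partialX.
rewrite (_ : (fun l => _ ^+ 0) = fun=> 1) ?partial_cst; last by apply/funext => l.
by apply/funext => l; rewrite mul0r.
Qed.

(** Used for the symbol with rho = r and for its inverse with rho = 1/R1. The first derivative taken
    yields three terms of the same shape, with [h] replaced by [partial j Q * h], kept, or replaced
    by [partial j h]; hence the induction over all [h]. The term from [Q ^+ n] costs a factor n and
    one power of rho, the term from [ech x] a factor |x|. *)
Lemma power_growth Q A (rho : R) : smooth Q -> closed A -> 0 < rho ->
  (forall l, A l -> normc (Q l) <= rho) ->
  forall k L h, tbox L h -> (forall l, ~ A l -> h l = 0) ->
  exists2 C, 0 <= C & forall n x s l, (size s <= k)%N ->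
    normc (foldr partial (fun l => Q l ^+ n * (h l * ech x l)) s l)
      <= C * (n.+1%:R ^+ k * rho ^+ n * (1 + `|x|) ^+ k).
Proof.
move=> SQ cA rho0 HQ; elim=> [|k IH] L h th hA.
  have [M M0 HM] := tbox_bounded th.
  exists M => // n x s l; rewrite leqn0 size_eq0 => /eqP -> /=.
  rewrite !expr0 mulr1 mul1r !normcM normcX normc_ech mulr1.
  have [Al|Al] := pselect (A l); last by rewrite (hA _ Al) normc0 mulr0 mulr_ge0 // exprn_ge0 // ltW.
  rewrite mulrC ler_pM ?normc_ge0 ?exprn_ge0 ?normc_ge0 //.
  by rewrite lerXn2r ?nnegrE ?normc_ge0 ?(ltW rho0) // HQ.
pose B n (x : 'rV[R]_d) k : R := n.+1%:R ^+ k * rho ^+ n * (1 + `|x|) ^+ k.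
have B0 n x i : 0 <= B n x i by rewrite !mulr_ge0 ?exprn_ge0 ?ltW // addr_ge0.
have BS n x i : B n x i.+1 = (n.+1%:R * (1 + `|x|)) * B n x i.
  by rewrite /B !exprS; ring.
have n1 n : 1 <= n.+1%:R :> R by rewrite ler1n.
have x1 (x : 'rV[R]_d) : 1 <= 1 + `|x| by rewrite lerDl.
have [C C0 HC] := IH L h th hA.
have t1 j : tbox L (fun l => partial j Q l * h l) := tboxMl th (smooth_partial j SQ).
have t2 j := tbox_partial j th.
have /choice[C1 HC1] : forall j, exists c, 0 <= c /\ forall n x s l, (size s <= k)%N ->
      normc (foldr partial (fun l => Q l ^+ n * (partial j Q l * h l * ech x l)) s l) <= c * B n x k.
  move=> j; have [|c c0 Hc] := IH L _ (t1 j); last by exists c.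
  by move=> l Al; rewrite hA // mulr0.
have /choice[C2 HC2] : forall j, exists c, 0 <= c /\ forall n x s l, (size s <= k)%N ->
      normc (foldr partial (fun l => Q l ^+ n * (partial j h l * ech x l)) s l) <= c * B n x k.
  move=> j; have [|c c0 Hc] := IH L _ (t2 j); last by exists c.
  exact: partial_vanish.
have sum_le (F : 'I_d -> R) j : (forall i, 0 <= F i) -> F j <= \sum_i F i.
  by move=> F0; rewrite (bigD1 j) //= lerDl sumr_ge0.
have S10 : 0 <= \sum_j C1 j by apply: sumr_ge0 => j _; case: (HC1 j).
have S20 : 0 <= \sum_j C2 j by apply: sumr_ge0 => j _; case: (HC2 j).
exists (C + (rho^-1 * \sum_j C1 j + \sum_j C2 j)).
  by rewrite !addr_ge0 // mulr_ge0 // invr_ge0 ltW.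
move=> n x s l; case/lastP: s => [_|s j].
  apply: le_trans (HC n x [::] l _) _ => //; rewrite -/(B n x k) -/(B n x k.+1).
  apply: ler_pM => //; first by rewrite lerDl addr_ge0 // mulr_ge0 // invr_ge0 ltW.
  by rewrite BS ler_peMl // mulr_ege1.
rewrite size_rcons ltnS => sk; rewrite foldr_rcons -/(B n x k.+1).
have Sh := th.1; have Se := smooth_ech x; have She := smoothM Sh Se.
have SQn i := smoothX i SQ.
have -> : partial j (fun l => Q l ^+ n * (h l * ech x l)) =
  fun l => n%:R * (Q l ^+ n.-1 * (partial j Q l * h l * ech x l)) +
    (Complex 0 (x ord0 j) * (Q l ^+ n * (h l * ech x l)) + Q l ^+ n * (partial j h l * ech x l)).
  rewrite (partialM j (SQn n) She) (partialM j Sh Se) (partial_power n j SQ) partial_ech.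
  by apply/funext => m; ring.
have Sa : smooth (fun l => Q l ^+ n.-1 * (partial j Q l * h l * ech x l)).
  exact: (smoothM (SQn _) (smoothM (t1 j).1 Se)).
have Sb : smooth (fun l => Q l ^+ n * (h l * ech x l)) := smoothM (SQn n) She.
have Sc : smooth (fun l => Q l ^+ n * (partial j h l * ech x l)).
  exact: (smoothM (SQn _) (smoothM (t2 j).1 Se)).
rewrite (foldr_partialD s (smoothZ _ Sa) (smoothD (smoothZ _ Sb) Sc)).
rewrite (foldr_partialD s (smoothZ _ Sb) Sc) !foldr_partialZ //.
apply: le_trans (normcD _ _) _; apply: le_trans (lerD (lexx _) (normcD _ _)) _.
rewrite !normcM normc_nat.
have lB i : B n x i <= B n x i.+1 by rewrite BS ler_peMl // mulr_ege1.
have xj : normc (Complex 0 (x ord0 j)) <= 1 + `|x|.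
  apply: le_trans (normc_le _) _; rewrite /= normr0 add0r.
  by apply: le_trans (coord_le_norm _ _) _; rewrite lerDr.
rewrite mulrDl mulrDl addrCA; apply: lerD; last apply: lerD.
- rewrite BS mulrCA; apply: ler_pM; rewrite ?normc_ge0 ?HC //.
  by apply: le_trans xj _; rewrite ler_peMl // addr_ge0.
- have [C10 H1] := HC1 j.
  apply: le_trans (ler_wpM2l (ler0n _ n) (H1 n.-1 x s l sk)) _.
  rewrite mulrCA [leRHS](_ : _ = (\sum_j C1 j) * (rho^-1 * B n x k.+1)); last by ring.
  apply: ler_pM => //; first by rewrite mulr_ge0.
    by apply: sum_le => i; case: (HC1 i).
  (* For n = 0 the default [n.-1 = 0] is harmless, as the coefficient n is 0. *)
  case: n {H1 lB Sa Sb Sc SQn} => [|n /=]; first by rewrite mul0r mulr_ge0 // invr_ge0 ltW.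
  rewrite [leRHS](_ : _ = n.+2%:R * (1 + `|x|) * (n.+2%:R ^+ k * rho ^+ n * (1 + `|x|) ^+ k)).
    apply: ler_pM => //; first by apply: le_trans (_ : n.+2%:R <= _); rewrite ?ler_nat // ler_peMr.
    rewrite /B ler_wpM2r ?exprn_ge0 ?addr_ge0 // ler_wpM2r ?exprn_ge0 ?(ltW rho0) //.
    by rewrite lerXn2r ?nnegrE ?ler_nat.
  by rewrite /B !exprS; field; rewrite gt_eqF.
have [C20 H2] := HC2 j; apply: le_trans (H2 n x s l sk) _.
by apply: ler_pM => //; apply: sum_le => i; case: (HC2 i).
Qed.

End PowerGrowth.

(** * Support and growth *)

Section GeometricDecay.
Context {R : realType}.

Lemma poly_geometric (p : nat) (q : R) : 0 <= q < 1 ->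
  exists2 B : R, 0 <= B & forall n : nat, n.+1%:R ^+ p * q ^+ n <= B.
Proof.
elim: p q => [|p IH] q /andP[q0 q1].
  by exists 1 => // n; rewrite mul1r exprn_ile1 // ltW.
pose s := Num.sqrt q.
have s0 : 0 <= s by exact: sqrtr_ge0.
have s1 : s < 1 by rewrite -sqrtr1 ltr_sqrt.
have [B B0 HB] := IH s (introT andP (conj s0 s1)).
have ds : 0 < 1 - s by rewrite subr_gt0.
(* With s the root of q, one half of q^n = s^n s^n absorbs one factor n + 1: since s <= 1, (n+1) s^n
   is at most the geometric sum (1 - s^(n+1))/(1 - s). *)
have H n : (1 - s) * (n.+1%:R * s ^+ n) + s ^+ n.+1 <= 1.
  elim: n => [|n IHn]; first by rewrite expr0 expr1 !mulr1 subrK.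
  rewrite (_ : _ + _ = s * ((1 - s) * (n.+1%:R * s ^+ n) + s ^+ n.+1) + (1 - s) * s ^+ n.+1).
    rewrite -[leRHS](subrK s) addrC lerD //.
      by rewrite ler_piMr ?(ltW ds) // exprn_ile1 // ltW.
    by rewrite ler_piMr.
  by rewrite !exprS -[n.+2%:R]natr1; ring.
exists (B / (1 - s)); first by rewrite divr_ge0 // ltW.
move=> n; rewrite (_ : q ^+ n = s ^+ n * s ^+ n); last by rewrite -exprMn -expr2 sqr_sqrtr.
rewrite exprSr mulrACA; apply: ler_pM; rewrite ?mulr_ge0 ?exprn_ge0 //.
rewrite -[leRHS]mul1r ler_pdivlMr // mulrC; apply: le_trans (H n).
by rewrite lerDl exprn_ge0.
Qed.

Lemma geometric_squeeze (a K q : R) (p : nat) : 0 <= q < 1 -> 0 <= K ->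
  (forall n : nat, (0 < n)%N -> a <= K * (n.+1%:R ^+ p * q ^+ n)) -> a <= 0.
Proof.
(* One power more than needed turns boundedness into O(1/n). *)
move=> Hq K0 H; have [B B0 HB] := poly_geometric p.+1 Hq.
apply: le_limit => e e0; exists (K * B) => n n0; apply: le_trans (H n n0) _.
rewrite add0r -mulrA; apply: ler_wpDl (ltW e0) _; rewrite ler_wpM2l // ler_pdivlMr //.
by rewrite mulrAC -exprSr.
Qed.

End GeometricDecay.

Section SupportGrowth.
Context {R : realType} {d : nat}.
Implicit Types (f phi psi : 'rV[R]_d -> R[i]) (T : ('rV[R]_d -> R[i]) -> R[i]).
Implicit Types (P : mpoly.mpoly d R[i]) (r C : R).

Lemma cont_normc f : cont f -> continuous (fun x => normc (f x)).
Proof.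
move=> [c1 c2]; rewrite (_ : (fun x => _) = fun x =>
    Num.sqrt (complex.Re (f x) * complex.Re (f x) + complex.Im (f x) * complex.Im (f x))).
  move=> x; exact: (continuous_comp ((contD (contM c1 c1) (contM c2 c2)) x) (@sqrt_continuous R _)).
by apply/funext => x; case: (f x).
Qed.

Lemma normc_symbol_continuous P : continuous (fun l : 'rV[R]_d => normc (symbol P l)).
Proof. exact: cont_normc (smooth_cont (smooth_symbol P)). Qed.

Lemma open_symbol_lt P r : open [set l : 'rV[R]_d | normc (symbol P l) < r].
Proof. by apply: open_comp (@open_lt _ r) => l _; exact: normc_symbol_continuous. Qed.

Lemma open_symbol_gt P r : open [set l : 'rV[R]_d | r < normc (symbol P l)].
Proof. by apply: open_comp (@open_gt _ r) => l _; exact: normc_symbol_continuous. Qed.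

(** The seminorm that controls [T] enters only the error of the cut-off, which vanishes in the
    limit; the final bound sees the growth of [f] and the decay of [G] alone. It can therefore be
    applied to [P(d)^n T], whose own seminorms depend on n. The decay N + 2 d pays for the growth of
    [f] and for the Cauchy weights. *)
Lemma represents_bound T f G N A M : cont f -> strong_tempered T -> represents f T ->
  0 <= A -> (forall x, normc (f x) <= A * (1 + `|x|) ^+ N) -> sschwartz G ->
  (forall x, (1 + `|x|) ^+ (N + 2 * d) * normc (G x) <= M) ->
  normc (T G) <= 2 * (A * M * pi ^+ d).
Proof.
move=> cf ST fT A0 HA SG HM.
have [th [th1 th2 th3 th0]] := @unit_bump R d.
(* [represents] only speaks of test functions, so G is cut off by theta (x / n). *)
pose theta x : R[i] := (th x)%:C%C.
have Sth : smooth theta by apply: smooth_real_complex; exact: SmBase.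
have tth : tbox 2 theta by split=> // x /ltW /th0; rewrite /theta => ->.
have theta0 : theta 0 = 1 by rewrite /theta th3 // normr0.
have M0 : 0 <= M.
  by apply: le_trans (HM 0); rewrite mulr_ge0 ?normc_ge0 // exprn_ge0 // addr_ge0.
have [_ [k [C [C0 HC]]]] := ST.
have bth := tbox_cbounded tth.
have nF s b := @scaled_null R d theta G s b bth SG.
have [M' M'0 HM'] := unull_sbnd (fun s => nF s k).
apply: le_limit => e e0; exists (C * M') => n n0.
pose c_ (n : nat) : R := n.+1%:R^-1.
have Sn := @smooth_scale R d theta n Sth.
have tn : tbox (2 * n.+1%:R) (fun x => theta (c_ n *: x) * G x).
  split=> [|x Lx]; first exact: (smoothM Sn SG.1).
  rewrite tth.2 ?mul0r // normrZ gtr0_norm ?invr_gt0 //.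
  by rewrite mulrC ltr_pdivlMr.
have Ln : 0 < 2 * n.+1%:R :> R by rewrite mulr_gt0.
have sn : sschwartz (fun x => (theta (c_ n *: x) - theta 0) * G x).
  apply: (unull_sschwartz _ nF).
  exact: (smoothM (smoothD Sn (smooth_cst _)) SG.1).
have -> : T G = T (fun x => theta (c_ n *: x) * G x) -
    T (fun x => (theta (c_ n *: x) - theta 0) * G x).
  rewrite -[LHS](addrK (T (fun x => (theta (c_ n *: x) - theta 0) * G x))).
  rewrite -(strong_temperedD ST SG sn); congr (T _ - _).
  by apply/funext => x; rewrite theta0; ring.
apply: le_trans (normcB _ _) _; apply: lerD; last first.
  by rewrite -mulrA; apply: HC sn _; exact: HM'.
apply: ler_wpDr (ltW e0) _.
rewrite fT; last by apply/test_functionP; exists (2 * n.+1%:R).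
apply: (ic_cauchy Ln (cccMl (tbox_ccc tn) cf)); first exact: mulr_ge0.
move=> x; have p0 : 0 < \prod_(j < d) (1 + x ord0 j ^+ 2).
  by rewrite prodr_gt0 // => j _; rewrite ltr_pwDl // sqr_ge0.
rewrite prodfV ler_pdivlMr // !normcM normc_real.
have x1 i : 0 <= (1 + `|x|) ^+ i by rewrite exprn_ge0 // addr_ge0.
have thn : `|th (c_ n *: x)| <= 1 by have /andP[? ?] := th2 (c_ n *: x); rewrite ger0_norm.
apply: le_trans (_ : A * (1 + `|x|) ^+ N * normc (G x) * (1 + `|x|) ^+ (2 * d) <= _).
  apply: ler_pM; rewrite ?mulr_ge0 ?normc_ge0 ?(ltW p0) ?prod_coord_le //.
  by rewrite ler_pM ?mulr_ge0 ?normc_ge0 // ler_piMl ?normc_ge0.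
rewrite -!mulrA ler_wpM2l // (_ : _ * _ = (1 + `|x|) ^+ (N + 2 * d) * normc (G x)) ?HM //.
by rewrite exprD; ring.
Qed.

Lemma growth_le_spectral T f P (R0 : R) N r : smooth f -> strong_tempered T -> represents f T ->
  compact (sublevel P R0) -> dist_support (fourier_dist T) `<=` sublevel P R0 ->
  order_at_most (fourier_dist T) N -> 0 <= R0 -> R0 < r ->
  exists C : R, 0 <= C /\ growth_bound P f r C N.
Proof.
move=> Sf ST fT cK supT oN R00 R0r; set S := fourier_dist T in supT oN *.
have r0 : 0 < r := le_lt_trans R00 R0r.
pose U := [set l : 'rV[R]_d | normc (symbol P l) < r].
have oU : open U by exact: open_symbol_lt.
have KU : sublevel P R0 `<=` U by move=> l /= /le_lt_trans; apply.
have [chi [bchi [V oV [KV chi1]]]] := cutoff cK oU KU.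
pose chi0 l : R[i] := (chi l)%:C%C; have Schi := smooth_bump bchi.
have [_ _ chiU [L L0 chiL]] := bchi.
have tchi : tbox L chi0 by split=> // l Ll; rewrite /chi0 chiL.
have Schi' : smooth (fun l => 1 + -1 * chi0 l) := smoothD (smooth_cst 1) (smoothZ (-1) Schi).
(* (1 - chi0) psi vanishes on the open set [V], so its closed support misses the sublevel set and
   with it the support of [S]. *)
have HS psi : test_function psi -> S psi = S (fun l => chi0 l * psi l).
  move=> /test_functionP[L' L'0 tpsi].
  have t1 : tbox L' (fun l => chi0 l * psi l) := tboxMl tpsi Schi.
  have t2 : tbox L' (fun l => (1 + -1 * chi0 l) * psi l) := tboxMl tpsi Schi'.
  rewrite {1}(_ : psi = fun l => chi0 l * psi l + (1 + -1 * chi0 l) * psi l); last first.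
    by apply/funext => l; ring.
  rewrite /S (fourier_distD ST L'0 t1 t2) [X in _ + X](fourier_dist_vanish ST).
  - by rewrite addr0.
  - by apply/test_functionP; exists L'.
  - move=> l pl /supT /KV Vl.
    have [y [/= /eqP py Vy]] := pl V (open_nbhs_nbhs (conj oV Vl)).
    by apply: py; rewrite /chi0 chi1 // mulr1 subrr mul0r.
(* Multiplication by powers of the symbol commutes with the cut-off, so one box and one order
   constant serve for all n. *)
have HSn n psi : test_function psi -> fourier_dist (transpose_iter P n T) psi =
    fourier_dist (transpose_iter P n T) (fun l => chi0 l * psi l).
  move=> /test_functionP[L' L'0 tpsi].
  have t0 : tbox L' (fun l => symbol P l ^+ n * psi l).
    exact: (tboxMl tpsi (smoothX n (smooth_symbol P))).
  rewrite (fourier_iter P n ST L'0 tpsi) (fourier_iter P n ST L'0 (tboxMl tpsi Schi)).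
  rewrite -/S HS; last by apply/test_functionP; exists L'.
  by congr S; apply/funext => l; rewrite mulrCA.
have [c c0 Hc] := @evaluation_bound R d.
have [C1 C10 HC1] := order_bound oN L0.
pose A := closure [set l | chi l != 0]; have cA : closed A by exact: closed_closure.
have chiA l : ~ A l -> chi0 l = 0.
  by move=> Al; rewrite /chi0; have [->//|nz] := eqVneq (chi l) 0; case: Al; exact: subset_closure.
have [C2 C20 HC2] := power_growth (smooth_symbol P) cA r0
  (fun l Al => ltW (chiU l Al)) N tchi chiA.
(* The factor 2^N comes from n + 1 <= 2 n, where n >= 1 is used. *)
exists (c * (C1 * (C2 * 2 ^+ N))); split=> [|n x n0]; first by rewrite !mulr_ge0 // exprn_ge0.
have STn := strong_tempered_iter P n ST.
apply: le_trans (Hc _ _ _ _ (smooth_cont (smooth_iter P n Sf)) STn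
  (represents_iter P n Sf fT) L0 tchi (HSn n) x) _.
have tG : tbox L (fun l => chi0 l * ech x l) := tboxMr tchi (smooth_ech x).
rewrite (fourier_iter P n ST L0 tG) -/S.
rewrite -!mulrA ler_wpM2l //.
apply: le_trans (HC1 _ _ (tboxMl tG (smoothX n (smooth_symbol P))) (fun s l sN => HC2 n x s l sN)) _.
rewrite ler_wpM2l // ler_wpM2l // [leRHS](_ : _ = 2 ^+ N * n%:R ^+ N * r ^+ n * (1 + enorm x) ^+ N).
  apply: ler_pM; rewrite ?mulr_ge0 ?exprn_ge0 ?addr_ge0 ?(ltW r0) //.
    rewrite ler_wpM2r ?exprn_ge0 ?(ltW r0) // -exprMn lerXn2r ?nnegrE ?mulr_ge0 //.
    by rewrite -natrM ler_nat mul2n -addnn -add1n leq_add2r.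
  by rewrite lerXn2r ?nnegrE ?addr_ge0 ?lerD2l ?norm_le_enorm // sqrtr_ge0.
by rewrite -!mulrA.
Qed.

End SupportGrowth.

(** * From growth to the support *)

Section GrowthSupport.
Context {R : realType} {d : nat}.
Implicit Types (f phi psi : 'rV[R]_d -> R[i]) (T : ('rV[R]_d -> R[i]) -> R[i]).
Implicit Types (P : mpoly.mpoly d R[i]) (r C : R).

Lemma symbol_inverse P (K : set 'rV[R]_d) (R1 : R) : 0 < R1 -> compact K ->
  (forall l, K l -> R1 < normc (symbol P l)) ->
  exists2 Q : 'rV[R]_d -> R[i], smooth Q &
    forall l, K l -> symbol P l * Q l = 1 /\ normc (Q l) <= R1^-1.
Proof.
move=> R10 cK KU; pose U := [set l : 'rV[R]_d | R1 < normc (symbol P l)].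
have oU : open U by exact: open_symbol_gt.
have [chi [[Schi chi01 chiU _] [V oV [KV chi1]]]] := cutoff cK oU KU.
have SP := smooth_symbol P.
pose a (l : 'rV[R]_d) := complex.Re (symbol P l); pose b (l : 'rV[R]_d) := complex.Im (symbol P l).
pose D l := a l * a l + b l * b l + (1 + -1 * chi l).
have D0 l : D l != 0.
  rewrite gt_eqF //; have /andP[c0 c1] := chi01 l.
  have [z|nz] := eqVneq (chi l) 0.
    by rewrite /D z mulr0 addr0 ltr_wpDl // addr_ge0 // -expr2 sqr_ge0.
  have : U l by apply: chiU; exact: subset_closure.
  rewrite /U /= => /(lt_trans R10) n0; rewrite /D -!expr2 -sqr_normc mulN1r.
  by rewrite ltr_pwDl ?exprn_gt0 // subr_ge0.
have SD : smooth_expr D.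
  by apply: SmAdd; [apply: SmAdd; apply: SmMul|apply: SmAdd; [exact: SmCst|
    apply: SmMul; [exact: SmCst|exact: SmBase]]]; (exact: smoothRe || exact: smoothIm).
(* conj P / (|P|^2 + 1 - chi), where chi = 1 on K and R1 < |P| on the support of chi. *)
pose Q l := Complex (a l * (D l)^-1) (-1 * b l * (D l)^-1).
exists Q.
  apply: smoothP; first by apply: SmMul (SmInv SD D0); exact: smoothRe.
  apply: SmMul (SmInv SD D0); apply: SmMul (SmCst _) _; exact: smoothIm.
move=> l Kl; have PQ : symbol P l * Q l = 1.
  have DE : D l = a l * a l + b l * b l by rewrite /D chi1 ?mulr1 ?subrr ?addr0 //; exact: KV.
  have nD := D0 l.
  apply: complex_ext; rewrite ?ReM ?ImM /= -/(a l) -/(b l); last by ring.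
  by transitivity ((a l * a l + b l * b l) / D l); [ring|rewrite -DE divff].
split=> //; have := congr1 (@normc R) PQ; rewrite normcM normc1 => E.
have n0 : 0 < normc (symbol P l) := lt_trans R10 (KU l Kl).
have -> : normc (Q l) = (normc (symbol P l))^-1.
  by apply: (mulfI (lt0r_neq0 n0)); rewrite E divff // gt_eqF.
by rewrite lef_pV2 ?posrE // ltW // KU.
Qed.

(** The value at phi is written, for every n, with the growth r^n of [P(d)^n f] against the decay
    R1^(-n) of Q^n; the polynomial factors in n cannot save it from being 0. *)
Lemma fourier_dist_growth T f P r (R1 : R) C N phi : smooth f -> strong_tempered T ->
  represents f T -> 0 <= r -> r < R1 -> 0 <= C -> growth_bound P f r C N ->
  test_function phi -> (forall l, fsupport phi l -> R1 < normc (symbol P l)) ->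
  fourier_dist T phi = 0.
Proof.
move=> Sf ST fT r0 rR C0 gf tf supp.
have R10 : 0 < R1 := le_lt_trans r0 rR.
have [Q SQ HQ] := symbol_inverse R10 tf.2 supp.
have /test_functionP[L L0 tp] := tf.
have cA : closed (fsupport phi) by exact: closed_closure.
have phiA l : ~ fsupport phi l -> phi l = 0.
  by move=> Al; have [//|nz] := eqVneq (phi l) 0; case: Al; exact: subset_closure.
(* The decay that [represents_bound] asks for. *)
pose k := (N + 2 * d)%N.
have iR : 0 < R1^-1 by rewrite invr_gt0.
have [C1 C10 HC1] := power_growth SQ cA iR (fun l Al => (HQ l Al).2) k tp phiA.
have [C2 C20 HC2] := @sbnd_Ftr R d k L L0.
pose psi n l := Q l ^+ n * phi l.
have tpsi n : tbox L (psi n) := tboxMl tp (smoothX n SQ).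
have psib n : pbnd k (psi n) (C1 * (n.+1%:R ^+ k * R1^-1 ^+ n)).
  (* At x = 0 the exponential in [power_growth] is 1. *)
  apply: lbnd_pbnd => s l sk; have := HC1 n 0 s l sk.
  rewrite normr0 addr0 expr1n mulr1 (_ : (fun l => _) = psi n) //.
  by apply/funext => x; rewrite /ech edot0l expi0 mulr1.
have Spsi n : fourier_dist T phi = @fourier_cst R d * transpose_iter P n T (Ftr (psi n)).
  rewrite -(fourier_distE (strong_tempered_iter P n ST) L0 (tpsi n)) (fourier_iter P n ST L0 (tpsi n)).
  congr fourier_dist; apply/funext => l; rewrite /psi mulrA -exprMn.
  by have [/HQ[-> _]|/phiA ->] := pselect (fsupport phi l); rewrite ?expr1n ?mul1r ?mulr0.
apply/eqP; rewrite -normc_eq0 eq_le normc_ge0 andbT.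
have q01 : 0 <= r / R1 < 1 by rewrite divr_ge0 ?(ltW R10) //= ltr_pdivrMr // mul1r.
pose K := normc (@fourier_cst R d) * (2 * (C * (1 + d%:R) ^+ N * (C2 * C1) * pi ^+ d)).
have d0 : 0 <= (1 + d%:R : R) ^+ N by rewrite exprn_ge0 // addr_ge0.
have K0 : 0 <= K by rewrite !mulr_ge0 ?normc_ge0 // exprn_ge0 // pi_ge0.
apply: (geometric_squeeze (p := (N + k)%N) q01 K0) => n n0.
rewrite (Spsi n) normcM /K -!mulrA ler_wpM2l ?normc_ge0 //.
pose A := C * (1 + d%:R) ^+ N * (n.+1%:R ^+ N * r ^+ n).
pose M := C2 * (C1 * (n.+1%:R ^+ k * R1^-1 ^+ n)).
have A0 : 0 <= A by rewrite !mulr_ge0 // exprn_ge0.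
have HA x : normc (iter n (diffop P) f x) <= A * (1 + `|x|) ^+ N.
  apply: le_trans (gf n x n0) _.
  rewrite [leRHS](_ : _ = C * n.+1%:R ^+ N * r ^+ n * ((1 + d%:R) ^+ N * (1 + `|x|) ^+ N)).
    apply: ler_pM; rewrite ?mulr_ge0 ?exprn_ge0 ?addr_ge0 ?sqrtr_ge0 ?enorm1_le //.
    by rewrite ler_wpM2r ?exprn_ge0 // ler_wpM2l // lerXn2r ?nnegrE ?ler_nat.
  by rewrite /A; ring.
have HM x : (1 + `|x|) ^+ k * normc (Ftr (psi n) x) <= M.
  exact: (HC2 _ _ (tpsi n) (psib n) [::] x (leq0n _)).
apply: le_trans (represents_bound (smooth_cont (smooth_iter P n Sf)) (strong_tempered_iter P n ST)
  (represents_iter P n Sf fT) A0 HA (sschwartz_Ftr L0 (tpsi n)) HM) _.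
rewrite le_eqVlt; apply/orP; left; apply/eqP; rewrite /A /M exprD expr_div_n exprVn; ring.
Qed.

End GrowthSupport.

Theorem theorem2p12 (R : realType) (d : nat)
    (f : 'rV[R]_d -> R[i]) (T : ('rV[R]_d -> R[i]) -> R[i])
    (P : mpoly.mpoly d R[i]) (R0 : R)
    (f_smooth : smooth f)
    (T_tempered : tempered_distribution T)
    (f_T : represents f T)
    (R0_ge0 : 0 <= R0)
    (K_compact : compact (sublevel P R0)) :
  (dist_support (fourier_dist T) `<=` sublevel P R0 <->
   forall r : R, R0 < r ->
     exists (N : nat) (C : R), 0 <= C /\ growth_bound P f r C N) /\
  (dist_support (fourier_dist T) `<=` sublevel P R0 ->
   exists N : nat, has_order (fourier_dist T) N /\
     forall r : R, R0 < r -> exists C : R, 0 <= C /\ growth_bound P f r C N).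
Proof.
have ST := tempered_strong T_tempered.
have forward : dist_support (fourier_dist T) `<=` sublevel P R0 ->
    exists N : nat, has_order (fourier_dist T) N /\
      forall r : R, R0 < r -> exists C : R, 0 <= C /\ growth_bound P f r C N.
  move=> supT; have [N oN] := fourier_dist_has_order ST; exists N; split=> // r R0r.
  exact: (growth_le_spectral f_smooth ST f_T K_compact supT oN.1 R0_ge0 R0r).
split=> //; split=> [/forward[N [_ HN]] r R0r|growth l0 sl0].
  by have [C HC] := HN r R0r; exists N, C.
rewrite /sublevel /= leNgt; apply/negP => Pl0; apply: sl0.
(* Thirds of the gap give R0 < r < R1 < a: growth is assumed for r, and the open set |P| > R1
   contains l0. *)
pose a := normc (symbol P l0); pose r := R0 + (a - R0) / 3; pose R1 := R0 + 2 * (a - R0) / 3.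
have aR : 0 < a - R0 by rewrite subr_gt0.
have [N [C [C0 gf]]] : exists N C, 0 <= C /\ growth_bound P f r C N.
  by apply: growth; rewrite /r; lra.
exists [set l | R1 < normc (symbol P l)]; split.
- exact: open_symbol_gt.
- by rewrite /= -/a /R1; lra.
move=> phi tphi supp.
apply: (fourier_dist_growth f_smooth ST f_T _ _ C0 gf tphi supp); rewrite /r /R1; lra.
Qed.
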